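(* Let $K$ be a field complete with respect to a non-trivial non-Archimedean valuation $v\colon K\to\mathbb{R}\cup\{+\infty\}$, with valuation ring $R$, maximal ideal $\mathfrak{m}$ and residue field $k$. Let $I$ be an ideal of $\mathcal{R}_n=R\langle x_1,\dots,x_n\rangle$, let $I^{\mathrm{ec}}$ be its saturation, $I^{\mathrm{e}}=I\cdot\mathcal{T}_n$ its extension to $\mathcal{T}_n=K\langle x_1,\dots,x_n\rangle$, and $\overline{I^{\mathrm{ec}}}\subset k[x_1,\dots,x_n]$ the reduction of $I^{\mathrm{ec}}$ modulo $\mathfrak{m}$. (i) If $I\cap R=(0)$, then (Krull dimensions) $$\dim(\mathcal{T}_n/I^{\mathrm{e}})=\dim\bigl(k[x_1,\dots,x_n]/\overline{I^{\mathrm{ec}}}\bigr)=\dim(\mathcal{R}_n/I^{\mathrm{ec}})-1.$$ (ii) For every ideal $I$ of $\mathcal{R}_n$ the following are equivalent: 1) the power series in $I$ have finitely many common zeros in $(\mathcal{O}_{K^c})^n$, where $K^c$ is a completion of an algebraic closure of $K$ and $\mathcal{O}_{K^c}$ is its ring of integers; 2) the subvariety of $\mathbb{A}^n_k$ defined by $\overline{I^{\mathrm{ec}}}$ has dimension zero or is empty; 3) the $k$-vector space $k[x_1,\dots,x_n]/\overline{I^{\mathrm{ec}}}$ is finite-dimensional; 4) the $R$-module $\mathcal{R}_n/I^{\mathrm{ec}}$ is finitely generated; 5) the $K$-vector space $\mathcal{T}_n/I^{\mathrm{e}}$ is finite-dimensional.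
   Context: $R=\{a\in K: v(a)\ge0\}$, $\mathfrak{m}=\{a\in K: v(a)>0\}$, $k=R/\mathfrak{m}$; the valuation may be non-discrete. $\mathcal{T}_n=K\langle x_1,\dots,x_n\rangle$ is the Tate algebra of power series $\sum a_Ix^I$ with $a_I\in K$ and $v(a_I)\to+\infty$ as $|I|\to+\infty$; $\mathcal{R}_n$ is the subring of such series with all $a_I\in R$. The saturation of $I$ is $I^{\mathrm{ec}}=\{f\in\mathcal{R}_n:\exists\, r\in R\setminus\{0\},\ rf\in I\}=I^{\mathrm{e}}\cap\mathcal{R}_n$. Reduction modulo $\mathfrak{m}$ reduces each coefficient, giving a polynomial in $k[x_1,\dots,x_n]$; $\overline{I^{\mathrm{ec}}}$ is the image of $I^{\mathrm{ec}}$ under this map. *)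

(* Defs.v *)
From HB Require Import structures.
From mathcomp Require Import all_boot all_order all_algebra.
From mathcomp Require Import boolp classical_sets functions cardinality.
From mathcomp Require Import reals ereal.
(* The notations of mpoly clash with those of constructive_ereal. *)
From mathcomp Require Import -(notations) mpoly.

Set Implicit Arguments.
Unset Strict Implicit.
Unset Printing Implicit Defensive.

Import Order.TTheory GRing.Theory Num.Theory.
Local Open Scope classical_set_scope.
Local Open Scope ring_scope.
Local Open Scope quotient_scope.

Record ideal (A : comPzRingType) := Ideal {
  ideal_set :> A -> Prop;
  ideal0 : ideal_set 0;
  idealD : forall x y, ideal_set x -> ideal_set y -> ideal_set (x + y);
  idealM : forall a x, ideal_set x -> ideal_set (a * x) }.

Section Quotient.
Variables (A : comPzRingType) (J : ideal A).

Lemma idealN x : J x -> J (- x).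
Proof. by rewrite -mulN1r; exact: idealM. Qed.

Definition ideal_pred : {pred A} := fun x => `[< J x >].

Fact ideal_zmod_closed : zmod_closed ideal_pred.
Proof.
split=> [|x y]; first by apply/asboolP; exact: ideal0.
move=> /asboolP Jx /asboolP Jy; apply/asboolP.
by apply: idealD => //; exact: idealN.
Qed.
HB.instance Definition _ :=
  GRing.isZmodClosed.Build A ideal_pred ideal_zmod_closed.

(* ring_quotient only has the ring structure for proper ideals. *)
Definition quotient : Type := Quotient.quot ideal_pred.
HB.instance Definition _ := GRing.Zmodule.on quotient.

Definition quotient_map (x : A) : quotient := \pi_(Quotient.quot ideal_pred) x.

Lemma quotient_map_eq x y : quotient_map x = quotient_map y <-> J (x - y).
Proof.
split=> [/eqP|Jxy]; last apply/eqP; rewrite /quotient_map -Quotient.idealrBE.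
  by move/asboolP.
exact/asboolP.
Qed.

Lemma quotient_map_surj (q : quotient) : exists x, q = quotient_map x.
Proof. by exists (repr q); rewrite /quotient_map reprK. Qed.

Fact quotient_map_additive : zmod_morphism quotient_map.
Proof. by move=> x y; rewrite /quotient_map raddfB. Qed.
HB.instance Definition _ :=
  GRing.isZmodMorphism.Build A quotient quotient_map quotient_map_additive.

Definition quotient_mul (p q : quotient) : quotient :=
  quotient_map (repr p * repr q).

Lemma quotient_mulE x y :
  quotient_mul (quotient_map x) (quotient_map y) = quotient_map (x * y).
Proof.
apply/quotient_map_eq; set x' := repr _; set y' := repr _.
have Jx : J (x' - x) by apply/quotient_map_eq; rewrite /x' /quotient_map reprK.
have Jy : J (y' - y) by apply/quotient_map_eq; rewrite /y' /quotient_map reprK.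
have -> : x' * y' - x * y = y' * (x' - x) + x * (y' - y).
  by rewrite !mulrBr (mulrC y') (mulrC y') addrA subrK.
by apply: idealD; exact: idealM.
Qed.

Fact quotient_mulA : associative quotient_mul.
Proof.
move=> p q r; have [x ->] := quotient_map_surj p.
have [y ->] := quotient_map_surj q; have [z ->] := quotient_map_surj r.
by rewrite !quotient_mulE mulrA.
Qed.
Fact quotient_mulC : commutative quotient_mul.
Proof.
move=> p q; have [x ->] := quotient_map_surj p.
by have [y ->] := quotient_map_surj q; rewrite !quotient_mulE mulrC.
Qed.
Fact quotient_mul1 : left_id (quotient_map 1) quotient_mul.
Proof.
by move=> p; have [x ->] := quotient_map_surj p; rewrite quotient_mulE mul1r.
Qed.
Fact quotient_mulD : left_distributive quotient_mul +%R.
Proof.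
move=> p q r; have [x ->] := quotient_map_surj p.
have [y ->] := quotient_map_surj q; have [z ->] := quotient_map_surj r.
by rewrite -raddfD !quotient_mulE mulrDl raddfD.
Qed.
HB.instance Definition _ := GRing.Zmodule_isComPzRing.Build quotient
  quotient_mulA quotient_mulC quotient_mul1 quotient_mulD.

Fact quotient_map_multiplicative : monoid_morphism quotient_map.
Proof. by split=> // x y; rewrite -quotient_mulE. Qed.
HB.instance Definition _ :=
  GRing.isMonoidMorphism.Build A quotient quotient_map
    quotient_map_multiplicative.

End Quotient.

Section Dimension.
Variable R : realType.

(* Supremum of the lengths m of the strict chains c 0 < ... < c m of members
   of F; it is -oo if F is empty. *)
Definition chain_dim (T : Type) (F : set (set T)) : \bar R :=
  ereal_sup [set (m%:R)%:E | m in [set m : nat |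
    exists c : nat -> set T, (forall i, (i <= m)%N -> F (c i)) /\
                             (forall i, (i < m)%N -> c i `<` c i.+1)]].

Definition prime_ideal (A : comPzRingType) (P : ideal A) : Prop :=
  ~ P 1 /\ forall x y, P (x * y) -> P x \/ P y.

Definition krull_dim (A : comPzRingType) : \bar R :=
  chain_dim [set (ideal_set P : set A) | P in @prime_ideal A].

Section Zariski.
Variable A : comPzRingType.

(* Closed subset of Spec A defined by S; the points of Spec A are the
   prime ideals. *)
Definition vanishing_locus (S : set A) : set (ideal A) :=
  [set P | prime_ideal P /\ S `<=` ideal_set P].

Definition zariski_closed (Z : set (ideal A)) : Prop :=
  exists S, Z = vanishing_locus S.

Definition zariski_irreducible (Z : set (ideal A)) : Prop :=
  Z !=set0 /\ forall Z1 Z2, zariski_closed Z1 -> zariski_closed Z2 ->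
    Z `<=` Z1 `|` Z2 -> Z `<=` Z1 \/ Z `<=` Z2.

Definition zariski_dim (Z : set (ideal A)) : \bar R :=
  chain_dim [set Y | [/\ zariski_closed Y, zariski_irreducible Y & Y `<=` Z]].

End Zariski.
End Dimension.

(* B is finitely generated as an A-module, A acting through phi. *)
Definition module_finite (A B : pzRingType) (phi : {rmorphism A -> B}) : Prop :=
  exists s : seq B, forall b : B, exists c : 'I_(size s) -> A,
    b = \sum_(i < size s) phi (c i) * s`_i.

Section Extension.
Variables (A B : comPzRingType) (phi : {rmorphism A -> B}) (J : ideal A).

Definition extension_set : set B :=
  [set b | exists2 s : seq (B * A), {in s, forall p, J p.2} &
             b = \sum_(p <- s) p.1 * phi p.2].

Fact extension0 : extension_set 0.
Proof. by exists [::] => //; rewrite big_nil. Qed.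
Fact extensionD x y :
  extension_set x -> extension_set y -> extension_set (x + y).
Proof.
move=> [s Js ->] [t Jt ->]; exists (s ++ t); last by rewrite big_cat.
by move=> p; rewrite mem_cat => /orP[/Js|/Jt].
Qed.
Fact extensionM a x : extension_set x -> extension_set (a * x).
Proof.
move=> [s Js ->]; exists [seq (a * p.1, p.2) | p <- s].
  by move=> _ /mapP[p /Js Jp ->].
by rewrite big_map mulr_sumr; apply: eq_bigr => p _ /=; rewrite mulrA.
Qed.
Definition extension : ideal B := Ideal extension0 extensionD extensionM.

End Extension.

Section Valuation.
Variables (R : realType) (K : fieldType).

Record valuation := Valuation {
  valuation_fun :> K -> \bar R;
  valuationNy : forall x, valuation_fun x != -oo%E;
  valuation_eqy : forall x, valuation_fun x = +oo%E <-> x = 0;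
  valuationM : forall x y,
    valuation_fun (x * y) = (valuation_fun x + valuation_fun y)%E;
  valuationD : forall x y,
    (Order.min (valuation_fun x) (valuation_fun y)
       <= valuation_fun (x + y)%R)%E }.

Variable v : valuation.

Definition valuation_nontrivial : Prop := exists x, x != 0 /\ v x != 0%E.

Definition valuation_cauchy (u : nat -> K) : Prop :=
  forall M : R, exists N, forall i j, (N <= i)%N -> (N <= j)%N ->
    (M%:E <= v (u i - u j)%R)%E.

Definition valuation_cvg (u : nat -> K) (l : K) : Prop :=
  forall M : R, exists N, forall i, (N <= i)%N -> (M%:E <= v (u i - l)%R)%E.

Definition valuation_complete : Prop :=
  forall u, valuation_cauchy u -> exists l, valuation_cvg u l.

Lemma valuation0 : v 0 = +oo%E.
Proof. exact/valuation_eqy. Qed.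

Lemma valuation_fin x : x != 0 -> v x \is a fin_num.
Proof.
move=> x0; rewrite fin_numE valuationNy /=.
by apply: contra_neqN x0 => /eqP /valuation_eqy.
Qed.

Lemma valuation1 : v 1 = 0%E.
Proof.
have := valuationM v 1 1; rewrite mulr1.
have /fineK <- := valuation_fin (oner_neq0 K).
rewrite -EFinD => -[] /eqP.
by rewrite -subr_eq0 opprD addNKr oppr_eq0 => /eqP->.
Qed.

Lemma valuationN1 : v (-1) = 0%E.
Proof.
have /valuation_fin/fineK E : (-1 : K) != 0 by rewrite oppr_eq0 oner_neq0.
have := valuationM v (-1) (-1); rewrite mulrNN mulr1 valuation1 -E -EFinD.
by move=> [] /esym/eqP; rewrite -mulr2n mulrn_eq0 /= => /eqP->.
Qed.

Lemma valuationN x : v (- x) = v x.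
Proof. by rewrite -mulN1r valuationM valuationN1 add0e. Qed.

Lemma valuation_geD (a : \bar R) x y :
  (a <= v x)%E -> (a <= v y)%E -> (a <= v (x + y)%R)%E.
Proof.
by move=> ax ay; apply: le_trans (valuationD v x y); rewrite le_min ax ay.
Qed.

Lemma valuation_gtD (a : \bar R) x y :
  (a < v x)%E -> (a < v y)%E -> (a < v (x + y)%R)%E.
Proof.
by move=> ax ay; apply: lt_le_trans (valuationD v x y); rewrite lt_min ax ay.
Qed.

Lemma valuation_geM (a b : R) x y :
  (a%:E <= v x)%E -> (b%:E <= v y)%E -> ((a + b)%:E <= v (x * y)%R)%E.
Proof. by move=> ax ay; rewrite valuationM EFinD leeD. Qed.

Lemma valuation_ge_sum (a : R) I (r : seq I) (P : pred I) (F : I -> K) :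
  (forall i, P i -> (a%:E <= v (F i))%E) ->
  (a%:E <= v (\sum_(i <- r | P i) F i)%R)%E.
Proof.
move=> aF; apply: (big_ind (fun x => (a%:E <= v x)%E)) => //.
  by rewrite valuation0 leey.
by move=> x y; exact: valuation_geD.
Qed.

Definition valring_pred : {pred K} := fun x => (0 <= v x)%E.

Fact valring_subring_closed : subring_closed valring_pred.
Proof.
split=> [|x y|x y]; rewrite !unfold_in.
- by rewrite valuation1.
- by move=> x0 y0; apply: valuation_geD => //; rewrite valuationN.
- by move=> x0 y0; rewrite valuationM adde_ge0.
Qed.
HB.instance Definition _ :=
  GRing.isSubringClosed.Build K valring_pred valring_subring_closed.

Record valring := ValRing {
  valring_val :> K; _ : valring_val \in valring_pred }.
HB.instance Definition _ := [isSub for valring_val].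
HB.instance Definition _ := [Choice of valring by <:].
HB.instance Definition _ := [SubChoice_isSubComNzRing of valring by <:].

Lemma valring_ge0 (x : valring) : (0 <= v (val x))%E.
Proof. by case: x. Qed.

Definition maximal_set : set valring := [set x | (0 < v (val x))%E].

Fact maximal0 : maximal_set 0.
Proof. by rewrite /maximal_set /= valuation0 ltey. Qed.
Fact maximalD x y : maximal_set x -> maximal_set y -> maximal_set (x + y).
Proof. exact: valuation_gtD. Qed.
Fact maximalM a x : maximal_set x -> maximal_set (a * x).
Proof.
rewrite /maximal_set /= valuationM => x0.
by apply: (lt_le_trans x0); rewrite leeDr // valring_ge0.
Qed.
Definition maximal_ideal : ideal valring := Ideal maximal0 maximalD maximalM.

Definition residue_field : Type := quotient maximal_ideal.
HB.instance Definition _ := GRing.ComPzRing.on residue_field.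

Definition residue (x : valring) : residue_field :=
  quotient_map maximal_ideal x.
HB.instance Definition _ :=
  GRing.RMorphism.copy residue
    (quotient_map maximal_ideal).

Lemma residue_eq0 x : residue x = 0 <-> (0 < v (val x))%E.
Proof.
have := @quotient_map_eq _ maximal_ideal x 0.
by rewrite subr0 raddf0.
Qed.

Lemma residue_surj (q : residue_field) : exists x, q = residue x.
Proof. exact: quotient_map_surj. Qed.

Fact residue_field_nonzero : (1 : residue_field) != 0.
Proof.
apply/eqP; rewrite -(rmorph1 residue) => /residue_eq0 /=.
by rewrite valuation1 ltxx.
Qed.
HB.instance Definition _ :=
  GRing.PzSemiRing_isNonZero.Build residue_field residue_field_nonzero.

Fact residue_has_inv (x : residue_field) : x != 0 -> exists y, y * x = 1.
Proof.
have [a ->] := residue_surj x; move=> /eqP a0.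
have va : v (val a) = 0%E.
  apply/eqP; rewrite eq_le valring_ge0 andbT leNgt.
  by apply/negP => /residue_eq0.
have a1 : val a != 0.
  by apply/eqP => a1; move: va; rewrite a1 valuation0.
have vV : v (val a)^-1 = 0%E.
  have := valuationM v (val a)^-1 (val a).
  by rewrite mulVf // valuation1 va adde0.
have b0 : (val a)^-1 \in valring_pred by rewrite unfold_in vV.
exists (residue (ValRing b0)); rewrite -rmorphM -(rmorph1 residue).
by congr residue; apply: val_inj; rewrite /= mulVf.
Qed.

Definition residue_inv (x : residue_field) : residue_field :=
  xget 0 [set y | y * x = 1].

Fact residue_mulVf x : x != 0 -> residue_inv x * x = 1.
Proof.
move=> /residue_has_inv[y yx]; rewrite /residue_inv.
by case: xgetP => [z _ ->//|/(_ y)].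
Qed.
Fact residue_inv0 : residue_inv 0 = 0.
Proof.
rewrite /residue_inv; case: xgetP => // y _ /= /eqP.
by rewrite mulr0 eq_sym oner_eq0.
Qed.
HB.instance Definition _ :=
  GRing.ComNzRing_isField.Build residue_field residue_mulVf residue_inv0.

End Valuation.

Section MPSeries.
Variables (n : nat) (A : comNzRingType).

Record mpseries := MPSeries { pscoef :> multinom n -> A }.
HB.instance Definition _ := [isNew for pscoef].
HB.instance Definition _ := [Choice of mpseries by <:].

Lemma mpseriesP (f g : mpseries) : (forall m, f m = g m) -> f = g.
Proof. by case: f g => [f] [g] /= fg; congr MPSeries; exact/funext. Qed.

Definition ps_zero := MPSeries (fun=> 0).
Definition ps_add (f g : mpseries) := MPSeries (fun m => f m + g m).
Definition ps_opp (f : mpseries) := MPSeries (fun m => - f m).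
Definition psC (c : A) := MPSeries (fun m => if m == mnm0 then c else 0).
(* Each monomial dividing m has degree at most mdeg m. *)
Definition ps_mul (f g : mpseries) := MPSeries (fun m =>
  \sum_(k : bmultinom n (mdeg m).+1 * bmultinom n (mdeg m).+1
          | m == mnm_add k.1 k.2) f k.1 * g k.2).

Fact ps_addA : associative ps_add.
Proof. by move=> f g h; apply: mpseriesP => m /=; rewrite addrA. Qed.
Fact ps_addC : commutative ps_add.
Proof. by move=> f g; apply: mpseriesP => m /=; rewrite addrC. Qed.
Fact ps_add0 : left_id ps_zero ps_add.
Proof. by move=> f; apply: mpseriesP => m /=; rewrite add0r. Qed.
Fact ps_addN : left_inverse ps_zero ps_opp ps_add.
Proof. by move=> f; apply: mpseriesP => m /=; rewrite addNr. Qed.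
HB.instance Definition _ :=
  GRing.isZmodule.Build mpseries ps_addA ps_addC ps_add0 ps_addN.

Definition ps_trunc N (f : mpseries) : mpoly n A :=
  \sum_(m : bmultinom n N) f m *: mpolyX A m.

Lemma ps_truncE N f m : (mdeg m < N)%N -> mcoeff m (ps_trunc N f) = f m.
Proof. exact: mcoeff_mpoly. Qed.

Lemma ps_mulE N (f g : mpseries) (p q : mpoly n A) m : (mdeg m < N)%N ->
  (forall k, (mdeg k < N)%N -> mcoeff k p = f k) ->
  (forall k, (mdeg k < N)%N -> mcoeff k q = g k) ->
  ps_mul f g m = mcoeff m (p * q).
Proof.
move=> mN pf qg; rewrite mcoeffM /=; apply: eq_bigr => k _.
rewrite pf ?qg //; apply: leq_trans mN; exact: bmdeg.
Qed.

Fact ps_mulA : associative ps_mul.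
Proof.
move=> f g h; apply: mpseriesP => m; pose N := (mdeg m).+1.
have t := ps_truncE (N := N).
rewrite (@ps_mulE N _ _ (ps_trunc N f) (ps_trunc N g * ps_trunc N h)) //;
  last 2 first.
- by move=> k /t.
- move=> k kN; rewrite (@ps_mulE N _ _ (ps_trunc N g) (ps_trunc N h)) //;
  by move=> l /t.
rewrite (@ps_mulE N _ _ (ps_trunc N f * ps_trunc N g) (ps_trunc N h)) ?mulrA //.
- move=> k kN; rewrite (@ps_mulE N _ _ (ps_trunc N f) (ps_trunc N g)) //;
  by move=> l /t.
- by move=> k /t.
Qed.
Fact ps_mulC : commutative ps_mul.
Proof.
move=> f g; apply: mpseriesP => m; pose N := (mdeg m).+1.
have t := ps_truncE (N := N).
rewrite (@ps_mulE N _ _ (ps_trunc N f) (ps_trunc N g)) //; try by move=> k /t.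
by rewrite mulrC -(@ps_mulE N g f) // => k /t.
Qed.
Fact ps_mul1 : left_id (psC 1) ps_mul.
Proof.
move=> f; apply: mpseriesP => m; pose N := (mdeg m).+1.
have t := ps_truncE (N := N).
rewrite (@ps_mulE N _ _ 1 (ps_trunc N f)) ?mul1r ?t // => k.
by rewrite mcoeff1 /=; case: eqP.
by move=> /t.
Qed.
Fact ps_mulD : left_distributive ps_mul +%R.
Proof.
move=> f g h; apply: mpseriesP => m; pose N := (mdeg m).+1.
have t := ps_truncE (N := N).
rewrite (@ps_mulE N _ _ (ps_trunc N f + ps_trunc N g) (ps_trunc N h)) //;
  last 2 first.
- by move=> k kN; rewrite mcoeffD !t.
- by move=> k /t.
rewrite mulrDl mcoeffD; congr (_ + _); apply/esym.
  by apply: (@ps_mulE N f h) => // k /t.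
by apply: (@ps_mulE N g h) => // k /t.
Qed.
Fact ps_1neq0 : psC 1 != 0.
Proof.
apply/eqP => /(congr1 (fun f : mpseries => f mnm0)) /=.
by rewrite eqxx; apply/eqP; exact: oner_neq0.
Qed.
HB.instance Definition _ := GRing.Zmodule_isComNzRing.Build mpseries
  ps_mulA ps_mulC ps_mul1 ps_mulD ps_1neq0.

Fact psC_additive : zmod_morphism psC.
Proof.
by move=> a b; apply: mpseriesP => m /=; case: eqP => //; rewrite subr0.
Qed.
Fact psC_multiplicative : monoid_morphism psC.
Proof.
split=> // a b; apply: mpseriesP => m; pose N := (mdeg m).+1.
have C c k : mcoeff k (mpolyC n c) = psC c k.
  by rewrite mcoeffC /=; case: eqP => _; rewrite ?mulr1 ?mulr0.
rewrite [RHS](@ps_mulE N _ _ (mpolyC n a) (mpolyC n b)) // -rmorphM.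
exact/esym/C.
Qed.
HB.instance Definition _ :=
  GRing.isZmodMorphism.Build A mpseries psC psC_additive.
HB.instance Definition _ :=
  GRing.isMonoidMorphism.Build A mpseries psC psC_multiplicative.

End MPSeries.

(* The Tate algebra of convergent series with coefficients in K is tate; its
   subring of series with coefficients in the valuation ring is itate. *)
Section Tate.
Variables (R : realType) (K : fieldType) (v : valuation R K) (n : nat).

Definition tate_cvg (f : mpseries n K) : Prop :=
  forall M : R, exists N, forall m, (N <= mdeg m)%N -> (M%:E <= v (f m))%E.

Definition tate_pred : {pred mpseries n K} := fun f => `[< tate_cvg f >].

Lemma tate_bounded f : tate_cvg f ->
  exists B : R, forall m, (B%:E <= v (f m))%E.
Proof.
move=> /(_ 0)[N fN].
exists (\big[Order.min/0]_(m : bmultinom n N | f m != 0) fine (v (f m))) => m.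
have [mN|Nm] := ltnP (mdeg m) N; last first.
  by apply: (le_trans _ (fN _ Nm)); rewrite lee_fin; exact: bigmin_le_id.
have [->|f0] := eqVneq (f m) 0; first by rewrite valuation0 leey.
have /fineK <- := valuation_fin v f0; rewrite lee_fin.
exact: (bigmin_le_cond _ (j := BMultinom mN)).
Qed.

Fact tate_subring_closed : subring_closed tate_pred.
Proof.
split=> [|f g /asboolP cf /asboolP cg|f g /asboolP cf /asboolP cg].
- apply/asboolP => M; exists 1%N => m m0 /=.
  case: eqP => [m00|_]; last by rewrite valuation0 leey.
  by move: m0; rewrite m00 mdeg0.
- apply/asboolP => M; have [Nf hf] := cf M; have [Ng hg] := cg M.
  exists (maxn Nf Ng) => m; rewrite geq_max => /andP[/hf ? /hg ?].
  by apply: valuation_geD => //; rewrite valuationN.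
- apply/asboolP => M.
  have [Bf bf] := tate_bounded cf; have [Bg bg] := tate_bounded cg.
  have [Nf hf] := cf (M - Bg); have [Ng hg] := cg (M - Bf).
  exists (Nf + Ng)%N => m mN /=; apply: valuation_ge_sum => k /eqP mk.
  have : (Nf <= mdeg k.1)%N || (Ng <= mdeg k.2)%N.
    have mE : mdeg m = (mdeg k.1 + mdeg k.2)%N by rewrite -mdegD -mk.
    apply: contraTT mN; rewrite -ltnNge [X in (X < _)%N]mE.
    by rewrite negb_or -!ltnNge => /andP[kf kg]; rewrite -addnS leq_add // ltnW.
  case/orP=> [/hf|/hg] h.
    by rewrite -(subrK Bg M); exact: valuation_geM.
  by rewrite -(subrK Bf M) addrC; exact: valuation_geM.
Qed.
HB.instance Definition _ :=
  GRing.isSubringClosed.Build (mpseries n K) tate_pred tate_subring_closed.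

Record tate := Tate { tate_val :> mpseries n K; _ : tate_val \in tate_pred }.
HB.instance Definition _ := [isSub for tate_val].
HB.instance Definition _ := [Choice of tate by <:].
HB.instance Definition _ := [SubChoice_isSubComNzRing of tate by <:].

Lemma tateP (f : tate) : tate_cvg f.
Proof. by case: f => f /= /asboolP. Qed.

Fact psC_tate c : psC n c \in tate_pred.
Proof.
apply/asboolP => M; exists 1%N => m m0 /=.
case: eqP => [m00|_]; last by rewrite valuation0 leey.
by move: m0; rewrite m00 mdeg0.
Qed.
Definition tateC (c : K) : tate := Tate (psC_tate c).
Fact tateC_additive : zmod_morphism tateC.
Proof. by move=> a b; apply: val_inj; rewrite /= -raddfB. Qed.
Fact tateC_multiplicative : monoid_morphism tateC.
Proof. by split=> [|a b]; apply: val_inj; rewrite //= -rmorphM. Qed.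
HB.instance Definition _ :=
  GRing.isZmodMorphism.Build K tate tateC tateC_additive.
HB.instance Definition _ :=
  GRing.isMonoidMorphism.Build K tate tateC tateC_multiplicative.

Definition itate_pred : {pred tate} :=
  fun f => `[< forall m, (0 <= v (f m))%E >].

Fact itate_subring_closed : subring_closed itate_pred.
Proof.
split=> [|f g /asboolP cf /asboolP cg|f g /asboolP cf /asboolP cg].
- apply/asboolP => m /=; case: eqP => _; first by rewrite valuation1.
  by rewrite valuation0 leey.
- by apply/asboolP => m; apply: valuation_geD => //; rewrite valuationN.
- apply/asboolP => m /=; apply: valuation_ge_sum => k _.
  by rewrite -[0]addr0; exact: valuation_geM.
Qed.
HB.instance Definition _ :=
  GRing.isSubringClosed.Build tate itate_pred itate_subring_closed.

Record itate := ITate { itate_val :> tate; _ : itate_val \in itate_pred }.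
HB.instance Definition _ := [isSub for itate_val].
HB.instance Definition _ := [Choice of itate by <:].
HB.instance Definition _ := [SubChoice_isSubComNzRing of itate by <:].

Lemma itate_ge0 (f : itate) m : (0 <= v (f m))%E.
Proof. by case: f => f /= /asboolP. Qed.

Definition itate_incl (f : itate) : tate := val f.
HB.instance Definition _ :=
  GRing.RMorphism.copy itate_incl (val : itate -> tate).

Fact tateC_itate (c : valring v) : tateC (val c) \in itate_pred.
Proof.
apply/asboolP => m /=; case: eqP => _; first exact: valring_ge0.
by rewrite valuation0 leey.
Qed.
Definition itateC (c : valring v) : itate := ITate (tateC_itate c).
Fact itateC_additive : zmod_morphism itateC.
Proof. by move=> a b; apply: val_inj; exact: (raddfB tateC). Qed.
Fact itateC_multiplicative : monoid_morphism itateC.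
Proof.
split=> [|a b]; apply: val_inj; first exact: (rmorph1 tateC).
exact: (rmorphM tateC).
Qed.
HB.instance Definition _ :=
  GRing.isZmodMorphism.Build (valring v) itate itateC itateC_additive.
HB.instance Definition _ :=
  GRing.isMonoidMorphism.Build (valring v) itate itateC itateC_multiplicative.

Section Saturation.
Variable I : ideal itate.

Definition saturation_set : set itate :=
  [set f | exists2 r : valring v, r != 0 & I (itateC r * f)].

Fact saturation0 : saturation_set 0.
Proof. by exists 1; rewrite ?oner_neq0 // mulr0; exact: ideal0. Qed.
Fact saturationD f g :
  saturation_set f -> saturation_set g -> saturation_set (f + g).
Proof.
move=> [r r0 If] [s s0 Ig]; exists (r * s).
  by rewrite -(inj_eq val_inj) /= mulf_neq0 // (inj_eq val_inj).
rewrite rmorphM mulrDr; apply: idealD.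
  by rewrite (mulrC (itateC r)) -mulrA; exact: idealM.
by rewrite -mulrA; exact: idealM.
Qed.
Fact saturationM a f : saturation_set f -> saturation_set (a * f).
Proof. by move=> [r r0 If]; exists r => //; rewrite mulrCA; exact: idealM. Qed.
Definition saturation : ideal itate :=
  Ideal saturation0 saturationD saturationM.

End Saturation.

Definition itate_coef (f : itate) (m : multinom n) : valring v :=
  ValRing (itate_ge0 f m : f m \in valring_pred v).

Fact reduction_bound (f : itate) :
  exists N, forall m, (N <= mdeg m)%N -> residue (itate_coef f m) = 0.
Proof.
have [N fN] := tateP f 1; exists N => m /fN fm.
by apply/residue_eq0; apply: lt_le_trans fm; rewrite lte_fin.
Qed.

Definition reduction (f : itate) : mpoly n (residue_field v) :=
  \sum_(m : bmultinom n (sval (cid (reduction_bound f))))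
    residue (itate_coef f m) *: mpolyX (residue_field v) m.

Lemma mcoeff_reduction f m : mcoeff m (reduction f) = residue (itate_coef f m).
Proof.
rewrite /reduction; case: cid => N /= fN.
have [mN|Nm] := ltnP (mdeg m) N.
  exact: (mcoeff_mpoly (fun m => residue (itate_coef f m))).
rewrite fN // raddf_sum big1 // => k _ /=; rewrite mcoeffZ mcoeffX.
case: eqP => [km|_]; last by rewrite mulr0.
by have := bmdeg k; rewrite km ltnNge Nm.
Qed.

Fact reduction_additive : zmod_morphism reduction.
Proof.
move=> f g; apply/mpolyP => m; rewrite mcoeffB !mcoeff_reduction -raddfB.
by congr residue; exact: val_inj.
Qed.
Fact reduction_multiplicative : monoid_morphism reduction.
Proof.
split=> [|f g]; apply/mpolyP => m.
  rewrite mcoeff_reduction mcoeff1; case: (eqVneq m mnm0) => m0.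
    rewrite -(rmorph1 (@residue _ _ v)); congr residue; apply: val_inj => /=.
    by rewrite m0 eqxx.
  rewrite mulr0n -(raddf0 (@residue _ _ v)); congr residue.
  apply: val_inj => /=.
  by rewrite (negbTE m0).
rewrite mcoeff_reduction mcoeffM.
under eq_bigr do rewrite !mcoeff_reduction -rmorphM.
rewrite -raddf_sum; congr residue; apply: val_inj.
by rewrite (raddf_sum (val : valring v -> K)).
Qed.
HB.instance Definition _ := GRing.isZmodMorphism.Build itate
  (mpoly n (residue_field v)) reduction reduction_additive.
HB.instance Definition _ := GRing.isMonoidMorphism.Build itate
  (mpoly n (residue_field v)) reduction reduction_multiplicative.

Lemma reduction_surj p : exists f, reduction f = p.
Proof.
pose c m : valring v := if mcoeff m p == 0 then 0 else
  sval (cid (residue_surj (mcoeff m p))).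
have cE m : residue (c m) = mcoeff m p.
  rewrite /c; case: eqP => [->|_]; first by rewrite raddf0.
  by case: cid.
pose g : mpseries n K := MPSeries (fun m => val (c m)).
have gT : g \in tate_pred.
  apply/asboolP => M; exists (msize p) => m pm.
  rewrite /= /c memN_msupp_eq0 ?eqxx /= ?valuation0 ?leey //.
  by apply/negP => /msize_mdeg_lt; rewrite ltnNge pm.
have gI : Tate gT \in itate_pred by apply/asboolP => m; exact: valring_ge0.
exists (ITate gI); apply/mpolyP => m; rewrite mcoeff_reduction -cE.
by congr residue; exact: val_inj.
Qed.

Section Reduced.
Variable J : ideal itate.

Definition reduced_set : set (mpoly n (residue_field v)) :=
  [set reduction f | f in (J : set itate)].

Fact reduced0 : reduced_set 0.
Proof. by exists 0; [exact: ideal0 | exact: raddf0]. Qed.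
Fact reducedD p q : reduced_set p -> reduced_set q -> reduced_set (p + q).
Proof.
move=> [f Jf <-] [g Jg <-]; exists (f + g); first exact: idealD.
exact: raddfD.
Qed.
Fact reducedM a p : reduced_set p -> reduced_set (a * p).
Proof.
move=> [f Jf <-]; have [b <-] := reduction_surj a.
by exists (b * f); [exact: idealM | exact: rmorphM].
Qed.
Definition reduced_ideal : ideal (mpoly n (residue_field v)) :=
  Ideal reduced0 reducedD reducedM.

End Reduced.

(* A completion of an algebraic closure of K, with the extension of v. *)
Record completed_algebraic_closure := CompletedAlgebraicClosure {
  cac_closure : closedFieldType;
  cac_base : {rmorphism K -> cac_closure};
  cac_algebraic : forall x, algebraicOver cac_base x;
  cac_field : fieldType;
  cac_val : valuation R cac_field;
  cac_incl : {rmorphism cac_closure -> cac_field};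
  cac_extends : forall x, cac_val (cac_incl (cac_base x)) = v x;
  cac_complete : valuation_complete cac_val;
  cac_dense : forall (y : cac_field) (M : R), exists x,
    (M%:E <= cac_val (y - cac_incl x)%R)%E }.

Section Zeros.
Variable C : completed_algebraic_closure.

Definition tate_partial_sum (f : tate) (x : 'I_n -> cac_field C) (N : nat) :
    cac_field C :=
  \sum_(m : bmultinom n N) cac_incl C (cac_base C (f m)) * mmap1 x m.

(* The series f converges to y at the point x. *)
Definition tate_eval (f : tate) (x : 'I_n -> cac_field C) (y : cac_field C) :
    Prop :=
  valuation_cvg (cac_val C) (tate_partial_sum f x) y.

Definition integral_zeros (I : ideal itate) : set ('I_n -> cac_field C) :=
  [set x | (forall i, (0 <= cac_val C (x i))%E) /\
           forall f : itate, I f -> tate_eval f x 0].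

End Zeros.
End Tate.

Arguments tateC {R K} v n c.
Arguments itateC {R K} v n c.
Arguments itate_incl {R K} v n f.
Arguments integral_zeros {R K v n} C I.

(* Main.v *)
From HB Require Import structures.
Require Import Defs.
From mathcomp Require Import all_boot all_order all_algebra.
From mathcomp Require Import boolp classical_sets functions cardinality.
From mathcomp Require Import reals ereal.
From mathcomp Require Import -(notations) mpoly.
From mathcomp Require Import ring.

Set Implicit Arguments.
Unset Strict Implicit.
Unset Printing Implicit Defensive.

Import Order.TTheory GRing.Theory Num.Theory.
Local Open Scope classical_set_scope.
Local Open Scope ring_scope.

(* Let J be the reduction of the saturation of I. Noether normalization gives a
   finite injective map k[y_1..y_d] -> k[x_1..x_n] / J. Lifting the y_i to R_n
   defines a continuous substitution morphism R_d -> R_n; finiteness lifts by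
   successive approximation, and injectivity lifts because a nonzero series can
   be scaled to have a nonzero reduction. So T_d -> T_n / I^e is also finite and
   injective. Polynomial rings and Tate algebras in d variables have dimension d
   by induction (a nonzero prime P of T_d has a normalization T_e -> T_d / P with
   e < d), so going up and incomparability identify both dimensions with d. A
   prime of R_n either meets R in 0 and comes from T_n, or meets R in m and comes
   from k[x]; this gives dimension d + 1 for R_n / I^ec. In (ii) all conditions
   amount to d = 0 or I^e = (1): if d > 0, each choice of values in R for the y_i
   is the image of a common zero of I. *)

(** * Ideals *)

(** The valuation may be dense, so R_n need not be Noetherian, its ideals need not be finitely
    generated or closed, and the maximal ideal of R need not be principal: there is no uniformizer
    to work with. The substitute is that the coefficients of a convergent series attain their least
    valuation. Hence a nonzero series can be scaled to one with nonzero reduction, and finitely many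
    series in the kernel of the reduction share one constant divisor [c] of positive valuation.
    Successive approximation is then [c]-adic, for a [c] adapted to the finitely many relations at
    hand. Finiteness, injectivity and dimension are expressed relative to an ideal of the target
    ring, not in a quotient ring. One ring then serves all the ideals and primes that occur, and
    quotients appear only when the final statements are translated. The condition that I meets R in
    0 makes I^e proper. *)

Section IdealTheory.
Variable A : comPzRingType.
Implicit Types I J P Q : ideal A.

Lemma ideal_eq I J : (forall x, I x <-> J x) -> I = J.
Proof.
case: I J => [I I0 ID IM] [J J0 JD JM] /= IJ.
have E : I = J by apply/funext => x; exact/propext.
by subst J; congr Ideal; exact: Prop_irrelevance.
Qed.

Lemma idealB J x y : J x -> J y -> J (x - y).
Proof. by move=> Jx Jy; apply: idealD => //; exact: idealN. Qed.

Lemma idealMC J x a : J x -> J (x * a).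
Proof. by rewrite mulrC; exact: idealM. Qed.

Lemma ideal_sum J (T : Type) (r : seq T) (p : pred T) (F : T -> A) :
  (forall i, p i -> J (F i)) -> J (\sum_(i <- r | p i) F i).
Proof.
by move=> JF; apply: big_ind => //; [exact: ideal0 | exact: idealD].
Qed.

Lemma idealBC J x y : J (x - y) -> J (y - x).
Proof. by rewrite -(opprB x); exact: idealN. Qed.

Lemma ideal_trans J y x z : J (x - y) -> J (y - z) -> J (x - z).
Proof. by move=> xy yz; rewrite -(subrK y x) -addrA; exact: idealD. Qed.

Lemma ideal_congr J x y : J (x - y) -> J x <-> J y.
Proof.
move=> xy; split=> [Jx|Jy]; last by rewrite -(subrK y x); exact: idealD.
by rewrite -(subKr x y); exact: idealB.
Qed.

Lemma ideal_top J : J 1 -> forall x, J x.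
Proof. by move=> J1 x; rewrite -(mulr1 x); exact: idealM. Qed.

Lemma prime_idealX P x m : prime_ideal P -> P (x ^+ m) -> P x.
Proof.
move=> [P1 PM]; elim: m => [|m IHm]; first by rewrite expr0 => /P1.
by rewrite exprS => /PM[].
Qed.

Fact zero_ideal0 : [set 0 : A] 0. Proof. by []. Qed.
Fact zero_idealD (x y : A) : [set 0] x -> [set 0] y -> [set (0 : A)] (x + y).
Proof. by move=> -> ->; rewrite /= addr0. Qed.
Fact zero_idealM (a x : A) : [set 0] x -> [set (0 : A)] (a * x).
Proof. by move=> ->; rewrite /= mulr0. Qed.
Definition zero_ideal := Ideal zero_ideal0 zero_idealD zero_idealM.

Definition idealU_set I J : set A := [set x | exists2 y, I y & J (x - y)].
Fact idealU0 I J : idealU_set I J 0.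
Proof. by exists 0; rewrite ?subr0; exact: ideal0. Qed.
Fact idealUD I J x y :
  idealU_set I J x -> idealU_set I J y -> idealU_set I J (x + y).
Proof.
move=> [a Ia Ja] [b Ib Jb]; exists (a + b); first exact: idealD.
by rewrite opprD addrACA; exact: idealD.
Qed.
Fact idealUM I J a x : idealU_set I J x -> idealU_set I J (a * x).
Proof.
move=> [y Iy Jy]; exists (a * y); first exact: idealM.
by rewrite -mulrBr; exact: idealM.
Qed.
Definition idealU I J := Ideal (@idealU0 I J) (@idealUD I J) (@idealUM I J).

Lemma idealU_l I J x : I x -> idealU I J x.
Proof. by move=> Ix; exists x => //; rewrite subrr; exact: ideal0. Qed.
Lemma idealU_r I J x : J x -> idealU I J x.
Proof. by move=> Jx; exists 0; rewrite ?subr0 //; exact: ideal0. Qed.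

Definition principal_set a : set A := [set x | exists b, x = b * a].
Fact principal0 a : principal_set a 0. Proof. by exists 0; rewrite mul0r. Qed.
Fact principalD a x y :
  principal_set a x -> principal_set a y -> principal_set a (x + y).
Proof. by move=> [b ->] [c ->]; exists (b + c); rewrite mulrDl. Qed.
Fact principalM a c x : principal_set a x -> principal_set a (c * x).
Proof. by move=> [b ->]; exists (c * b); rewrite mulrA. Qed.
Definition principal_ideal a :=
  Ideal (@principal0 a) (@principalD a) (@principalM a).

(** Krull's argument: an ideal maximal among those that contain [J] and miss the multiplicative set
    [S] is prime. *)
Lemma exists_prime_avoiding J (S : set A) :
  S 1 -> (forall x y, S x -> S y -> S (x * y)) -> (forall x, J x -> ~ S x) ->
  exists P, [/\ prime_ideal P, J `<=` P & forall x, P x -> ~ S x].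
Proof.
move=> S1 SM JS.
(* [X] has to be an ideal only after its union with [J], so that the empty chain, whose union is
   empty, is covered by [J] itself. *)
pose good (X : set A) :=
  exists2 P, ideal_set P = J `|` X & forall x, P x -> ~ S x.
have [F Fgood Ftot|X [[P PE PS] Pmax]] := @Zorn_bigcup A good.
  have [[X0 FX0]|F0] := pselect (F !=set0); last first.
    exists J => //; apply/seteqP; split=> x; first by left.
    by case=> // -[X FX _]; case: F0; exists X.
  pose U := J `|` \bigcup_(X in F) X.
  have UF x : U x -> exists2 X, F X & (J `|` X) x.
    by case=> [Jx|[X FX Xx]]; [exists X0 => //; left|exists X => //; right].
  have FU X x : F X -> (J `|` X) x -> U x.
    by move=> FX [Jx|Xx]; [left|right; exists X].
  have U0 : U 0 by left; exact: ideal0.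
  have UD x y : U x -> U y -> U (x + y).
    move=> /UF[X FX Xx] /UF[Y FY Yy].
    have [Z [FZ Zx Zy]] : exists Z, [/\ F Z, (J `|` Z) x & (J `|` Z) y].
      have [XY|YX] := Ftot _ _ FX FY.
        by exists Y; split=> //; case: Xx; [left|right; exact: XY].
      by exists X; split=> //; case: Yy; [left|right; exact: YX].
    have [Q QE _] := Fgood _ FZ.
    by apply: FU FZ _; move: Zx Zy; rewrite -QE; exact: idealD.
  have UM a x : U x -> U (a * x).
    move=> /UF[X FX Xx]; have [Q QE _] := Fgood _ FX.
    by apply: FU FX _; move: Xx; rewrite -QE; exact: idealM.
  exists (Ideal U0 UD UM) => // x /UF[X FX Xx].
  by have [Q QE QS] := Fgood _ FX; apply: QS; rewrite QE.
have JP : J `<=` P by rewrite PE; left.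
have big x : ~ P x -> exists2 s, S s & idealU P (principal_ideal x) s.
  move=> Px; apply: contrapT => /forall2NP noS.
  pose Y := ideal_set (idealU P (principal_ideal x)).
  have Yx : Y x by apply: idealU_r; exists 1; rewrite mul1r.
  apply: (Pmax Y).
    split=> [z Xz|]; first by apply: idealU_l; rewrite PE; right.
    by move=> /(_ x Yx) Xx; apply: Px; rewrite PE; right.
  exists (idealU P (principal_ideal x)); last first.
    by move=> s Ys Ss; have [] := noS s.
  apply/seteqP; split=> z; first by right.
  by case=> // Jz; apply: idealU_l; exact: JP.
exists P; split=> //; split=> [P1|x y Pxy]; first exact: PS S1.
(* With s = p + ax and t = q + by, the product st lies in [P] because p, q and xy do. *)
apply: contrapT => /not_orP[/big[s Ss [p Pp [a sE]]] /big[t St [q Pq [b tE]]]].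
apply: (PS (s * t)); last exact: SM.
rewrite -(subrK p s) -(subrK q t) sE tE mulrDl !mulrDr mulrACA.
by apply: idealD; apply: idealD; rewrite ?(mulrC p); exact: idealM.
Qed.

Lemma exists_prime J : ~ J 1 -> exists2 P, prime_ideal P & J `<=` P.
Proof.
move=> J1; have [|x y -> ->|x Jx x1|P [Pp JP _]] :=
  @exists_prime_avoiding J [set 1] => //.
- by rewrite /= mulr1.
- by apply: J1; rewrite -x1.
- by exists P.
Qed.

End IdealTheory.

Section Contraction.
Variables (A B : comPzRingType) (phi : {rmorphism A -> B}).

Definition contraction_set (J : ideal B) : set A := [set a | J (phi a)].
Fact contraction0 J : contraction_set J 0.
Proof. by rewrite /contraction_set /= rmorph0; exact: ideal0. Qed.
Fact contractionD J x y :
  contraction_set J x -> contraction_set J y -> contraction_set J (x + y).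
Proof. by rewrite /contraction_set /= rmorphD; exact: idealD. Qed.
Fact contractionM J a x : contraction_set J x -> contraction_set J (a * x).
Proof. by rewrite /contraction_set /= rmorphM; exact: idealM. Qed.
Definition contraction (J : ideal B) : ideal A :=
  Ideal (@contraction0 J) (@contractionD J) (@contractionM J).

Lemma contraction_prime P : prime_ideal P -> prime_ideal (contraction P).
Proof.
move=> [P1 PM]; split; first by rewrite /= /contraction_set /= rmorph1.
by move=> x y; rewrite /= /contraction_set /= rmorphM; exact: PM.
Qed.

Lemma extensionW (J : ideal A) a : J a -> extension phi J (phi a).
Proof.
move=> Ja; exists [:: (1, a)]; last by rewrite big_seq1 mul1r.
by move=> p; rewrite inE => /eqP ->.
Qed.

Lemma extension_sub (J : ideal A) (Q : ideal B) :
  (forall a, J a -> Q (phi a)) -> extension phi J `<=` Q.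
Proof.
move=> JQ _ [s Js ->]; rewrite big_seq; apply: ideal_sum => p /Js Jp.
by apply: idealM; exact: JQ.
Qed.

End Contraction.

(** * Finite ring extensions *)

(** Finiteness of B / J over A, without forming the quotient: [J] can then be enlarged, for instance
    to a prime, inside a fixed ring. *)
Definition finite_mod (A B : comPzRingType) (phi : {rmorphism A -> B})
    (J : ideal B) : Prop :=
  exists r (s : 'I_r -> B), forall b, exists c : 'I_r -> A,
    J (b - \sum_i phi (c i) * s i).

Definition injective_mod (A B : comPzRingType) (phi : {rmorphism A -> B})
    (J : ideal B) : Prop :=
  forall a, J (phi a) -> a = 0.

Section Determinant.
Variables (B : comPzRingType) (J : ideal B) (r : nat).

(** Cramer's rule modulo [J]: combine the relations with the coefficients of the adjugate matrix. *)
Lemma ideal_det_mul (s : 'I_r -> B) (M : 'M[B]_r) :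
  (forall i, J (\sum_j M i j * s j)) -> forall i, J (\det M * s i).
Proof.
move=> JM i; have -> : \det M * s i = \sum_k (\adj M) i k * (\sum_j M k j * s
  j).
  under eq_bigr do rewrite mulr_sumr; rewrite exchange_big /=.
  have E j : \sum_k (\adj M) i k * M k j = (\det M) *+ (i == j).
    by have /matrixP/(_ i j) := mul_adj_mx M; rewrite !mxE.
  under eq_bigr => j _.
    under eq_bigr do rewrite mulrA; rewrite -mulr_suml E; over.
  rewrite (bigD1 i) //= eqxx mulr1n big1 ?addr0 // => j ji.
  by rewrite eq_sym (negbTE ji) mul0r.
by apply: ideal_sum => k _; exact: idealM.
Qed.

Lemma ideal_det_congr (M N : 'M[B]_r) :
  (forall i j, J (M i j - N i j)) -> J (\det M - \det N).
Proof.
move=> MN; rewrite -sumrB; apply: ideal_sum => s _; rewrite -mulrBr.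
apply: idealM; apply: (big_ind2 (fun x y => J (x - y))) => //.
  by rewrite subrr; exact: ideal0.
move=> x x' y y' Jx Jy; apply: (@ideal_trans _ _ (x * y')).
  by rewrite -mulrBr; exact: idealM.
by rewrite -mulrBl; exact: idealMC.
Qed.

End Determinant.

Section FiniteExtension.
Variables (A B : comPzRingType) (phi : {rmorphism A -> B}).

Lemma finite_mod_sub (J Q : ideal B) :
  J `<=` Q -> finite_mod phi J -> finite_mod phi Q.
Proof.
by move=> JQ [r [s sP]]; exists r, s => b; have [c cP] := sP b; exists c;
  exact: JQ.
Qed.

(** The determinant kills every generator modulo [J], hence also 1, which is a combination of
    them. *)
Lemma finite_mod_det (J : ideal B) r (s : 'I_r -> B) (M : 'M[B]_r) :
  (forall b, exists c : 'I_r -> A, J (b - \sum_i phi (c i) * s i)) ->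
  (forall i, J (\sum_j M i j * s j)) -> J (\det M).
Proof.
move=> sP /ideal_det_mul JM; have [c /(idealM (\det M))] := sP 1.
rewrite mulrBr mulr1 => Jd; apply/(ideal_congr Jd); rewrite mulr_sumr.
by apply: ideal_sum => i _; rewrite mulrCA; exact: idealM.
Qed.

(* Nakayama's determinant trick: det (a - C) annihilates B / J for a matrix C
   over p, and it is congruent to a power of a modulo p. *)
Lemma finite_mod_extension (J : ideal B) (p : ideal A) a :
  finite_mod phi J -> contraction phi J `<=` p ->
  idealU J (extension phi p) (phi a) -> exists m, p (a ^+ m).
Proof.
move=> [r [s sP]] Jp [y Jy ext].
(* [Q] is the submodule generated by the products of [p] with the generators, modulo [J]. It is an
   ideal containing the image of [p], hence the whole extension of [p]. *)
pose Q : set B :=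
  [set e | exists c : 'I_r -> A, (forall j, p (c j)) /\
                                 J (e - \sum_j phi (c j) * s j)].
have Q0 : Q 0.
  exists (fun=> 0); split=> [j|]; first exact: ideal0.
  rewrite big1 ?subr0 => [|j _]; first exact: ideal0.
  by rewrite rmorph0 mul0r.
have QD x x' : Q x -> Q x' -> Q (x + x').
  move=> [c [pc Jc]] [c' [pc' Jc']]; exists (fun j => c j + c' j).
  split=> [j|]; first exact: idealD.
  under eq_bigr do rewrite rmorphD mulrDl.
  by rewrite big_split opprD addrACA; exact: idealD.
have QM b x : Q x -> Q (b * x).
  move=> [c [pc Jc]]; have /choice [d dP] j := sP (b * s j).
  exists (fun l => \sum_j c j * d j l); split=> [l|].
    by apply: ideal_sum => j _; exact: idealMC.
  apply: (@ideal_trans _ _ (\sum_j phi (c j) * (b * s j))).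
    rewrite (_ : \sum_j _ = b * \sum_j phi (c j) * s j).
      by rewrite -mulrBr; exact: idealM.
    by rewrite mulr_sumr; apply: eq_bigr => j _; rewrite mulrCA.
  under [X in _ - X]eq_bigr do rewrite rmorph_sum mulr_suml.
  rewrite exchange_big /= -sumrB; apply: ideal_sum => j _.
  rewrite (_ : \sum_(l < r) _ = phi (c j) * \sum_l phi (d j l) * s l).
    by rewrite -mulrBr; exact: idealM.
  by rewrite mulr_sumr; apply: eq_bigr => l _; rewrite rmorphM mulrA.
have : Q (phi a).
  have pQ a' : p a' -> Q (phi a').
    move=> pa; have [c Jc] := sP 1; exists (fun j => a' * c j).
    split=> [j|]; first exact: idealMC.
    rewrite (_ : \sum_j _ = phi a' * \sum_j phi (c j) * s j).
      by rewrite -{1}(mulr1 (phi a')) -mulrBr; exact: idealM.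
    by rewrite mulr_sumr; apply: eq_bigr => l _; rewrite rmorphM mulrA.
  have [c [pc Jc]] := @extension_sub _ _ phi p (Ideal Q0 QD QM) pQ _ ext.
  by exists c; split=> //; rewrite -(subrK y (phi a)) addrAC; exact: idealD.
move=> Qa; have /choice [C CP] i : Q (s i * phi a) by exact: QM.
have Cp i j : p (C i j) by have [] := CP i.
exists r; pose M := a%:M - \matrix_(i, j) C i j.
have pM : p (\det M).
  apply: Jp; rewrite /= /contraction_set /= -det_map_mx.
  apply: finite_mod_det sP _ => i.
  have [_] := CP i; rewrite mulrC; congr (J _).
  under [RHS]eq_bigr do rewrite !mxE rmorphB mulrBl.
  rewrite sumrB; congr (_ - _); rewrite (bigD1 i) //= eqxx big1 ?addr0 // =>
    j ji.
  by rewrite eq_sym (negbTE ji) rmorph0 mul0r.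
rewrite -(det_scalar r a) -(subrK (\det M) (\det _)).
apply: idealD => //; apply: ideal_det_congr => i j.
by rewrite !mxE opprB addrCA subrr addr0.
Qed.

(** The prime is chosen to contain J + pB and to avoid the image of the complement of [p]. These are
    disjoint, since an [a] with image in J + pB has a power in [p]. *)
Lemma lying_over (J : ideal B) (p : ideal A) :
  finite_mod phi J -> prime_ideal p -> contraction phi J `<=` p ->
  exists Q, [/\ prime_ideal Q, J `<=` Q & contraction phi Q = p].
Proof.
move=> fin pp Jp; have [p1 pM] := pp.
have [||x Ex [a pa aE]|Q [Qp EQ QS]] := @exists_prime_avoiding _
  (idealU J (extension phi p)) [set phi a | a in ~` p].
- by exists 1; rewrite ?rmorph1.
- move=> _ _ [a pa <-] [b pb <-]; exists (a * b); rewrite ?rmorphM //.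
  by move=> /pM[].
- move: Ex; rewrite -aE => /(finite_mod_extension fin Jp)[m].
  by move=> /prime_idealX-/(_ pp).
exists Q; split=> // [x Jx|]; first by apply: EQ; exact: idealU_l.
apply: ideal_eq => a; split=> [Qa|pa].
  by apply: contrapT => pa; apply: (QS _ Qa); exists a.
by apply: EQ; apply: idealU_r; exact: extensionW.
Qed.

End FiniteExtension.

(** Cayley-Hamilton: the polynomial is the characteristic polynomial of a matrix of multiplication
    by [b] on the generators. *)
Lemma finite_mod_integral (A B : comNzRingType) (phi : {rmorphism A -> B})
    (J : ideal B) b : finite_mod phi J ->
  exists2 p : {poly A}, p \is monic & J (map_poly phi p).[b].
Proof.
move=> [r [s sP]]; have /choice [C CP] i := sP (b * s i).
exists (char_poly (\matrix_(i, j) C i j)); first exact: char_poly_monic.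
have cb : commr_rmorph phi b by move=> x; exact: mulrC.
rewrite -[_.[_]]/(horner_morph cb _) /char_poly -det_map_mx.
apply: finite_mod_det sP _ => i; have := CP i; congr (J _).
under [RHS]eq_bigr do rewrite !mxE rmorphB mulrBl /= horner_morphC.
rewrite sumrB; congr (_ - _).
rewrite (bigD1 i) //= eqxx mulr1n horner_morphX big1 ?addr0 // => j ji.
by rewrite eq_sym (negbTE ji) mulr0n raddf0 mul0r.
Qed.

(** * Chains of primes *)

Fixpoint prime_chain (A : comPzRingType) (m : nat) (P : ideal A) : Prop :=
  prime_ideal P /\
  if m is m'.+1 then exists2 Q : ideal A, P `<` Q & prime_chain m' Q else True.

(** The Krull dimension of A / J, read on the primes above [J]. Requiring an actual chain of length
    [d] forces [J] to be proper. *)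
Definition has_dim (A : comPzRingType) (J : ideal A) (d : nat) : Prop :=
  (exists2 P : ideal A, J `<=` P & prime_chain d P) /\
  forall m (P : ideal A), J `<=` P -> prime_chain m P -> (m <= d)%N.

Lemma prime_chain_prime (A : comPzRingType) m (P : ideal A) :
  prime_chain m P -> prime_ideal P.
Proof. by case: m => [|m] []. Qed.

(** The invariant [good] propagates from the lowest prime upwards. This common pattern serves
    contractions along surjective and finite maps as well as reduction modulo the maximal ideal. *)
Lemma prime_chain_map (A B : comPzRingType) (good : ideal A -> Prop)
    (f : ideal A -> ideal B) m (P : ideal A) :
  (forall P, prime_ideal P -> good P -> prime_ideal (f P)) ->
  (forall P Q, prime_ideal P -> good P -> prime_ideal Q -> P `<` Q ->
     good Q /\ f P `<` f Q) ->
  good P -> prime_chain m P -> prime_chain m (f P).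
Proof.
move=> f_prime f_lt; elim: m P => [|m IHm] P gP [pP].
  by split=> //; exact: f_prime.
move=> [Q PQ chQ]; split; first exact: f_prime.
have [gQ lt_f] := f_lt _ _ pP gP (prime_chain_prime chQ) PQ.
by exists (f Q) => //; exact: IHm.
Qed.

Lemma prime_chain_contraction_surj (A B : comPzRingType)
    (rho : {rmorphism A -> B}) m (P : ideal B) :
  (forall b, exists a, rho a = b) ->
  prime_chain m P -> prime_chain m (contraction rho P).
Proof.
move=> rho_surj; apply: (@prime_chain_map _ _ (fun=> True)) => // [Q pQ _|].
  exact: contraction_prime.
move=> Q Q' _ _ _ [QQ' nQ'Q]; split=> //; split=> [x|]; first exact: QQ'.
by move=> Q'Q; apply: nQ'Q => y; have [x <-] := rho_surj y; exact: Q'Q.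
Qed.

Lemma going_up (A B : comPzRingType) (phi : {rmorphism A -> B}) (J : ideal B)
    m (p : ideal A) :
  finite_mod phi J -> contraction phi J `<=` p -> prime_chain m p ->
  exists2 Q : ideal B, J `<=` Q & prime_chain m Q.
Proof.
(* The induction needs the contraction of the lowest prime, in order to see that the next lifted
   prime is strictly larger. *)
move=> phi_fin Jp chp; suff [Q [JQ _ chQ]] : exists Q : ideal B,
  [/\ J `<=` Q, contraction phi Q = p & prime_chain m Q] by exists Q.
elim: m J p phi_fin Jp chp => [|m IHm] J' p fin Jp [pp].
  by have [Q [pQ JQ Qp]] := lying_over fin pp Jp; exists Q.
move=> [q [pq nqp] chq]; have [Q [pQ JQ Qp]] := lying_over fin pp Jp.
have [||Q' [QQ' Q'q chQ']] := IHm Q q _ _ chq.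
- exact: finite_mod_sub JQ fin.
- by rewrite Qp.
exists Q; split=> //; split=> //; exists Q' => //; split=> // Q'Q.
by apply: nqp; rewrite -Q'q -Qp => a; exact: Q'Q.
Qed.

Section FiniteChains.
Variables (A B : comNzRingType) (phi : {rmorphism A -> B}) (J : ideal B).
Hypothesis phi_fin : finite_mod phi J.

(* The least degree of a monic polynomial over A sending b into P: its constant
   term lies in Q, and if it lay in P one could divide by b. *)
Lemma incomparability (P Q : ideal B) :
  J `<=` P -> prime_ideal P -> prime_ideal Q -> P `<` Q ->
  contraction phi P `<` contraction phi Q.
Proof.
move=> JP [P1 PM] [Q1 _] [PQ nQP]; split=> [a|QPc]; first exact: PQ.
have [b Qb Pb] : exists2 b, Q b & ~ P b.
  by apply: contrapT => /forall2NP h; apply: nQP => b Qb;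
    have [|/contrapT] := h b.
pose ex n := `[< exists p : {poly A}, [/\ p \is monic, size p = n
                                        & P (map_poly phi p).[b]] >].
have [p pm Jp] := finite_mod_integral b phi_fin.
have exP : exists n, ex n by exists (size p); apply/asboolP; exists p;
  split=> //; exact: JP.
case: (ex_minnP exP) => n /asboolP[{p pm Jp}p [pm <- Pp]] pmin.
have [q qE] : exists q : {poly A}, p = q * 'X + (p`_0)%:P.
  exists (Poly (behead p)); apply/polyP => i.
  rewrite coefD coefMX coefC; case: i => [|i] /=; first by rewrite add0r.
  by rewrite coef_Poly nth_behead addr0.
have pE : (map_poly phi p).[b] = (map_poly phi q).[b] * b + phi p`_0.
  by rewrite {1}qE rmorphD rmorphM /= map_polyX map_polyC !hornerE.
have Qp0 : Q (phi p`_0).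
  rewrite -(addKr ((map_poly phi q).[b] * b) (phi p`_0)) -pE addrC.
  by apply: idealB; [exact: PQ | exact: idealM].
have /PM[Pq|//] : P ((map_poly phi q).[b] * b).
  by rewrite -(addrK (phi p`_0) (_ * b)) -pE; apply: idealB => //; exact: QPc.
have q0 : q != 0.
  apply/eqP => q0; move: qE; rewrite q0 mul0r add0r => pC.
  have p1 : p = 1 by move/monicP: pm; rewrite pC lead_coefC => ->.
  by apply: P1; move: Pp; rewrite p1 rmorph1 hornerC.
have sp : size p = (size q).+1.
  rewrite qE size_polyDl ?size_mulX // size_polyC.
  by apply: leq_ltn_trans (leq_b1 _) _; rewrite ltnS size_poly_gt0.
have qm : q \is monic.
  move/monicP: pm; rewrite lead_coefE sp qE coefD coefMX coefC -lead_coefE.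
  by rewrite size_poly_eq0 (negbTE q0) addr0 => /eqP; rewrite monicE.
have : (size p <= size q)%N by apply: pmin; apply/asboolP; exists q.
by rewrite sp ltnn.
Qed.

Lemma prime_chain_contraction m (P : ideal B) :
  J `<=` P -> prime_chain m P -> prime_chain m (contraction phi P).
Proof.
apply: (@prime_chain_map _ _ (fun P : ideal B => J `<=` P)) => [Q pQ _|].
  exact: contraction_prime.
move=> Q Q' pQ JQ pQ' QQ'; split; last exact: incomparability.
by apply: subset_trans JQ _; case: QQ'.
Qed.

(** Injectivity means that [J] contracts to 0, so every chain of A lifts by going up;
    incomparability bounds the chains above [J]. *)
Lemma has_dim_finite d :
  injective_mod phi J -> has_dim (zero_ideal A) d -> has_dim J d.
Proof.
move=> phi_inj [[p _ chp] dim_le]; split.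
  apply: going_up phi_fin _ chp => a /phi_inj ->; exact: ideal0.
move=> m P JP /(prime_chain_contraction JP); apply: dim_le => _ ->.
exact: ideal0.
Qed.

End FiniteChains.

(** The induction shared by polynomial rings and Tate algebras. The lower bound pulls a chain back
    along a surjection with nonzero kernel and puts the zero ideal below it. The upper bound
    normalizes modulo the second prime of a chain, which is nonzero. *)
Lemma has_dim_family (A : nat -> comNzRingType) :
  (forall d, prime_ideal (zero_ideal (A d))) ->
  (forall d, exists rho : {rmorphism A d.+1 -> A d},
     (forall b, exists a, rho a = b) /\ exists2 x, x != 0 & rho x = 0) ->
  (forall d (P : ideal (A d)), prime_ideal P -> (exists2 x, P x & x != 0) ->
     exists e (phi : {rmorphism A e -> A d}),
       [/\ (e < d)%N, finite_mod phi P & injective_mod phi P]) ->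
  forall d, has_dim (zero_ideal (A d)) d.
Proof.
move=> dom proj norm d; elim/ltn_ind: d => d IHd; split.
  case: d IHd => [|d] IHd; first by exists (zero_ideal (A 0%N)).
  have [rho [rho_surj [x x0 rhox]]] := proj d.
  have [[P _ chP] _] := IHd d (leqnn _).
  exists (zero_ideal (A d.+1)) => //; split=> //; exists (contraction rho P).
    split=> [_ ->|]; first exact: ideal0.
    move=> h; case/eqP: x0; apply: h.
    by rewrite /= /contraction_set /= rhox; exact: ideal0.
  exact: prime_chain_contraction_surj.
move=> [//|m] P _ [_ [Q [_ nQP] chQ]].
have [x Qx x0] : exists2 x, Q x & x != 0.
  apply: contrapT => /forall2NP h; apply: nQP => x Qx.
  have [//|/negP] := h x; rewrite negbK => /eqP ->; exact: ideal0.
have [e [phi [ed fin inj]]] := norm d Q (prime_chain_prime chQ) (ex_intro2 _ _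
  x Qx x0).
have [_ dim_le] := has_dim_finite fin inj (IHd e ed).
exact: leq_ltn_trans (dim_le _ _ (@subset_refl _ _) chQ) ed.
Qed.

(** * Krull dimension of quotients and Zariski dimension *)

Section KrullDim.
Variable R : realType.

Lemma ereal_sup_nat (S : set nat) d : S d -> (forall m, S m -> (m <= d)%N) ->
  ereal_sup [set (m%:R : R)%:E | m in S] = (d%:R : R)%:E.
Proof.
move=> Sd dS; apply/eqP; rewrite eq_le; apply/andP; split.
  by apply: ge_ereal_sup => _ [m /dS md <-]; rewrite lee_fin ler_nat.
by apply: ereal_sup_ubound; exists d.
Qed.

Lemma prime_chainP (A : comPzRingType) m :
  (exists c : nat -> set A,
     (forall i, (i <= m)%N -> [set (ideal_set P : set A) | P in @prime_ideal A]
       (c i)) /\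
     (forall i, (i < m)%N -> c i `<` c i.+1)) <->
  exists P : ideal A, prime_chain m P.
Proof.
split=> [[c [cP c_lt]]|[P chP]].
  have [P pP Pc] := cP 0%N (leq0n m); exists P.
  elim: m c cP c_lt P pP Pc => [|m IHm] c cP c_lt P pP Pc; first by split.
  have [Q pQ Qc] := cP 1%N isT; split=> //; exists Q.
    by rewrite Pc Qc; exact: c_lt.
  by apply: (IHm (c \o S)) => // i im; [exact: cP | exact: c_lt].
suff [c [c0 [cP c_lt]]] : exists c : nat -> set A, c 0%N = P /\
    (forall i, (i <= m)%N -> [set (ideal_set P : set A) | P in @prime_ideal A]
      (c i)) /\
    (forall i, (i < m)%N -> c i `<` c i.+1) by exists c.
elim: m P chP => [|m IHm] P [pP].
  by exists (fun=> ideal_set P); split=> //; split=> // i _; exists P.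
move=> [Q PQ /IHm[c [c0 [cP c_lt]]]].
exists (fun i => if i is i'.+1 then c i' else ideal_set P); split=> //.
split=> [[_|i]|[_|i]]; [by exists P | exact: cP | by rewrite c0 | exact: c_lt].
Qed.

(** The quotient map is surjective, hence finite, so going up turns chains above [J] into chains of
    the quotient; contraction goes back. *)
Lemma krull_dim_quotient (A : comPzRingType) (J : ideal A) d :
  has_dim J d -> krull_dim R (quotient J) = (d%:R : R)%:E.
Proof.
pose pi : {rmorphism A -> quotient J} := quotient_map J.
have piP x : pi x = 0 <-> J x.
  by rewrite -(rmorph0 pi) -[X in _ <-> J X]subr0; exact: quotient_map_eq.
have pi_surj b : exists a, pi a = b.
  by have [a ->] := quotient_map_surj b; exists a.
have pi_fin : finite_mod pi (zero_ideal _).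
  exists 1%N, (fun=> 1) => b; have [a <-] := pi_surj b.
  by exists (fun=> a); rewrite big_ord1 mulr1 /= subrr.
move=> [[P JP chP] dim_le]; apply: ereal_sup_nat => [|m].
  have [|Q _ chQ] := going_up pi_fin _ chP; first by move=> x /piP; exact: JP.
  by apply/prime_chainP; exists Q.
move=> /prime_chainP[Q /(prime_chain_contraction_surj pi_surj)].
apply: dim_le => x /piP; rewrite /= /contraction_set /= => ->; exact: ideal0.
Qed.

Section ZariskiDim.
Variables (A : comPzRingType) (J : ideal A).
Let V := vanishing_locus (ideal_set J).

(** The vanishing ideal of [Y]: the intersection of its points. *)
Definition locus_ideal_set (Y : set (ideal A)) : set A :=
  [set x | forall P, Y P -> P x].
Fact locus_ideal0 Y : locus_ideal_set Y 0.
Proof. by move=> P _; exact: ideal0. Qed.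
Fact locus_idealD Y x y :
  locus_ideal_set Y x -> locus_ideal_set Y y -> locus_ideal_set Y (x + y).
Proof. by move=> Yx Yy P YP; apply: idealD; [exact: Yx | exact: Yy]. Qed.
Fact locus_idealM Y a x : locus_ideal_set Y x -> locus_ideal_set Y (a * x).
Proof. by move=> Yx P YP; apply: idealM; exact: Yx. Qed.
Definition locus_ideal Y :=
  Ideal (@locus_ideal0 Y) (@locus_idealD Y) (@locus_idealM Y).

Lemma locus_ideal_prime Y :
  zariski_closed Y -> zariski_irreducible Y -> prime_ideal (locus_ideal Y).
Proof.
move=> [S YE] [[P YP] irr].
have pY Q : Y Q -> prime_ideal Q by rewrite YE => -[].
split=> [/(_ _ YP)|x y xyY]; first by have [] := pY _ YP.
have [||Q YQ|Yx|Yy] := irr (vanishing_locus [set x]) (vanishing_locus [set y]).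
- by exists [set x].
- by exists [set y].
- have [_ /(_ _ _ (xyY _ YQ))[Qx|Qy]] := pY _ YQ; [left|right].
    by split=> [|_ ->]; first exact: pY.
  by split=> [|_ ->]; first exact: pY.
- by left=> Q /Yx[_]; apply.
- by right=> Q /Yy[_]; apply.
Qed.

Lemma vanishing_locus_irreducible (P : ideal A) :
  prime_ideal P -> zariski_irreducible (vanishing_locus (ideal_set P)).
Proof.
move=> pP; split; first by exists P; split=> //; exact: subset_refl.
move=> _ _ [S1 ->] [S2 ->] /(_ P (conj pP (@subset_refl _ (ideal_set P)))) SP.
case: SP => -[_ SP]; [left|right] => Q [pQ PQ];
  by split=> //; exact: subset_trans SP PQ.
Qed.

(** Irreducible closed subsets correspond to primes, with inclusions reversed. The empty locus is
    listed apart because its dimension, a supremum over no chain, is [-oo]. *)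
Lemma zariski_dim0P :
  (V = set0 \/ zariski_dim R V = 0%E) <->
  (forall P Q : ideal A, J `<=` P -> prime_ideal P -> prime_ideal Q -> ~ P `<`
    Q).
Proof.
split=> [[V0|dim0] P Q JP pP pQ PQ|noPQ].
- have : V P by []. by rewrite V0.
- have : ((1%:R : R)%:E <= 0%E)%E; last by rewrite lee_fin ler10.
  rewrite -dim0; apply: ereal_sup_ubound; exists 1%N => //.
  exists (fun i => if i is 0%N then vanishing_locus (ideal_set Q)
                   else vanishing_locus (ideal_set P)).
  split=> [i _|[|//] _]; last first.
    split=> [T [pT QT]|]; first by split=> //; apply: subset_trans QT; case: PQ.
    by move=> /(_ P (conj pP (@subset_refl _ (ideal_set P))))[_]; case: PQ.
  case: i => [|i]; split; do ?[by eexists | exact: vanishing_locus_irreducible].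
    move=> T [pT QT]; split=> //; apply: subset_trans QT.
    by apply: subset_trans JP _; case: PQ.
  by move=> T [pT PT]; split=> //; exact: subset_trans PT.
- have [V0|/set0P[P VP]] := eqVneq V set0; [by left|right].
  apply: (@ereal_sup_nat _ 0%N) => [|m [c [cP c_lt]]].
    have [pP JP] := VP.
    exists (fun=> vanishing_locus (ideal_set P)); split=> // i _.
    split; [by exists P | exact: vanishing_locus_irreducible |].
    by move=> T [pT PT]; split=> //; exact: subset_trans PT.
  case: m cP c_lt => // m cP /(_ 0%N isT)[c01 nc10].
  have [cl0 ir0 c0V] := cP 0%N isT; have [cl1 ir1 c1V] := cP 1%N isT.
  case: (noPQ (locus_ideal (c 1%N)) (locus_ideal (c 0%N))).
  - by move=> x Jx T /c1V[_]; apply.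
  - exact: locus_ideal_prime.
  - exact: locus_ideal_prime.
  split=> [x c1x T /c01|l01]; first exact: c1x.
  apply: nc10; have [S0 c0E] := cl0; rewrite [X in _ `<=` X]c0E => T c1T.
  split=> [|x S0x]; first by have [] := c1V _ c1T.
  by apply: l01 c1T => T'; rewrite c0E => -[_]; apply.
Qed.

End ZariskiDim.

End KrullDim.

(** * Noether normalization *)

Lemma finite_mod_finType (A B : comPzRingType) (phi : {rmorphism A -> B})
    (J : ideal B) (T : finType) (s : T -> B) :
  (forall b, exists c : T -> A, J (b - \sum_i phi (c i) * s i)) ->
  finite_mod phi J.
Proof.
move=> sP; exists #|T|, (fun i => s (enum_val i)) => b; have [c cP] := sP b.
exists (fun i => c (enum_val i)).
by move: cP; rewrite (reindex (@enum_val _ T)) //; apply: onW_bij;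
  exact: enum_val_bij.
Qed.

Lemma finite_mod_comp (A B C : comPzRingType) (psi : {rmorphism A -> B})
    (zeta : {rmorphism B -> C}) (chi : {rmorphism A -> C}) (J : ideal C) :
  (forall a, chi a = zeta (psi a)) ->
  finite_mod zeta J -> finite_mod psi (contraction zeta J) -> finite_mod chi J.
Proof.
move=> chiE [r [s sP]] [q [t tP]].
apply: (@finite_mod_finType _ _ _ _ _ (fun ij : 'I_r * 'I_q =>
  s ij.1 * zeta (t ij.2))).
move=> x; have [c cP] := sP x; have /choice[d dP] i := tP (c i).
exists (fun ij => d ij.1 ij.2); apply: ideal_trans cP _.
rewrite -(pair_bigA _ (fun i j => chi (d i j) * (s i * zeta (t j)))) /= -sumrB.
apply: ideal_sum => i _; have := dP i.
rewrite /= /contraction_set /= rmorphB => /(idealM (s i)).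
rewrite mulrBr [s i * _]mulrC; congr (J (_ - _)).
rewrite rmorph_sum mulr_sumr; apply: eq_bigr => j _.
by rewrite rmorphM chiE mulrCA.
Qed.

Lemma rmorph_mpoly_eq n (A : comNzRingType) (S : comNzRingType)
    (f g : {rmorphism mpoly n A -> S}) :
  (forall c, f (mpolyC n c) = g (mpolyC n c)) ->
  (forall i, f (mpolyX A (mnm1 i)) = g (mpolyX A (mnm1 i))) -> f =1 g.
Proof.
move=> fgC fgX p; rewrite (mpolyE p) !rmorph_sum; apply: eq_bigr => m _.
rewrite -mul_mpolyC !rmorphM fgC; congr (_ * _).
rewrite mpolyXE_id !rmorph_prod; apply: eq_bigr => i _.
by rewrite !rmorphXn fgX.
Qed.

Lemma mpoly0_const (A : comNzRingType) (p : mpoly 0 A) :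
  p = mpolyC 0 (mcoeff mnm0 p).
Proof.
apply/mpolyP => m; have -> : m = mnm0 by apply/mnmP => -[].
by rewrite mcoeffC eqxx mulr1.
Qed.

Lemma mmapX1 n (A S : comNzRingType) (f : {rmorphism A -> S}) (h : 'I_n -> S) i
  :
  mmap f h (mpolyX A (mnm1 i)) = h i.
Proof. by rewrite mmapX mmap1U. Qed.

Lemma mmap_mpolyX_id n (A : comNzRingType) (p : mpoly n A) :
  mmap (@mpolyC n A) (fun i => mpolyX A (mnm1 i)) p = p.
Proof.
apply: (@rmorph_mpoly_eq n A (mpoly n A) (mmap _ _) idfun) => [c|i] /=.
  by rewrite mmapC.
by rewrite mmapX1.
Qed.

(** Uniqueness of digits in base [B]. With [B] above all exponents of a polynomial, it tells its
    monomials apart by their weights. *)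
Lemma base_expansion_inj B n (a b : 'I_n -> nat) :
  (forall i, (a i < B)%N) -> (forall i, (b i < B)%N) ->
  (\sum_i a i * B ^ i = \sum_i b i * B ^ i)%N -> a =1 b.
Proof.
elim: n a b => [|n IHn] a b aB bB; first by move=> _ [].
have B0 : (0 < B)%N by apply: leq_ltn_trans (aB ord0).
have E (c : 'I_n.+1 -> nat) : (\sum_i c i * B ^ i =
    (\sum_(i < n) c (lift ord0 i) * B ^ i) * B + c ord0)%N.
  rewrite big_ord_recl expn0 muln1 addnC big_distrl; congr addn.
  by apply: eq_bigr => i _; rewrite /= -mulnA -expnSr.
rewrite !E => /(congr1 (fun x => edivn x B)).
rewrite !edivn_eq // => -[E1 E0] i.
have [j ->|->//] := unliftP ord0 i.
exact: (IHn (fun i => a (lift ord0 i)) (fun i => b (lift ord0 i))).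
Qed.

Section Nagata.
Variables (k : fieldType) (n : nat) (f : mpoly n.+1 k).
Hypothesis f0 : f != 0.

Let B := msize f.
Let X i := mpolyX k (mnm1 i) : mpoly n.+1 k.
Let weight (m : multinom n.+1) := (\sum_i m i * B ^ i)%N.

(** Nagata's change of variables. In terms of these elements and of X_0, the monomial [m] becomes
    monic in X_0 of degree [weight m], and [B], the degree of [f] plus one, exceeds every exponent
    in [f]. *)
Definition nagata_var (j : 'I_n) : mpoly n.+1 k :=
  X (lift ord0 j) - X ord0 ^+ (B ^ lift ord0 j).

Let xi : {rmorphism mpoly n k -> mpoly n.+1 k} :=
  mmap (@mpolyC n.+1 k) nagata_var.

Let theta_var (i : 'I_n.+1) : {poly mpoly n k} :=
  if unlift ord0 i is Some j then 'X^(B ^ i) + (mpolyX k (mnm1 j))%:P else 'X.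

(** Rewrites a polynomial as a polynomial in X_0 whose coefficients are polynomials in the Nagata
    variables; [unlift_poly] substitutes these back. *)
Let theta : {rmorphism mpoly n.+1 k -> {poly mpoly n k}} :=
  mmap (polyC \o @mpolyC n k) theta_var.

Let comm_xi : commr_rmorph xi (X ord0). Proof. by move=> x; exact: mulrC. Qed.
Let unlift_poly : {rmorphism {poly mpoly n k} -> mpoly n.+1 k} :=
  horner_morph comm_xi.

Let thetaK p : unlift_poly (theta p) = p.
Proof.
apply: (@rmorph_mpoly_eq n.+1 k _ (unlift_poly \o theta) idfun) => [c|i] /=.
  by rewrite /theta /= mmapC /= horner_morphC /xi /= mmapC.
rewrite /theta /= mmapX1 /theta_var; case: unliftP => [j|] ->;
  last by rewrite horner_morphX.
by rewrite rmorphD rmorphXn /= horner_morphX horner_morphC /xi /= mmapX1 addrC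
  subrK.
Qed.

Let B_gt0 : (0 < B)%N.
Proof. by rewrite lt0n msize_poly_eq0. Qed.

Let theta_monic m :
  theta (mpolyX k m) \is monic /\ size (theta (mpolyX k m)) = (weight m).+1.
Proof.
rewrite /theta /= mmapX /mmap1 /weight.
apply: (big_ind2 (fun (p : {poly mpoly n k}) d =>
  p \is monic /\ size p = d.+1)).
- by rewrite monic1 size_poly1.
- move=> p d q e [pm sp] [qm sq]; split; first by rewrite monicMl.
  by rewrite size_monicM ?monic_neq0 // sp sq addSn addnS.
move=> i _; have [vm sv] : theta_var i \is monic /\ size (theta_var i) = (B ^
  i).+1.
  rewrite /theta_var; case: unliftP => [j|] ->;
    last by rewrite monicX size_polyX.
  by rewrite monicXnaddC ?size_XnaddC ?expn_gt0 ?B_gt0.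
split; first exact: monic_exp.
elim: (m i) => [|e IHe]; first by rewrite size_poly1.
rewrite exprS size_monicM ?monic_neq0 ?monic_exp // sv IHe mulSn.
by rewrite addSn addnS.
Qed.

(* Distinct monomials of f have distinct weights, and theta sends each of them
   to a monic polynomial of degree its weight. *)
Let theta_lead : exists c : k, theta (mpolyC n.+1 c * f) \is monic.
Proof.
have [m fm mmax] : exists2 m, m \in msupp f &
    forall m', m' \in msupp f -> (weight m' <= weight m)%N.
  have : msupp f != [::] by rewrite msupp_eq0.
  elim: (msupp f) => // m s IHs _; have [->|/IHs[m' sm' m'max]] :=
    eqVneq s [::].
    by exists m; rewrite ?mem_head // => m'; rewrite inE => /eqP ->.
  have [le|lt] := leqP (weight m') (weight m).
    exists m; rewrite ?mem_head // => m''; rewrite inE => /predU1P[->//|/m'max].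
    by move=> /leq_trans; exact.
  exists m'; rewrite ?inE ?sm' ?orbT // => m'';
    rewrite inE => /predU1P[->|/m'max//].
  exact: ltnW.
have wE m' : m' \in msupp f -> m' != m -> (weight m' < weight m)%N.
  move=> fm' nm; rewrite ltn_neqAle mmax // andbT; apply: contra_neqN nm.
  move=> /eqP wmm'; apply/mnmP.
  have bnd m'' : m'' \in msupp f -> forall i, (m'' i < B)%N.
    move=> /msize_mdeg_lt lt i; apply: leq_ltn_trans lt.
    by rewrite mdegE (bigD1 i) //= leq_addr.
  exact: base_expansion_inj (bnd _ fm') (bnd _ fm) wmm'.
have c0 : mcoeff m f != 0 by move: fm; rewrite mcoeff_msupp.
exists (mcoeff m f)^-1; have [tm st] := theta_monic m.
have fE : mpolyC n.+1 (mcoeff m f)^-1 * f = mpolyX k m +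
    \sum_(m' <- rem m (msupp f))
      mpolyC n.+1 ((mcoeff m f)^-1 * mcoeff m' f) * mpolyX k m'.
  rewrite [X in _ * X]mpolyE (big_rem m) //= mulrDr; congr (_ + _).
    by rewrite -mul_mpolyC mulrA -rmorphM mulVf // rmorph1 mul1r.
  rewrite mulr_sumr; apply: eq_bigr => m' _.
  by rewrite -mul_mpolyC rmorphM mulrA.
have thC c : theta (mpolyC n.+1 c) = (mpolyC n c)%:P by exact: mmapC.
have E : theta (mpolyC n.+1 (mcoeff m f)^-1 * f) = theta (mpolyX k m) +
    \sum_(m' <- rem m (msupp f))
      (mpolyC n ((mcoeff m f)^-1 * mcoeff m' f))%:P * theta (mpolyX k m').
  rewrite fE rmorphD rmorph_sum; congr (_ + _); apply: eq_bigr => m' _.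
  by rewrite rmorphM thC.
have lt : (size (\sum_(m' <- rem m (msupp f))
      ((mpolyC n ((mcoeff m f)^-1 * mcoeff m' f))%:P * theta (mpolyX k m')))%R
      < size (theta (mpolyX k m)))%N.
  rewrite st ltnS big_seq; apply: leq_trans (size_sum _ _ _) _.
  apply/bigmax_leqP_seq => m'; rewrite mem_rem_uniq ?msupp_uniq // => + _.
  rewrite inE /= => /andP[nm fm']; rewrite mul_polyC.
  apply: leq_trans (size_scale_leq _ _) _.
  by have [_ ->] := theta_monic m'; exact: wE.
by rewrite E monicE lead_coefDl // -monicE.
Qed.

(** A multiple of [f] is monic in X_0, so Euclidean division by it leaves modulo [J] only bounded
    powers of X_0. *)
Lemma nagata_finite (J : ideal (mpoly n.+1 k)) : J f ->
  finite_mod (mmap (@mpolyC n.+1 k) nagata_var) J.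
Proof.
move=> Jf; have [c mon] := theta_lead; set F := mpolyC n.+1 c * f in mon.
have JF : J F by exact: idealM.
exists (size (theta F)), (fun i => X ord0 ^+ i) => g.
have gE := Pdiv.RingMonic.rdivp_eq mon (theta g).
have sr := Pdiv.CommonRing.ltn_rmodpN0 (theta g) (monic_neq0 mon).
move: gE sr; set q := Pdiv.CommonRing.rdivp _ _;
  set r := Pdiv.CommonRing.rmodp _ _.
move=> gE sr; exists (fun i => r`_i).
have -> : \sum_(i < size (theta F)) mmap (@mpolyC n.+1 k) nagata_var r`_i * X
  ord0 ^+ i
    = unlift_poly r.
  rewrite /= /horner_morph (@horner_coef_wide _ (size (theta F))).
    by apply: eq_bigr => i _; rewrite coef_map.
  exact: leq_trans (size_poly _ _) (ltnW sr).
rewrite -{1}(thetaK g) gE rmorphD rmorphM thetaK addrK; exact: idealM.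
Qed.

End Nagata.

(** If [J] is zero the variables themselves work; otherwise Nagata's change of variables removes one
    of them and the induction applies to the contraction of [J]. The strict inequality for nonzero
    [J] drives the computation of dimensions. *)
Lemma noether_normalization (k : fieldType) n (J : ideal (mpoly n k)) : ~ J 1 ->
  exists d (y : 'I_d -> mpoly n k),
    [/\ finite_mod (mmap (@mpolyC n k) y) J,
        injective_mod (mmap (@mpolyC n k) y) J, (d <= n)%N
      & (exists2 f, J f & f != 0) -> (d < n)%N].
Proof.
elim: n J => [|n IHn] J J1;
  (have [[f Jf f0]|J0] := pselect (exists2 f, J f & f != 0); last by
    exists _, (fun i => mpolyX k (mnm1 i)); split=> //;
    [exists 1%N, (fun=> 1) => b; exists (fun=> b);
     rewrite big_ord1 /= mmap_mpolyX_id mulr1 subrr; exact: ideal0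
    | by move=> p; rewrite /= mmap_mpolyX_id => Jp; apply/eqP/negP => /negP p0;
         apply: J0; exists p]).
  (* Without variables, a nonzero element of [J] is an invertible constant. *)
  case: J1; have c0 : mcoeff mnm0 f != 0.
    by apply: contra_neq f0 => c0; rewrite (mpoly0_const f) c0 rmorph0.
  rewrite -(rmorph1 (@mpolyC 0 k)) -(mulVf c0) rmorphM /= -mpoly0_const.
  exact: idealM.
have zfin := nagata_finite f0 Jf; set z := nagata_var f in zfin.
have [|d [y [yfin yinj dn _]]] := IHn (contraction (mmap (@mpolyC n.+1 k) z) J).
  by rewrite /= /contraction_set /= rmorph1.
have yzE : mmap (@mpolyC n.+1 k) (fun i => mmap (@mpolyC n.+1 k) z (y i)) =1
    mmap (@mpolyC n.+1 k) z \o mmap (@mpolyC n k) y.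
  apply: (@rmorph_mpoly_eq d k _ (mmap _ _)
            (mmap (@mpolyC n.+1 k) z \o mmap (@mpolyC n k) y)) => [c|i] /=.
    by rewrite !mmapC.
  by rewrite !mmapX1.
exists d, (fun i => mmap (@mpolyC n.+1 k) z (y i)); split; rewrite ?ltnS //.
- exact: finite_mod_comp yzE zfin yfin.
- by move=> p Jp; apply: yinj; rewrite /= /contraction_set /= -[mmap _ _ _]yzE.
- exact: leqW.
Qed.

Lemma mpoly_has_dim (k : fieldType) d : has_dim (zero_ideal (mpoly d k)) d.
Proof.
move: d; apply: (@has_dim_family (fun d => mpoly d k)) => d.
- split=> [|x y]; first by apply/eqP; exact: oner_neq0.
  by move=> /eqP; rewrite mulf_eq0 => /orP[]/eqP; [left|right].
- pose h (i : 'I_d.+1) : mpoly d k :=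
    if unlift ord_max i is Some j then mpolyX k (mnm1 j) else 0.
  pose g (j : 'I_d) : mpoly d.+1 k := mpolyX k (mnm1 (lift ord_max j)).
  exists (mmap (@mpolyC d k) h); split=> [b|].
    exists (mmap (@mpolyC d.+1 k) g b).
    apply: (@rmorph_mpoly_eq d k _ (mmap (@mpolyC d k) h \o mmap (@mpolyC d.+1
      k) g)
             idfun) => [c|i] /=; first by rewrite !mmapC.
    by rewrite !mmapX1 /h liftK.
  exists (mpolyX k (mnm1 ord_max)); last by rewrite /= mmapX1 /h unlift_none.
  by rewrite -msize_poly_eq0 msizeX.
- move=> P [P1 _] Pnz; have [e [y [fin inj _ ed]]] := noether_normalization P1.
  by exists e, (mmap (@mpolyC d k) y); split=> //; exact: ed.
Qed.

Lemma noether_dim (k : fieldType) n (J : ideal (mpoly n k)) d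
    (y : 'I_d -> mpoly n k) :
  finite_mod (mmap (@mpolyC n k) y) J ->
  injective_mod (mmap (@mpolyC n k) y) J -> has_dim J d.
Proof. by move=> fin inj; exact: (@has_dim_finite (mpoly d k) (mpoly n k) _ _
  fin d inj (mpoly_has_dim k d)). Qed.

(** * Complete filtered rings and substitution *)

Section Filtration.
Variables (R : realType) (B : comNzRingType).

Definition filtered_cvg (F : R -> B -> Prop) (u : nat -> B) (l : B) : Prop :=
  forall M, exists N, forall i, (N <= i)%N -> F M (u i - l).

Definition filtered_cauchy (F : R -> B -> Prop) (u : nat -> B) : Prop :=
  forall M, exists N, forall i j, (N <= i)%N -> (N <= j)%N -> F M (u i - u j).

(* fil M x stands for "the valuation of x is at least M". *)
Record filtration := Filtration {
  fil :> R -> B -> Prop;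
  fil0 : forall M, fil M 0;
  filB : forall M x y, fil M x -> fil M y -> fil M (x - y);
  fil1 : fil 0 1;
  filM : forall M N x y, fil M x -> fil N y -> fil (M + N) (x * y);
  fil_separated : forall x, (forall M, fil M x) -> x = 0;
  fil_complete : forall u, filtered_cauchy fil u -> exists l,
    filtered_cvg fil u l }.

Variable F : filtration.

Lemma filN M x : F M x -> F M (- x).
Proof. by rewrite -sub0r; apply: filB; exact: fil0. Qed.

Lemma filD M x y : F M x -> F M y -> F M (x + y).
Proof. by move=> Fx Fy; rewrite -(opprK y); apply: filB => //; exact: filN. Qed.

Lemma filBC M x y : F M (x - y) -> F M (y - x).
Proof. by move/filN; rewrite opprB. Qed.

Lemma fil_trans M y x z : F M (x - y) -> F M (y - z) -> F M (x - z).
Proof. by move=> xy yz; rewrite -(subrK y x) -addrA; exact: filD. Qed.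

Lemma fil_congr M x y : F M (x - y) -> F M x -> F M y.
Proof. by move=> Fxy Fx; rewrite -(subKr x y); exact: filB. Qed.

Lemma fil_sum M (T : Type) (r : seq T) (p : pred T) (f : T -> B) :
  (forall i, p i -> F M (f i)) -> F M (\sum_(i <- r | p i) f i).
Proof. by move=> Ff; apply: big_ind => //; [exact: fil0 | exact: filD]. Qed.

Lemma filM0 x y : F 0 x -> F 0 y -> F 0 (x * y).
Proof. by move=> Fx Fy; rewrite -[0]addr0; exact: filM. Qed.

Lemma filMr M x y : F M x -> F 0 y -> F M (x * y).
Proof. by move=> Fx Fy; rewrite -[M]addr0; exact: filM. Qed.

Lemma fil_prod (T : Type) (r : seq T) (f : T -> B) :
  (forall i, F 0 (f i)) -> F 0 (\prod_(i <- r) f i).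
Proof.
by move=> Ff; apply: big_ind => [|x y|i _]; [exact: fil1 | exact: filM0 |
  exact: Ff].
Qed.

Lemma filX M x m : F M x -> F (M *+ m) (x ^+ m).
Proof.
move=> Fx; elim: m => [|m IHm]; first exact: fil1.
by rewrite exprS mulrS; exact: filM.
Qed.

Lemma filX0 x m : F 0 x -> F 0 (x ^+ m).
Proof. by move/(filX m); rewrite mul0rn. Qed.

Lemma filtered_cvg_unique u l l' :
  filtered_cvg F u l -> filtered_cvg F u l' -> l = l'.
Proof.
move=> ul ul'; apply/eqP; rewrite -subr_eq0; apply/eqP/(@fil_separated F) => M.
have [N hN] := ul M; have [N' hN'] := ul' M.
apply: (@fil_trans _ (u (maxn N N'))); last by apply: hN'; exact: leq_maxr.
by apply: filBC; apply: hN; exact: leq_maxl.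
Qed.

Lemma filtered_cvgB u l v l' :
  filtered_cvg F u l -> filtered_cvg F v l' ->
  filtered_cvg F (fun i => u i - v i) (l - l').
Proof.
move=> ul vl' M; have [N hN] := ul M; have [N' hN'] := vl' M.
exists (maxn N N') => i; rewrite geq_max => /andP[/hN Fu /hN' Fv].
have -> : u i - v i - (l - l') = (u i - l) - (v i - l') by ring.
exact: filB.
Qed.

Lemma filtered_cvg_fil u l M N :
  filtered_cvg F u l -> (forall i, (N <= i)%N -> F M (u i)) -> F M l.
Proof.
move=> /(_ M)[N' hN'] uM; apply: (@fil_congr _ (u (maxn N N'))).
  by apply: hN'; exact: leq_maxr.
by apply: uM; exact: leq_maxl.
Qed.

End Filtration.

Section FieldFiltration.
Variables (R : realType) (L : fieldType) (w : valuation R L).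

Lemma valuation_separated x : (forall M : R, (M%:E <= w x)%E) -> x = 0.
Proof.
move=> wx; apply/eqP/negP => /negP x0; have /fineK E := valuation_fin w x0.
have := wx (fine (w x) + 1); rewrite -[X in (_ <= X)%E]E lee_fin.
by rewrite gerDl ler10.
Qed.

Hypothesis w_complete : valuation_complete w.

(** Kept transparent, so that the filtration unfolds to inequalities on [w]. *)
Definition field_filtration : filtration R L.
Proof.
apply: (@Filtration R L (fun M x => (M%:E <= w x)%E)).
- by move=> M; rewrite valuation0 leey.
- by move=> M x y Mx My; apply: valuation_geD => //; rewrite valuationN.
- by rewrite valuation1.
- exact: valuation_geM.
- exact: valuation_separated.
- exact: w_complete.
Defined.

End FieldFiltration.

Section TateFiltration.
Variables (R : realType) (K : fieldType) (v : valuation R K) (n : nat).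
Implicit Types f g : tate v n.

Lemma tate_eqP f g : (forall m, f m = g m) -> f = g.
Proof. by move=> fg; apply: val_inj; exact: mpseriesP. Qed.

Lemma tate_coefB f g m : (f - g) m = f m - g m. Proof. by []. Qed.
Lemma tate_coefD f g m : (f + g) m = f m + g m. Proof. by []. Qed.

(** Lower bounds for the Gauss valuation, the minimum of the valuations of the coefficients. *)
Definition gauss_ge (M : R) f : Prop := forall m, (M%:E <= v (f m))%E.

Lemma gauss_geM M N f g : gauss_ge M f -> gauss_ge N g -> gauss_ge (M + N) (f *
  g).
Proof.
move=> fM gN m; apply: valuation_ge_sum => k _; exact: valuation_geM.
Qed.

Hypothesis v_complete : valuation_complete v.

Lemma gauss_complete (u : nat -> tate v n) :
  filtered_cauchy gauss_ge u -> exists l, filtered_cvg gauss_ge u l.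
Proof.
move=> uC; have /choice[l lP] m : exists l, valuation_cvg v (fun i => u i m) l.
  apply: v_complete => M; have [N hN] := uC M; exists N => i j Ni Nj.
  exact: hN.
(* Uniformity in [m]: the rank [N] comes from the Cauchy condition alone, while the rank depending
   on [m] is used only to compare with the limit coefficient. *)
have ulP M : exists N, forall i, (N <= i)%N -> forall m,
  (M%:E <= v (u i m - l m)%R)%E.
  have [N hN] := uC M; exists N => i Ni m; have [N' hN'] := lP m M.
  rewrite -(subrK (u (maxn N N') m) (u i m)) -addrA.
  apply: valuation_geD; last by apply: hN'; exact: leq_maxr.
  by apply: (hN i (maxn N N')) => //; exact: leq_maxl.
have lT : MPSeries l \in @tate_pred R K v n.
  apply/asboolP => M; have [N /(_ N (leqnn _)) hN] := ulP M.
  have [N' hN'] := tateP (u N) M; exists N' => m /hN' uM /=.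
  rewrite -(subKr (u N m) (l m)); apply: valuation_geD => //.
  by rewrite valuationN.
by exists (Tate lT) => M; have [N hN] := ulP M; exists N => i Ni m; exact: hN.
Qed.

Definition tate_filtration : filtration R (tate v n).
Proof.
apply: (@Filtration R _ gauss_ge).
- by move=> M m; rewrite valuation0 leey.
- by move=> M f g fM gM m; apply: valuation_geD => //; rewrite valuationN.
- by move=> m /=; case: eqP => _; rewrite ?valuation1 ?valuation0 ?leey.
- exact: gauss_geM.
- move=> f fM; apply: tate_eqP => m; apply: (@valuation_separated _ _ v) => M.
  exact: fM.
- exact: gauss_complete.
Defined.

End TateFiltration.

Lemma ps_trunc_coef n (A : comNzRingType) N (f : mpseries n A) m :
  mcoeff m (ps_trunc N f) = if (mdeg m < N)%N then f m else 0.
Proof.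
case: ltnP => mN; first exact: ps_truncE.
rewrite /ps_trunc raddf_sum big1 // => k _ /=; rewrite mcoeffZ mcoeffX.
case: eqP => [km|_]; last by rewrite mulr0.
by have := bmdeg k; rewrite km ltnNge mN.
Qed.

Section TatePolynomials.
Variables (R : realType) (K : fieldType) (v : valuation R K) (n : nat).
Implicit Types (p q : mpoly n K) (f g : tate v n).

Fact tate_poly_proof p : MPSeries (fun m => mcoeff m p) \in @tate_pred R K v n.
Proof.
apply/asboolP => M; exists (msize p) => m pm /=.
rewrite memN_msupp_eq0 ?valuation0 ?leey //.
by apply/negP => /msize_mdeg_lt; rewrite ltnNge pm.
Qed.
Definition tate_poly p : tate v n := Tate (tate_poly_proof p).

Fact tate_poly_additive : zmod_morphism tate_poly.
Proof. by move=> p q; apply: tate_eqP => m /=; rewrite mcoeffB. Qed.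
Fact tate_poly_multiplicative : monoid_morphism tate_poly.
Proof.
split=> [|p q]; apply: tate_eqP => m.
  by rewrite /= mcoeff1; case: eqP.
exact/esym/(@ps_mulE n K (mdeg m).+1).
Qed.
HB.instance Definition _ :=
  GRing.isZmodMorphism.Build (mpoly n K) (tate v n) tate_poly
    tate_poly_additive.
HB.instance Definition _ :=
  GRing.isMonoidMorphism.Build (mpoly n K) (tate v n) tate_poly
    tate_poly_multiplicative.

Lemma tate_polyC c : tate_poly (mpolyC n c) = tateC v n c.
Proof.
by apply: tate_eqP => m /=; rewrite mcoeffC; case: eqP; rewrite ?mulr1 ?mulr0.
Qed.

Lemma ps_truncB N f g : ps_trunc N (f - g) = ps_trunc N f - ps_trunc N g.
Proof.
by apply/mpolyP => m; rewrite mcoeffB !ps_trunc_coef; case: ifP; rewrite ?subr0.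
Qed.

Lemma ps_trunc_poly N p : (msize p <= N)%N -> ps_trunc N (tate_poly p) = p.
Proof.
move=> pN; apply/mpolyP => m; rewrite ps_trunc_coef; case: ltnP => // Nm.
rewrite memN_msupp_eq0 //; apply/negP => /msize_mdeg_lt; rewrite ltnNge.
by rewrite (leq_trans pN Nm).
Qed.

Lemma tate_dense f M : exists N, forall i, (N <= i)%N ->
  gauss_ge M (f - tate_poly (ps_trunc i f)).
Proof.
have [N hN] := tateP f M; exists N => i Ni m.
rewrite tate_coefB /= ps_trunc_coef; case: ltnP => im.
  by rewrite subrr valuation0 leey.
by rewrite subr0; apply: hN; exact: leq_trans im.
Qed.

End TatePolynomials.
Arguments tate_poly {R K} v {n} p.

Section Substitution.
Variables (R : realType) (K : fieldType) (v : valuation R K) (n : nat).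
Variables (B : comNzRingType) (F : filtration R B).
Variables (iota : {rmorphism K -> B}) (b : 'I_n -> B).
Hypothesis iotaF : forall (M : R) c, (M%:E <= v c)%E -> F M (iota c).
Hypothesis bF : forall i, F 0 (b i).
Implicit Types f g : tate v n.

Let eval_poly : {rmorphism mpoly n K -> B} := mmap iota b.
Let partial f N := eval_poly (ps_trunc N f).

Let eval_poly_fil M p :
  (forall m, (M%:E <= v (mcoeff m p))%E) -> F M (eval_poly p).
Proof.
move=> pM; apply: fil_sum => m _; apply: filMr; first exact: iotaF.
by apply: fil_prod => i; apply: filX0.
Qed.

Let eval_exists f : exists l, filtered_cvg F (partial f) l.
Proof.
apply: fil_complete => M; have [N hN] := tateP f M; exists N => i j Ni Nj.
rewrite /partial -rmorphB; apply: eval_poly_fil => m.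
rewrite mcoeffB !ps_trunc_coef; case: ltnP => mi; case: ltnP => mj;
  rewrite ?subrr ?subr0 ?sub0r ?valuationN ?valuation0 ?leey //;
  apply: hN; [exact: leq_trans mj | exact: leq_trans mi].
Qed.

Let eval f := sval (cid (eval_exists f)).
Let evalP f : filtered_cvg F (partial f) (eval f).
Proof. by rewrite /eval; case: cid. Qed.

Let evalB : zmod_morphism eval.
Proof.
move=> f g; apply: (@filtered_cvg_unique _ _ F (partial (f - g))) => //.
rewrite (_ : partial _ = fun i => partial f i - partial g i).
  exact: filtered_cvgB.
by apply/funext => i; rewrite /partial ps_truncB rmorphB.
Qed.

Let eval_fil M f : gauss_ge M f -> F M (eval f).
Proof.
move=> fM; apply: (@filtered_cvg_fil _ _ F (partial f) _ _ 0%N) => // i _.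
apply: eval_poly_fil => m; rewrite ps_trunc_coef; case: ifP => // _.
by rewrite valuation0 leey.
Qed.

Let eval_tate_poly p : eval (tate_poly v p) = eval_poly p.
Proof.
apply: (@filtered_cvg_unique _ _ F (partial (tate_poly v p))) => // M.
exists (msize p) => i pi; rewrite /partial ps_trunc_poly // subrr.
exact: fil0.
Qed.

Let evalM f g : eval (f * g) = eval f * eval g.
Proof.
apply/eqP; rewrite -subr_eq0; apply/eqP/(@fil_separated _ _ F) => M.
have [bf fb] := tate_bounded (tateP f); have [bg gb] := tate_bounded (tateP g).
(* The products f(g - q) and (f - p)q must reach precision [M]. The bound [bg] in the second maximum
   gives [q] the lower bound of [g]. *)
have [N hN] := tate_dense f (Num.max (M - bg) bf).
have [N' hN'] := tate_dense g (Num.max (M - bf) bg).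
have := hN N (leqnn _); have := hN' N' (leqnn _).
set p := ps_trunc N f; set q := ps_trunc N' g => gq fp.
have gW (h : tate v n) a a' : a <= a' -> gauss_ge a' h -> gauss_ge a h.
  by move=> aa' ha m; apply: le_trans (ha m); rewrite lee_fin.
have gq1 : gauss_ge (M - bf) (g - tate_poly v q) by apply: gW gq;
  rewrite le_max lexx.
have gq2 : gauss_ge bg (g - tate_poly v q) by apply: gW gq;
  rewrite le_max lexx orbT.
have fp1 : gauss_ge (M - bg) (f - tate_poly v p) by apply: gW fp;
  rewrite le_max lexx.
have qb : gauss_ge bg (tate_poly v q).
  move=> m; rewrite -(subKr g (tate_poly v q)) tate_coefB.
  by apply: valuation_geD => //; rewrite valuationN.
apply: (@fil_trans _ _ _ _ (eval (tate_poly v p * tate_poly v q))).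
  rewrite -evalB; apply: eval_fil.
  rewrite -(subrK (f * tate_poly v q) (f * g)) -mulrBr -addrA -mulrBl => m.
  rewrite tate_coefD; apply: valuation_geD.
    by rewrite -(subrKC bf M); exact: gauss_geM.
  by rewrite -(subrK bg M); exact: gauss_geM.
rewrite -rmorphM eval_tate_poly rmorphM -!eval_tate_poly; apply: filBC.
rewrite -(subrK (eval f * eval (tate_poly v q)) (eval f * eval g)).
rewrite -mulrBr -addrA -mulrBl -!evalB; apply: filD.
  by rewrite -(subrKC bf M); apply: filM; exact: eval_fil.
by rewrite -(subrK bg M); apply: filM; exact: eval_fil.
Qed.

(** Universal property of the Tate algebra for complete filtered rings. It is applied with another
    Tate algebra (lifting the normalization), with K (specialization) and with the completed
    algebraic closure (evaluation) as target. *)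
Lemma tate_substitution : exists phi : {rmorphism tate v n -> B},
  [/\ forall p, phi (tate_poly v p) = mmap iota b p,
      forall M f, gauss_ge M f -> F M (phi f) &
      forall f, filtered_cvg F (fun N => mmap iota b (ps_trunc N f)) (phi f)].
Proof.
have eval_mul : monoid_morphism eval.
  by split=> //; rewrite -(rmorph1 (tate_poly v)) eval_tate_poly rmorph1.
pose phi : {rmorphism tate v n -> B} :=
  HB.pack eval (GRing.isZmodMorphism.Build _ _ eval evalB)
    (GRing.isMonoidMorphism.Build _ _ eval eval_mul).
by exists phi.
Qed.

End Substitution.

(** * Scaling and approximation in Tate algebras *)

Section Scaling.
Variables (R : realType) (K : fieldType) (v : valuation R K).

Lemma valuation_le_div c x : c != 0 -> ((0 <= v (c^-1 * x)%R) = (v c <= v x))%E.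
Proof.
move=> c0; have -> : v x = (v c + v (c^-1 * x)%R)%E by rewrite -valuationM
  mulVKf.
have /fineK <- := valuation_fin v c0.
by case: (v (c^-1 * x)%R) => [r| |] //=; rewrite ?lee_fin ?lerDl ?leey.
Qed.

Lemma valuation_lt_div c x : c != 0 -> ((0 < v (c^-1 * x)%R) = (v c < v x))%E.
Proof.
move=> c0; have -> : v x = (v c + v (c^-1 * x)%R)%E by rewrite -valuationM
  mulVKf.
have /fineK <- := valuation_fin v c0.
by case: (v (c^-1 * x)%R) => [r| |] //=; rewrite ?lte_fin ?ltrDl ?ltry.
Qed.

Lemma valuation_min (s : seq K) : s != [::] ->
  exists2 x, x \in s & forall y, y \in s -> (v x <= v y)%E.
Proof.
elim: s => // x s IHs _; have [->|/IHs[y ys ymin]] := eqVneq s [::].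
  by exists x; rewrite ?mem_head // => y; rewrite inE => /eqP ->.
have [xy|yx] := leP (v x) (v y).
  exists x; rewrite ?mem_head // => z; rewrite inE => /predU1P[->//|/ymin].
  exact: le_trans.
exists y; rewrite ?inE ?ys ?orbT // => z; rewrite inE => /predU1P[->|/ymin//].
exact: ltW.
Qed.

Lemma tateC_coef n c (f : tate v n) m : (tateC v n c * f) m = c * f m.
Proof.
rewrite [LHS](@ps_mulE n K (mdeg m).+1 _ _ (mpolyC n c) (ps_trunc (mdeg m).+1
  f)) //.
- by rewrite mcoeffCM ps_truncE.
- by move=> l _; rewrite mcoeffC /=; case: eqP; rewrite ?mulr1 ?mulr0.
- by move=> l lm; rewrite ps_truncE.
Qed.

Lemma itate_lift n (f : tate v n) : (forall m, (0 <= v (f m))%E) ->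
  exists g : itate v n, itate_incl v n g = f.
Proof.
by move=> f0; have fI : f \in @itate_pred R K v n by [exact/asboolP];
  exists (ITate fI).
Qed.

Lemma itate_incl_inj n : injective (itate_incl v n).
Proof. exact: val_inj. Qed.

Lemma itate_inclM n (f g : itate v n) :
  itate_incl v n (f * g) = itate_incl v n f * itate_incl v n g.
Proof. exact: rmorphM. Qed.

Lemma itate_inclB n (f g : itate v n) :
  itate_incl v n (f - g) = itate_incl v n f - itate_incl v n g.
Proof. exact: rmorphB. Qed.

Lemma itate_inclC n c : itate_incl v n (itateC v n c) = tateC v n (val c).
Proof. by []. Qed.

Lemma reductionB n (f g : itate v n) : reduction (f - g) = reduction f -
  reduction g.
Proof. exact: rmorphB. Qed.

Lemma reduction_eq0 n (f : itate v n) :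
  (forall m, (0 < v (f m))%E) -> reduction f = 0.
Proof.
move=> f0; apply/mpolyP => m; rewrite mcoeff_reduction mcoeff0;
  apply/residue_eq0.
exact: f0.
Qed.

Lemma reduction0_gt0 n (f : itate v n) m : reduction f = 0 -> (0 < v (f m))%E.
Proof.
move=> /(congr1 (mcoeff m)); rewrite mcoeff_reduction mcoeff0.
exact: (proj1 (residue_eq0 _)).
Qed.

(** Divide by a coefficient of least valuation. One exists even for a dense valuation, since beyond
    some degree all coefficients are at least as small as a fixed nonzero one. *)
Lemma tate_scale n (f : tate v n) : f != 0 -> exists c (g : itate v n),
  [/\ c != 0, f = tateC v n c * itate_incl v n g & reduction g != 0].
Proof.
move=> f0; have [m1 fm1] : exists m, f m != 0.
  apply: contrapT => /forallNP h; case/eqP: f0; apply: tate_eqP => m.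
  by apply/eqP/negP => /negP /h.
have /fineK vm1 := valuation_fin v fm1.
have [N hN] := tateP f (fine (v (f m1))).
have [_ [m0 ->] cmin] : exists2 x, exists m, x = f m &
    forall m, (v x <= v (f m))%E.
  pose s := f m1 :: [seq f m | m : bmultinom n N].
  have [//|x sx xmin] := @valuation_min s.
  exists x => [|m].
    move: sx; rewrite inE => /predU1P[->|/codomP[m ->]]; first by exists m1.
    by exists m.
  have [mN|Nm] := ltnP (mdeg m) N; last first.
    apply: le_trans (hN _ Nm); rewrite vm1.
    by apply: xmin; rewrite mem_head.
  apply: xmin; rewrite inE; apply/orP; right.
  by apply/codomP; exists (BMultinom mN).
have c0 : f m0 != 0.
  apply: contra_neq fm1 => fm0; have := cmin m1.
  by rewrite fm0 valuation0 leye_eq => /eqP/valuation_eqy.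
have [m|g gE] := @itate_lift n (tateC v n (f m0)^-1 * f).
  by rewrite tateC_coef valuation_le_div.
exists (f m0), g; split=> //.
  by rewrite gE mulrA -rmorphM mulfV // rmorph1 mul1r.
apply/eqP => /(@reduction0_gt0 n _ m0).
have -> : g m0 = (f m0)^-1 * f m0 by rewrite -tateC_coef -gE.
by rewrite mulVf // valuation1 ltxx.
Qed.

Lemma itate_divisible n (f : itate v n) (c : valring v) : val c != 0 ->
  (forall m, (v (val c) <= v (f m))%E) -> exists g, f = itateC v n c * g.
Proof.
move=> c0 cf; have [m|g gE] := @itate_lift n (tateC v n (val c)^-1 * itate_incl
  v n f).
  by rewrite tateC_coef valuation_le_div.
exists g; apply: itate_incl_inj; rewrite itate_inclM gE itate_inclC mulrA.
by rewrite -rmorphM mulfV // rmorph1 mul1r.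
Qed.

Lemma itateC_coef n (c : valring v) (f : itate v n) m :
  (itateC v n c * f) m = val c * f m.
Proof. exact: (tateC_coef (val c) (itate_incl v n f)). Qed.

Hypothesis v_nontrivial : valuation_nontrivial v.

(** Stands in for a uniformizer, which a non-discrete valuation does not have. *)
Lemma exists_pseudouniformizer : exists2 c : valring v,
  val c != 0 & (0 < v (val c))%E.
Proof.
have [x [x0 vx]] := v_nontrivial.
have H (y : K) : y != 0 -> (0 < v y)%E ->
    exists2 c : valring v, val c != 0 & (0 < v (val c))%E.
  move=> y0 vy; have yR : y \in valring_pred v by exact: ltW.
  by exists (ValRing yR).
have [|vx0] := ltP 0%E (v x); first exact: H.
apply: (H x^-1); first by rewrite invr_eq0.
rewrite -[x^-1]mulr1 valuation_lt_div // valuation1.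
by rewrite lt_neqAle vx vx0.
Qed.

Lemma exists_small_bound (s : seq K) : (forall x, x \in s -> (0 < v x)%E) ->
  exists c : valring v, [/\ val c != 0, (0 < v (val c))%E &
    forall x, x \in s -> (v (val c) <= v x)%E].
Proof.
move=> s0; have [c0 c0n vc0] := exists_pseudouniformizer.
(* Adding [c0] to the list keeps the minimum finite, even if [s] is empty or consists of zeros. *)
have [//|x xs xmin] := @valuation_min (val c0 :: s).
have vx : (0 < v x)%E by move: xs; rewrite inE => /predU1P[->|/s0].
have xR : x \in valring_pred v by exact: ltW.
exists (ValRing xR); split=> //=.
  apply: contra_neq c0n => x0; have := xmin (val c0) (mem_head _ _).
  by rewrite x0 valuation0 leye_eq => /eqP/valuation_eqy.
by move=> y ys; apply: xmin; rewrite inE ys orbT.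
Qed.

Lemma tate_min_coef n (f : tate v n) : exists m0, forall m,
  (v (f m0) <= v (f m))%E.
Proof.
have [->|f0] := eqVneq f 0; first by exists mnm0.
have [c [g [c0 fE gr]]] := tate_scale f0.
have [m0 gm0] : exists m0, ~ (0 < v (g m0))%E.
  by apply: contrapT => /forallNP h; case/eqP: gr; apply: reduction_eq0 => m;
    apply: contrapT; exact: h.
exists m0 => m; rewrite fE !tateC_coef !valuationM.
apply: leeD => //; apply: (@le_trans _ _ 0%E); last exact: itate_ge0.
by rewrite leNgt; exact/negP.
Qed.

(** Each [e t] attains its least valuation, which is positive, and finitely many positive values
    have a positive lower bound. This takes the place of dividing by a generator of the maximal
    ideal. *)
Lemma exists_uniform_divisor n (T : finType) (e : T -> itate v n) :
  (forall t, reduction (e t) = 0) ->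
  exists c : valring v, [/\ val c != 0, (0 < v (val c))%E &
    forall t, exists g, e t = itateC v n c * g].
Proof.
move=> e0; have /choice[m mP] t := tate_min_coef (itate_incl v n (e t)).
have [|c [c0 cpos cP]] := @exists_small_bound [seq e t (m t) | t : T].
  by move=> _ /codomP[t ->]; exact: reduction0_gt0.
exists c; split=> // t; apply: itate_divisible => // m'.
by apply: le_trans (mP t m'); apply: cP; exact: codom_f.
Qed.

Section PowerSeries.
Variables (n : nat) (c : valring v).
Hypotheses (c0 : val c != 0) (c_gt0 : (0 < v (val c))%E).
Hypothesis v_complete : valuation_complete v.

Lemma valuation_exp x M i : (M%:E <= v x)%E -> ((M *+ i)%:E <= v (x ^+ i)%R)%E.
Proof. exact: (@filX _ _ (field_filtration v_complete)). Qed.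

Lemma valuation_exp_large (M : R) : exists i, (M%:E <= v (val c ^+ i)%R)%E.
Proof.
have /fineK vc := valuation_fin v c0.
have vcpos : 0 < fine (v (val c)) by rewrite -lte_fin vc.
pose i := Num.bound `|M / fine (v (val c))|; exists i.
apply: (@le_trans _ _ (fine (v (val c)) *+ i)%:E); last first.
  by apply: valuation_exp; rewrite vc.
rewrite lee_fin -mulr_natl -ler_pdivrMr //.
by apply: ltW; apply: le_lt_trans (ler_norm _) _; exact/archi_boundP/normr_ge0.
Qed.

Lemma itate_separated (f : itate v n) :
  (forall i, exists g, f = itateC v n c ^+ i * g) -> f = 0.
Proof.
move=> fdiv; apply: itate_incl_inj; apply: tate_eqP => m.
apply: (@valuation_separated _ _ v) => M.
have [i Mi] := valuation_exp_large M; have [g ->] := fdiv i.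
rewrite -rmorphXn itateC_coef rmorphXn valuationM.
by apply: (le_trans Mi); rewrite leeDl // itate_ge0.
Qed.

(** The sum of the series c^i a_i. Its remainders are given as exact multiples of c^N, so that a
    ring morphism fixing constants carries them along with no continuity assumption. *)
Lemma itate_geometric_sum (a : nat -> itate v n) :
  exists l, forall N, exists z,
    l - \sum_(i < N) itateC v n c ^+ i * a i = itateC v n c ^+ N * z.
Proof.
pose u N : itate v n := \sum_(i < N) itateC v n c ^+ i * a i.
have uB N d : exists z, u (N + d)%N - u N = itateC v n c ^+ N * z.
  exists (\sum_(i < d) itateC v n c ^+ i * a (N + i)%N).
  rewrite /u big_split_ord addrC addKr mulr_sumr; apply: eq_bigr => i _.
  by rewrite exprD mulrA.
have divM N z m (M : R) : (M%:E <= v (val c ^+ N)%R)%E ->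
    (M%:E <= v ((itateC v n c ^+ N * z)%R m))%E.
  move=> MN; rewrite -rmorphXn itateC_coef rmorphXn valuationM.
  by apply: (le_trans MN); rewrite leeDl // itate_ge0.
have uge N (M : R) : (M%:E <= v (val c ^+ N)%R)%E -> forall i, (N <= i)%N ->
    gauss_ge M (itate_incl v n (u i) - itate_incl v n (u N)).
  move=> MN i Ni m; have [z] := uB N (i - N)%N; rewrite subnKC // => E.
  by rewrite -rmorphB E; exact: divM.
pose F := tate_filtration n v_complete.
have [l lP] : exists l, filtered_cvg F (fun i => itate_incl v n (u i)) l.
  apply: fil_complete => M; have [N MN] := valuation_exp_large M.
  exists N => i j Ni Nj; apply: (@fil_trans _ _ F _ (itate_incl v n (u N))).
    exact: uge.
  by apply: filBC; exact: uge.
have [|g gE] := @itate_lift n l.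
  apply: (@filtered_cvg_fil _ _ F _ _ 0 0%N lP) => i _ m; exact: itate_ge0.
exists g => N.
have cN : val c ^+ N != 0 by rewrite expf_neq0.
have /fineK vN := valuation_fin v cN.
have lN : F (fine (v (val c ^+ N))) (l - itate_incl v n (u N)).
  have [N' hN'] := lP (fine (v (val c ^+ N))).
  apply: (@fil_trans _ _ F _ (itate_incl v n (u (maxn N N')))).
    by apply: filBC; apply: hN'; exact: leq_maxr.
  by apply: uge; rewrite ?vN // leq_maxl.
have [||z zE] := @itate_divisible n (g - u N) (c ^+ N).
- by rewrite rmorphXn.
- by move=> m; rewrite rmorphXn -vN; move: (lN m); rewrite -gE.
by exists z; rewrite zE rmorphXn.
Qed.

End PowerSeries.

End Scaling.

(** * Lifting the normalization *)

Section IntegralPolynomials.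
Variables (R : realType) (K : fieldType) (v : valuation R K) (n : nat).

Fact itateX_proof i : tate_poly v (mpolyX K (mnm1 i)) \in @itate_pred R K v n.
Proof.
apply/asboolP => m /=; rewrite mcoeffX; case: eqP => _; rewrite ?valuation1 //.
by rewrite valuation0 leey.
Qed.
Definition itateX i : itate v n := ITate (itateX_proof i).

Definition itate_poly : {rmorphism mpoly n (valring v) -> itate v n} :=
  mmap (itateC v n) itateX.

Definition valring_incl : {rmorphism valring v -> K} := val.

Lemma itate_polyC c : itate_poly (mpolyC n c) = itateC v n c.
Proof. exact: mmapC. Qed.

Lemma itate_polyX i : itate_poly (mpolyX _ (mnm1 i)) = itateX i.
Proof. exact: mmapX1. Qed.

Lemma itate_polyE p :
  itate_incl v n (itate_poly p) = tate_poly v (map_mpoly valring_incl p).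
Proof.
apply: (@rmorph_mpoly_eq n (valring v) (tate v n) (itate_incl v n \o itate_poly)
  (tate_poly v \o map_mpoly valring_incl)) => [c|i].
  transitivity (tateC v n (val c)); last first.
    by rewrite -tate_polyC; congr tate_poly; exact/esym/(map_mpolyC _
      valring_incl).
  exact: (congr1 (itate_incl v n) (itate_polyC c)).
transitivity (tate_poly v (mpolyX K (mnm1 i))); last first.
  by congr tate_poly; exact/esym/(map_mpolyX valring_incl).
exact: (congr1 (itate_incl v n) (itate_polyX i)).
Qed.

Lemma itate_poly_dense (M : R) (f : itate v n) : exists p,
  gauss_ge M (itate_incl v n (f - itate_poly p)).
Proof.
have [N hN] := tate_dense (itate_incl v n f) M.
pose p := ps_trunc N (MPSeries (itate_coef f)); exists p => m.
have -> : itate_incl v n (f - itate_poly p) =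
    itate_incl v n f - tate_poly v (map_mpoly valring_incl p).
  by rewrite -itate_polyE; exact: rmorphB.
have := hN N (leqnn _) m; rewrite !tate_coefB /=.
rewrite (mcoeff_map_mpoly valring_incl) !ps_trunc_coef.
by case: ifP => // _; rewrite rmorph0.
Qed.

Lemma reductionC c : reduction (itateC v n c) = mpolyC n (residue c).
Proof.
apply/mpolyP => m; rewrite mcoeff_reduction mcoeffC; case: eqP => [->|/eqP m0].
  by rewrite mulr1; congr residue; apply: val_inj; rewrite /= eqxx.
rewrite mulr0; apply/residue_eq0 => /=; rewrite (negbTE m0) valuation0.
exact: ltey.
Qed.

Lemma reductionX i : reduction (itateX i) = mpolyX _ (mnm1 i).
Proof.
apply/mpolyP => m; rewrite mcoeff_reduction mcoeffX; case: eqP => [<-|/eqP m0].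
  rewrite -(rmorph1 (@residue _ _ v)); congr residue; apply: val_inj => /=.
  by rewrite mcoeffX eqxx.
by apply/residue_eq0 => /=; rewrite mcoeffX (negbTE m0) valuation0 ltey.
Qed.

End IntegralPolynomials.

Section Lifting.
Variables (R : realType) (K : fieldType) (v : valuation R K).
Hypotheses (v_complete : valuation_complete v) (v_nontrivial :
  valuation_nontrivial v).
Variables (d n : nat).

Lemma lift_substitution (y : 'I_d -> mpoly n (residue_field v)) :
  exists (phi : {rmorphism tate v d -> tate v n})
         (Phi : {rmorphism itate v d -> itate v n}),
  [/\ forall f, itate_incl v n (Phi f) = phi (itate_incl v d f),
      forall c, phi (tateC v d c) = tateC v n c,
      forall M f, gauss_ge M f -> gauss_ge M (phi f) &
      forall f, reduction (Phi f) = mmap (@mpolyC n _) y (reduction f)].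
Proof.
have /choice[Y Yy] i := reduction_surj (y i).
have [||phi [phi_poly phi_fil _]] := @tate_substitution R K v d (tate v n)
  (tate_filtration n v_complete) (tateC v n) (fun i => itate_incl v n (Y i)).
- move=> M c Mc m /=; case: eqP => // _; by rewrite valuation0 leey.
- by move=> i m; exact: itate_ge0.
have phiI (f : itate v d) m : (0 <= v (phi (itate_incl v d f) m))%E.
  by apply: phi_fil => m'; exact: itate_ge0.
have phiI' (f : itate v d) : phi (itate_incl v d f) \in @itate_pred R K v n.
  exact/asboolP.
pose Phi0 f := ITate (phiI' f).
have PhiE f : itate_incl v n (Phi0 f) = phi (itate_incl v d f) by [].
have PhiB : zmod_morphism Phi0.
  move=> f g; apply: itate_incl_inj.
  by rewrite itate_inclB !PhiE itate_inclB rmorphB.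
have PhiM : monoid_morphism Phi0.
  split=> [|f g]; apply: itate_incl_inj; last by rewrite itate_inclM !PhiE
    itate_inclM rmorphM.
  by rewrite PhiE -[itate_incl v d 1]/(1 : tate v d) rmorph1.
pose Phi : {rmorphism itate v d -> itate v n} :=
  HB.pack Phi0 (GRing.isZmodMorphism.Build _ _ Phi0 PhiB)
    (GRing.isMonoidMorphism.Build _ _ Phi0 PhiM).
have phiC c : phi (tateC v d c) = tateC v n c.
  by rewrite -tate_polyC phi_poly mmapC.
exists phi, Phi; split=> // f.
(* Series of Gauss valuation at least 1 reduce to 0 and stay so under [phi]; it is thus enough to
   compare both sides on integral polynomials, that is, on constants and variables. *)
have [p fp] := itate_poly_dense 1 f.
have red0 n' (h : itate v n') : gauss_ge 1 (itate_incl v n' h) -> reduction h =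
  0.
  by move=> h1; apply: reduction_eq0 => m; apply: lt_le_trans (h1 m);
    rewrite lte_fin.
have -> : reduction f = reduction (itate_poly v d p).
  by apply/eqP; rewrite -subr_eq0 -reductionB red0.
have -> : reduction (Phi f) = reduction (Phi (itate_poly v d p)).
  apply/eqP; rewrite -subr_eq0 -reductionB -rmorphB red0 //.
  exact: phi_fil fp.
apply: (@rmorph_mpoly_eq d (valring v) _ (@reduction R K v n \o Phi \o
  itate_poly v d)
  (mmap (@mpolyC n _) y \o @reduction R K v d \o itate_poly v d)) => [c|i].
  transitivity (mpolyC n (residue c)).
    rewrite -[LHS]/(reduction (Phi (itate_poly v d (mpolyC d c)))) itate_polyC.
    by rewrite -reductionC; congr reduction; apply: itate_incl_inj; exact: phiC.
  rewrite -[RHS]/(mmap (@mpolyC n _) y (reduction (itate_poly v d (mpolyC d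
    c)))).
  by rewrite itate_polyC reductionC mmapC.
transitivity (y i).
  rewrite -[LHS]/(reduction (Phi (itate_poly v d (mpolyX _ (mnm1 i)))))
    itate_polyX.
  rewrite -Yy; congr reduction; apply: itate_incl_inj.
  rewrite -[LHS]/(phi (tate_poly v (mpolyX K (mnm1 i)))).
  by rewrite phi_poly mmapX1.
rewrite -[RHS]/(mmap (@mpolyC n _) y (reduction (itate_poly v d (mpolyX _ (mnm1
  i))))).
by rewrite itate_polyX reductionX mmapX1.
Qed.

End Lifting.

(* The finitely many relations expressing 1 and the X_i * S_l over the
   generators modulo I hold up to errors in the kernel of the reduction, which
   are all divisible by a single c of positive valuation. Iterating the
   resulting decomposition of f converges for the coefficients of the S_l and
   of the relations h_t in I, so that one does not need I to be closed. *)
Lemma lift_finite (R : realType) (K : fieldType) (v : valuation R K)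
    (v_complete : valuation_complete v) (v_nontrivial : valuation_nontrivial v)
    (d n : nat) (y : 'I_d -> mpoly n (residue_field v))
    (Phi : {rmorphism itate v d -> itate v n}) (I : ideal (itate v n)) :
  (forall c, Phi (itateC v d c) = itateC v n c) ->
  (forall f, reduction (Phi f) = mmap (@mpolyC n _) y (reduction f)) ->
  finite_mod (mmap (@mpolyC n _) y) (reduced_ideal I) -> finite_mod Phi I.
Proof.
move=> PhiC Phi_red [r [s sP]]; have /choice[S Ss] l := reduction_surj (s l).
(* [None] indexes the generator 1, and [Some (i, l)] the product of the variable X_i with S_l. *)
pose T := option ('I_n * 'I_r).
pose gen (t : T) := if t is Some il then itateX v il.1 * S il.2 else 1.
have /choice[A /choice[h hP]] t : exists (A : 'I_r -> itate v d) h, I h /\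
    reduction (gen t - \sum_l Phi (A l) * S l - h) = 0.
  have [c [h Ih hE]] := sP (reduction (gen t)).
  have /choice[A Ac] l := reduction_surj (c l).
  exists A, h; split=> //; rewrite !reductionB hE rmorph_sum.
  rewrite (eq_bigr (fun l => mmap (@mpolyC n _) y (c l) * s l)) ?subrr // =>
    l _.
  by rewrite rmorphM /= Phi_red Ac Ss.
have Ih t : I (h t) by have [] := hP t.
have [t|c [c0 c_gt0]] := exists_uniform_divisor v_nontrivial
  (e := fun t => gen t - \sum_l Phi (A t l) * S l - h t) _.
  by have [] := hP t.
move=> /choice[e eP]; set C := itateC v n c in eP.
pose comb (a : 'I_r -> itate v d) (b : T -> itate v n) :=
  \sum_l Phi (a l) * S l + \sum_t b t * h t.
have combD a b a' b' : comb (fun l => a l + a' l) (fun t => b t + b' t) =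
    comb a b + comb a' b'.
  rewrite /comb addrACA -!big_split; congr (_ + _); apply: eq_bigr => l _ /=.
    by rewrite rmorphD mulrDl.
  by rewrite mulrDl.
have combM x a b : comb (fun l => x * a l) (fun t =>
  Phi x * b t) = Phi x * comb a b.
  rewrite /comb mulrDr !mulr_sumr; congr (_ + _); apply: eq_bigr => l _ /=.
    by rewrite rmorphM mulrA.
  by rewrite mulrA.
(* One step of the approximation. Closure under sums, under [Phi] and under the variables gives it
   for polynomials, then density gives it for all series. *)
pose W f := exists a b g, f = comb a b + C * g.
have W0 : W 0.
  exists (fun=> 0), (fun=> 0), 0; rewrite /comb mulr0 addr0 !big1 ?addr0 // =>
    l _.
    by rewrite mul0r.
  by rewrite rmorph0 mul0r.
have WD f g : W f -> W g -> W (f + g).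
  move=> [a [b [u ->]]] [a' [b' [u' ->]]].
  by do 3 eexists; rewrite addrACA -combD -mulrDr.
have W_sum (J : Type) (q : seq J) (F : J -> itate v n) :
    (forall j, W (F j)) -> W (\sum_(j <- q) F j).
  by move=> WF; apply: big_ind.
have WPhi x f : W f -> W (Phi x * f).
  move=> [a [b [u ->]]]; do 3 eexists.
  by rewrite mulrDr -combM mulrCA.
have Wh x t : W (x * h t).
  exists (fun=> 0), (fun t' => if t' == t then x else 0), 0.
  rewrite /comb mulr0 addr0 big1 ?add0r => [|l _];
    last by rewrite rmorph0 mul0r.
  rewrite (bigD1 t) //= eqxx big1 ?addr0 // => t' /negbTE ->.
  by rewrite mul0r.
have WC x : W (C * x).
  exists (fun=> 0), (fun=> 0), x; rewrite /comb !big1 ?add0r // => l _.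
    by rewrite mul0r.
  by rewrite rmorph0 mul0r.
have WS x l : W (Phi x * S l).
  exists (fun l' => if l' == l then x else 0), (fun=> 0), 0.
  rewrite /comb mulr0 addr0 [X in _ + X]big1 ?addr0 => [|t _];
    last by rewrite mul0r.
  rewrite (bigD1 l) //= eqxx big1 ?addr0 // => t' /negbTE ->.
  by rewrite rmorph0 mul0r.
have Wgen t : W (gen t).
  have -> : gen t = \sum_l Phi (A t l) * S l + 1 * h t + C * e t.
    by rewrite -eP mul1r; ring.
  by apply: (WD) => //; apply: (WD) => //; exact: W_sum.
have WX i f : W f -> W (itateX v i * f).
  move=> [a [b [u ->]]]; rewrite /comb !mulrDr mulrCA; apply: (WD) => //.
  rewrite !mulr_sumr; apply: (WD); apply: W_sum => l; last by rewrite mulrA.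
  by rewrite mulrCA; apply: (WPhi); exact: (Wgen (Some (i, l))).
have Wpoly p : W (itate_poly v n p).
  rewrite (mpolyE p) rmorph_sum; apply: W_sum => m.
  rewrite -mul_mpolyC rmorphM itate_polyC -PhiC; apply: (WPhi).
  rewrite mpolyXE_id rmorph_prod; apply: big_rec => [|i f _ Wf].
    exact: (Wgen None).
  rewrite rmorphXn itate_polyX; elim: (m i) => [|k IHk]; first by rewrite mul1r.
  by rewrite exprS -mulrA; exact: WX.
have Wall f : W f.
  have /fineK vc := valuation_fin v c0.
  (* Precision v(c) makes the error divisible by [C]. *)
  have [p fp] := itate_poly_dense (fine (v (val c))) f.
  have [m|g fE] := itate_divisible c0 (f := f - itate_poly v n p).
    by rewrite -vc; exact: fp.
  by rewrite -(subrK (itate_poly v n p) f) fE; apply: (WD).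
have /choice[a /choice[b /choice[g abgP]]] f := Wall f.
apply: (@finite_mod_sub _ _ _ I) => //; exists r, S => f.
(* The successive remainders of [f]; after N steps the error is C^N times [fs N]. *)
pose fs i := iter i g f.
have /choice[a' a'P] l : exists a', forall N, exists z,
    a' = \sum_(i < N) itateC v d c ^+ i * a (fs i) l + itateC v d c ^+ N * z.
  have [a' a'P] := itate_geometric_sum c0 c_gt0 v_complete (fun i =>
    a (fs i) l).
  exists a' => N; have [z zE] := a'P N; exists z.
  by rewrite -zE addrC subrK.
have /choice[b' b'P] t : exists b', forall N, exists z,
    b' = \sum_(i < N) C ^+ i * b (fs i) t + C ^+ N * z.
  have [b' b'P] := itate_geometric_sum c0 c_gt0 v_complete (fun i =>
    b (fs i) t).
  exists b' => N; have [z zE] := b'P N; exists z.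
  by rewrite -zE addrC subrK.
(* For every N, both sides equal the same partial combination up to a multiple of C^N. *)
exists a'; have fE : f = comb a' b'.
  apply/eqP; rewrite -subr_eq0; apply/eqP.
  apply: (itate_separated c0 c_gt0 v_complete) => N.
  have /choice[za zaE] l := a'P l N; have /choice[zb zbE] t := b'P t N.
  have combE : comb a' b' = comb (fun l => \sum_(i < N) itateC v d c ^+ i * a
    (fs i) l)
      (fun t => \sum_(i < N) C ^+ i * b (fs i) t) + C ^+ N * comb za zb.
    have <- : Phi (itateC v d c ^+ N) = C ^+ N by rewrite rmorphXn PhiC.
    rewrite -combM -combD; congr comb; apply/funext => l //=.
    by rewrite rmorphXn PhiC.
  have fN : f = comb (fun l => \sum_(i < N) itateC v d c ^+ i * a (fs i) l)
      (fun t => \sum_(i < N) C ^+ i * b (fs i) t) + C ^+ N * fs N.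
    elim: N {za zaE zb zbE combE} => [|N IHN].
      rewrite mul1r /comb !big1 ?add0r // => l _;
        rewrite big_ord0 ?rmorph0 mul0r //.
    rewrite {1}IHN {1}(abgP (fs N)).
    have -> : (fun l => \sum_(i < N.+1) itateC v d c ^+ i * a (fs i) l) =
        fun l => \sum_(i < N) itateC v d c ^+ i * a (fs i) l + itateC v d c ^+
          N * a (fs N) l.
      by apply/funext => l; rewrite big_ord_recr.
    have -> : (fun t => \sum_(i < N.+1) C ^+ i * b (fs i) t) =
        fun t => \sum_(i < N) C ^+ i * b (fs i) t + Phi (itateC v d c ^+ N) * b
          (fs N) t.
      by apply/funext => l; rewrite big_ord_recr rmorphXn PhiC.
    by rewrite combD combM mulrDr addrA rmorphXn PhiC exprSr mulrA.
  by exists (fs N - comb za zb); rewrite {1}fN combE; ring.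
rewrite {1}fE /comb addrC addKr; apply: ideal_sum => t _; exact: idealM.
Qed.

(** * Dimension of Tate algebras *)

Section TateDimension.
Variables (R : realType) (K : fieldType) (v : valuation R K).
Hypotheses (v_complete : valuation_complete v) (v_nontrivial :
  valuation_nontrivial v).

Lemma tateC_cancel n c (f : tate v n) : c != 0 ->
  tateC v n c^-1 * (tateC v n c * f) = f.
Proof. by move=> c0; rewrite mulrA -rmorphM mulVf // rmorph1 mul1r. Qed.

Lemma tateC_ideal n (a : ideal (tate v n)) c f :
  c != 0 -> a (tateC v n c * f) -> a f.
Proof. by move=> c0 af; rewrite -(tateC_cancel f c0); exact: idealM. Qed.

Lemma tate_scale_any n (f : tate v n) :
  exists c (g : itate v n), c != 0 /\ f = tateC v n c * itate_incl v n g.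
Proof.
have [->|/tate_scale[c [g [c0 fE _]]]] := eqVneq f 0; last by exists c, g.
by exists 1, 0; split; rewrite ?oner_neq0 // rmorph0 mulr0.
Qed.

(** An element of [I] with reduction 1 has the form 1 - Cg and is inverted by the geometric series,
    whether or not [I] is closed. *)
Lemma reduced_ideal_top n (I : ideal (itate v n)) : reduced_ideal I 1 -> I 1.
Proof.
move=> [h Ih h1]; have [t|c [c0 c_gt0]] := exists_uniform_divisor v_nontrivial
    (e := fun _ : unit => 1 - h) _.
  by rewrite reductionB h1 rmorph1 subrr.
move=> /(_ tt)[g gE]; set C := itateC v n c in gE.
have [l lP] := itate_geometric_sum c0 c_gt0 v_complete (fun i => g ^+ i).
suff -> : 1 = l * h by exact: idealM.
apply/eqP; rewrite -subr_eq0; apply/eqP.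
apply: (itate_separated c0 c_gt0 v_complete) => N.
have [z] := lP N; rewrite -/C => zE; exists (g ^+ N - z * h).
have hE : h = 1 - C * g by rewrite -gE; ring.
have geo : h * \sum_(i < N) C ^+ i * g ^+ i = 1 - C ^+ N * g ^+ N.
  under eq_bigr do rewrite -exprMn.
  rewrite hE -(opprB (C * g)) mulNr -subrX1 opprB.
  by rewrite exprMn.
have -> : l = C ^+ N * z + \sum_(i < N) C ^+ i * g ^+ i by rewrite -zE subrK.
by rewrite mulrDl [X in _ - (_ + X)]mulrC geo; ring.
Qed.

Section Lift.
Variables (d n : nat) (y : 'I_d -> mpoly n (residue_field v)).
Variables (phi : {rmorphism tate v d -> tate v n}).
Variables (Phi : {rmorphism itate v d -> itate v n}) (a : ideal (tate v n)).
Hypothesis PhiE : forall f, itate_incl v n (Phi f) = phi (itate_incl v d f).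
Hypothesis phiC : forall c, phi (tateC v d c) = tateC v n c.

Lemma lift_injective :
  (forall f, reduction (Phi f) = mmap (@mpolyC n _) y (reduction f)) ->
  injective_mod (mmap (@mpolyC n _) y)
    (reduced_ideal (contraction (itate_incl v n) a)) -> injective_mod phi a.
Proof.
move=> Phi_red y_inj f af; apply/eqP/negP => /negP /tate_scale[c [g [c0 fE]]].
case/eqP; apply: y_inj; exists (Phi g); last exact: Phi_red.
rewrite /= /contraction_set /= PhiE; apply: (tateC_ideal c0).
by rewrite -phiC -rmorphM -fE.
Qed.

Lemma lift_finite_tate :
  finite_mod Phi (contraction (itate_incl v n) a) -> finite_mod phi a.
Proof.
move=> [r [S SP]]; exists r, (fun l => itate_incl v n (S l)) => f.
have [c [g [_ ->]]] := tate_scale_any f; have [A AP] := SP g.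
exists (fun l => tateC v d c * itate_incl v d (A l)).
have -> : \sum_l phi (tateC v d c * itate_incl v d (A l)) * itate_incl v n (S
  l) =
    tateC v n c * itate_incl v n (\sum_l Phi (A l) * S l).
  rewrite rmorph_sum mulr_sumr; apply: eq_bigr => l _.
  by rewrite rmorphM phiC -PhiE [in RHS]rmorphM mulrA.
by rewrite -mulrBr; apply: idealM; move: AP; rewrite /= /contraction_set /=
  rmorphB.
Qed.

End Lift.

(** The same [d] normalizes the residue, integral and generic levels. It is less than n for nonzero
    [a], since a nonzero element of [a] scales to one with nonzero reduction. *)
Lemma tate_normalization n (a : ideal (tate v n)) : ~ a 1 ->
  exists d (y : 'I_d -> mpoly n (residue_field v))
    (phi : {rmorphism tate v d -> tate v n})
    (Phi : {rmorphism itate v d -> itate v n}),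
  [/\ forall f, itate_incl v n (Phi f) = phi (itate_incl v d f),
      forall c, phi (tateC v d c) = tateC v n c,
      [/\ finite_mod (mmap (@mpolyC n _) y)
        (reduced_ideal (contraction (itate_incl v n) a)) &
      injective_mod (mmap (@mpolyC n _) y)
        (reduced_ideal (contraction (itate_incl v n) a))],
      [/\ finite_mod phi a, injective_mod phi a &
          finite_mod Phi (contraction (itate_incl v n) a)] &
      (exists2 f, a f & f != 0) -> (d < n)%N].
Proof.
move=> a1; have red1 : ~ reduced_ideal (contraction (itate_incl v n) a) 1.
  by move=> /reduced_ideal_top; rewrite /= /contraction_set /= rmorph1.
have [d [y [y_fin y_inj _ d_lt]]] := noether_normalization red1.
have [phi [Phi [PhiE phiC phi_fil Phi_red]]] := lift_substitution v_complete y.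
have PhiC c : Phi (itateC v d c) = itateC v n c.
  by apply: itate_incl_inj; rewrite PhiE; exact: phiC.
have Phi_fin := lift_finite v_complete v_nontrivial PhiC Phi_red y_fin.
exists d, y, phi, Phi; split=> //.
  split=> //; first exact: lift_finite_tate PhiE phiC Phi_fin.
  exact: lift_injective PhiE phiC Phi_red y_inj.
move=> [f af /tate_scale[c [g [c0 fE gr]]]]; apply: d_lt;
  exists (reduction g) => //.
exists g => //; rewrite /= /contraction_set /=; apply: (tateC_ideal c0).
by rewrite -fE.
Qed.

(** Gauss's lemma: after scaling, both factors have nonzero reductions in a polynomial ring over a
    field. *)
Lemma tate_domain n : prime_ideal (zero_ideal (tate v n)).
Proof.
split=> [|x y /= xy]; first by apply/eqP; exact: oner_neq0.
apply: contrapT => /not_orP[/eqP/tate_scale[c [g [c0 xE gr]]]].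
move=> /eqP/tate_scale[c' [g' [c0' yE gr']]].
have gg : g * g' = 0.
  apply: itate_incl_inj; rewrite itate_inclM rmorph0.
  have cc : c * c' != 0 by rewrite mulf_neq0.
  rewrite -(tateC_cancel (_ * _) cc) rmorphM mulrACA -xE -yE xy.
  by rewrite mulr0.
move: (mulf_neq0 gr gr'); rewrite (_ : _ * _ = reduction (g * g')).
  by rewrite gg rmorph0 eqxx.
exact/esym/rmorphM.
Qed.

Lemma tate_hom_eq d n (f g : {rmorphism tate v d -> tate v n}) :
  (forall M h, gauss_ge M h -> gauss_ge M (f h)) ->
  (forall M h, gauss_ge M h -> gauss_ge M (g h)) ->
  (forall p, f (tate_poly v p) = g (tate_poly v p)) -> f =1 g.
Proof.
move=> fb gb fg h; apply/eqP; rewrite -subr_eq0; apply/eqP.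
apply: (@fil_separated _ _ (tate_filtration n v_complete)) => M.
have [N /(_ N (leqnn _)) hN] := tate_dense h M; set p := ps_trunc N h in hN.
apply: (@fil_trans _ _ _ _ (f (tate_poly v p))).
  by rewrite -rmorphB; exact: fb.
by rewrite fg; apply: filBC; rewrite -rmorphB; exact: gb.
Qed.

Lemma tate_polyX_ge0 n i : gauss_ge 0 (tate_poly v (mpolyX K (mnm1 i : multinom
  n))).
Proof.
move=> m /=; rewrite mcoeffX; case: eqP => _; rewrite ?valuation1 //.
by rewrite valuation0 leey.
Qed.

Lemma tateC_ge n (M : R) c : (M%:E <= v c)%E -> gauss_ge M (tateC v n c).
Proof. by move=> Mc m /=; case: eqP => // _; rewrite valuation0 leey. Qed.

Lemma tate_has_dim d : has_dim (zero_ideal (tate v d)) d.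
Proof.
move: d; apply: (@has_dim_family (fun d => tate v d)) => d;
  first exact: tate_domain.
(* The surjection sets the last variable to 0; inclusion of the other variables is a section of
   it. *)
- pose h (i : 'I_d.+1) : tate v d :=
    if unlift ord_max i is Some j then tate_poly v (mpolyX K (mnm1 j)) else 0.
  have h0 i : gauss_ge 0 (h i).
    rewrite /h; case: unliftP => [j|] _; first exact: tate_polyX_ge0.
    by move=> m; rewrite valuation0 leey.
  have [rho [rhoP rho_b _]] := @tate_substitution R K v d.+1 _
    (tate_filtration d v_complete) (tateC v d) h (@tateC_ge d) h0.
  pose g (j : 'I_d) : tate v d.+1 := tate_poly v (mpolyX K (mnm1 (lift ord_max
    j))).
  have [sec [secP sec_b _]] := @tate_substitution R K v d _
    (tate_filtration d.+1 v_complete) (tateC v d.+1) g (@tateC_ge d.+1)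
    (fun j => @tate_polyX_ge0 d.+1 (lift ord_max j)).
  exists rho; split=> [b|].
    exists (sec b); apply: (@tate_hom_eq d d (rho \o sec) idfun) => //.
      by move=> M f fM; apply: rho_b; exact: sec_b.
    apply: (@rmorph_mpoly_eq d K _ (rho \o sec \o tate_poly v) (tate_poly v))
      => [c|i].
      rewrite -[LHS]/(rho (sec (tate_poly v (mpolyC d c)))).
      have -> : sec (tate_poly v (mpolyC d c)) = tate_poly v (mpolyC d.+1 c).
        by rewrite secP mmapC tate_polyC.
      by rewrite rhoP mmapC; exact/esym/tate_polyC.
    rewrite -[LHS]/(rho (sec (tate_poly v (mpolyX K (mnm1 i))))) secP mmapX1.
    by rewrite /g rhoP mmapX1 /h liftK.
  exists (tate_poly v (mpolyX K (mnm1 ord_max))).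
    apply/eqP => /(congr1 (fun f : tate v d.+1 => f (mnm1 ord_max))).
    by rewrite /= mcoeffX eqxx; apply/eqP; exact: oner_neq0.
  by rewrite rhoP mmapX1 /h unlift_none.
- move=> P [P1 _] Pnz.
  have [e [_ [phi [_ [_ _ _ [fin inj _] ed]]]]] := tate_normalization P1.
  by exists e, phi; split=> //; exact: ed.
Qed.

Lemma tate_ideal_dim n (a : ideal (tate v n)) : ~ a 1 -> exists d,
  has_dim a d /\ has_dim (reduced_ideal (contraction (itate_incl v n) a)) d.
Proof.
move=> a1; have [d [y [phi [_ [_ _ [yf yi] [fin inj _] _]]]]] :=
  tate_normalization a1.
exists d; split; last exact: noether_dim yf yi.
exact: (@has_dim_finite (tate v d) (tate v n) _ _ fin d inj (tate_has_dim d)).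
Qed.

Lemma contraction_extension n (I : ideal (itate v n)) :
  contraction (itate_incl v n) (extension (itate_incl v n) I) = saturation I.
Proof.
apply: ideal_eq => f; split=> [|[r r0 If]]; last first.
  have r0' : val r != 0 by apply: contra_neq r0 => r0; exact: val_inj.
  apply: (@tateC_ideal _ (extension (itate_incl v n) I) (val r)) => //.
  by rewrite -itate_inclC -itate_inclM; exact: extensionW.
(* The series that some nonzero constant of R multiplies into [I]. They form an ideal of the Tate
   algebra, hence contain the extension of [I]. *)
pose Q : set (tate v n) := [set b | exists r : valring v,
  val r != 0 /\ exists2 g, I g & tateC v n (val r) * b = itate_incl v n g].
have Q0 : Q 0.
  exists 1; split; first by rewrite /= oner_neq0.
  by exists 0; [exact: ideal0 | rewrite mulr0 rmorph0].
have QD b b' : Q b -> Q b' -> Q (b + b').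
  move=> [r [r0 [g Ig gE]]] [r' [r0' [g' Ig' gE']]]; exists (r * r').
  split; first by rewrite /= mulf_neq0.
  exists (itateC v n r' * g + itateC v n r * g').
    by apply: idealD; exact: idealM.
  rewrite rmorphD /= !itate_inclM !itate_inclC -gE -gE' /= rmorphM.
  by ring.
have QM x b : Q b -> Q (x * b).
  move=> [r [r0 [g Ig gE]]]; have [c [u [c0 ->]]] := tate_scale_any x.
  (* [s] clears the denominator of [c]: it is 1 if [c] lies in R, and the inverse of [c]
     otherwise. *)
  have [s [s0 [t tE]]] : exists s : valring v, val s != 0 /\
      exists t : valring v, val t = val s * c.
    have [c_ge0|/ltW c_le0] := leP 0%E (v c).
      exists 1; split; first by rewrite /= oner_neq0.
      have cR : c \in valring_pred v by [].
      by exists (ValRing cR); rewrite /= mul1r.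
    have cR : c^-1 \in valring_pred v.
      rewrite unfold_in -[c^-1]mulr1 valuation_le_div // valuation1.
      exact: c_le0.
    exists (ValRing cR); split; first by rewrite /= invr_eq0.
    by exists 1; rewrite /= mulVf.
  exists (s * r); split; first by rewrite /= mulf_neq0.
  exists (itateC v n t * u * g); first exact: idealM.
  by rewrite !itate_inclM itate_inclC -gE tE /= !rmorphM; ring.
have := @extension_sub _ _ (itate_incl v n) I (Ideal Q0 QD QM) _ (itate_incl v
  n f).
rewrite /= /contraction_set /= => h /h[g Ig|r [r0 [g Ig gE]]].
  exists 1; split; first by rewrite /= oner_neq0.
  by exists g => //; rewrite rmorph1 mul1r.
exists r; first by apply: contra_neq r0 => ->.
suff -> : itateC v n r * f = g by [].
by apply: itate_incl_inj; rewrite itate_inclM itate_inclC.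
Qed.

End TateDimension.

(** * Dimension of the integral Tate algebra *)

Section IntegralDimension.
Variables (R : realType) (K : fieldType) (v : valuation R K).
Hypotheses (v_complete : valuation_complete v) (v_nontrivial :
  valuation_nontrivial v).
Variable n : nat.
Implicit Types (I J P Q : ideal (itate v n)) (f g : itate v n).

Let incl : {rmorphism itate v n -> tate v n} := itate_incl v n.
Let ext I := extension incl I.

(** For a prime [I], this says that its quotient has no R-torsion; such primes are exactly the
    contractions of primes of the Tate algebra over K. *)
Definition torsion_free_ideal I : Prop := forall r, I (itateC v n r) -> r = 0.

Lemma prime_saturated P :
  prime_ideal P -> torsion_free_ideal P -> contraction incl (ext P) = P.
Proof.
move=> [_ PM] flat; rewrite contraction_extension; apply: ideal_eq => f.
split=> [[r r0 /PM[/flat|//]]|Pf]; first by move/eqP; rewrite (negbTE r0).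
by exists 1; rewrite ?oner_neq0 // rmorph1 mul1r.
Qed.

Lemma extension_prime P :
  prime_ideal P -> torsion_free_ideal P -> prime_ideal (ext P).
Proof.
move=> pP flat; have extE f : P f <-> ext P (incl f).
  by rewrite -[in X in X <-> _](prime_saturated pP flat).
have [P1 PM] := pP; split=> [|x y].
  by rewrite -(rmorph1 incl) => /extE.
have [c [f [c0 ->]]] := tate_scale_any x; have [c' [g [c'0 ->]]] :=
  tate_scale_any y.
rewrite mulrACA -rmorphM => /tateC_ideal; rewrite mulf_neq0 // => /(_ isT).
rewrite -[_ * _]/(incl f * incl g) -rmorphM => /extE/PM[/extE fP|/extE gP];
  [left|right];
  exact: idealM.
Qed.

Lemma not_torsion_free I : ~ torsion_free_ideal I ->
  exists2 r : valring v, val r != 0 & I (itateC v n r).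
Proof.
move=> /existsNP[r /not_implyP[Ir r0]]; exists r => //.
by apply/eqP => r0'; apply: r0; exact: val_inj.
Qed.

(** A series with reduction 0 is divisible by some [c] of positive valuation. A large power of [c]
    is a multiple of the nonzero constant lying in [P], so [c] is in [P]. *)
Lemma torsion_prime_kernel P : prime_ideal P -> ~ torsion_free_ideal P ->
  forall f, reduction f = 0 -> P f.
Proof.
move=> pP /not_torsion_free[r r0 Pr] f f0.
have [_|c [c0 c_gt0 /(_ tt)[g ->]]] := exists_uniform_divisor v_nontrivial
  (e := fun _ : unit => f) _; first exact: f0.
apply: idealMC; have [i iP] := valuation_exp_large c0 c_gt0 v_complete (fine (v
  (val r))).
have tR : (val r)^-1 * val c ^+ i \in valring_pred v.
  by rewrite unfold_in valuation_le_div // -(fineK (valuation_fin v r0)).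
apply: (@prime_idealX _ P _ i) => //.
have -> : itateC v n c ^+ i = itateC v n (ValRing tR) * itateC v n r.
  by rewrite -rmorphXn -rmorphM; congr itateC; apply: val_inj;
    rewrite rmorphXn /= mulrC mulVKf.
exact: idealM.
Qed.

Lemma reduced_idealP P f : prime_ideal P -> ~ torsion_free_ideal P ->
  reduced_ideal P (reduction f) <-> P f.
Proof.
move=> pP tP; split=> [[g Pg gf]|Pf]; last by exists f.
rewrite -(subrK g f); apply: idealD => //.
by apply: torsion_prime_kernel => //; rewrite reductionB gf subrr.
Qed.

Lemma prime_chain_reduced m P :
  ~ torsion_free_ideal P -> prime_chain m P -> prime_chain m (reduced_ideal P).
Proof.
apply: (@prime_chain_map _ _ (fun P => ~ torsion_free_ideal P)) =>
  [Q pQ tQ|Q Q' pQ tQ pQ' [QQ' nQ'Q]].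
  have [Q1 QM] := pQ; split=> [|p q].
    by rewrite -(rmorph1 (@reduction R K v n)) => /(reduced_idealP _ pQ tQ).
  have [f <-] := reduction_surj p; have [g <-] := reduction_surj q.
  rewrite -[_ * _](rmorphM (@reduction R K v n) f g).
  by move=> /(reduced_idealP _ pQ tQ)/QM[fQ|gQ]; [left; exists f|right;
    exists g].
have tQ' : ~ torsion_free_ideal Q'.
  by move=> flat; apply: tQ => r /QQ'; exact: flat.
split=> //; split=> [_ [f Qf <-]|sub]; first by exists f => //; exact: QQ'.
apply: nQ'Q => f Q'f; apply/(reduced_idealP _ pQ tQ); apply: sub.
by exists f.
Qed.

Lemma extension_proper P : prime_ideal P -> torsion_free_ideal P -> ~ ext P 1.
Proof. by move=> pP flat; have [] := extension_prime pP flat. Qed.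

(** Induction along the chain. If the next prime meets R, the rest of the chain lives in k[x_1..x_n]
    above the reduction of [P]. Otherwise it has its own common dimension [e], and e < d since
    extension to the Tate algebra preserves strict inclusion. *)
Lemma prime_chain_le m P d : torsion_free_ideal P ->
  has_dim (ext P) d -> has_dim (reduced_ideal P) d -> prime_chain m P ->
  (m <= d.+1)%N.
Proof.
elim: m P d => [//|m IHm] P d flat [dE d_le] [dR d_le'] [pP [Q PQ chQ]].
have pQ := prime_chain_prime chQ; rewrite ltnS.
have [flatQ|tQ] := pselect (torsion_free_ideal Q); last first.
  apply: d_le' (prime_chain_reduced tQ chQ) => _ [f Pf <-]; exists f => //.
  by case: PQ => + _; exact.
have [e [eE eR]] := tate_ideal_dim v_complete v_nontrivial (extension_proper pQ
  flatQ).
rewrite [contraction _ _]prime_saturated // in eR.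
apply: leq_trans (IHm Q e flatQ eE eR chQ) _; have [[Q0 QQ0 chQ0] _] := eE.
apply: (d_le e.+1 (ext P)) => //; split; first exact: extension_prime.
have PQext : ext P `<=` ext Q.
  by apply: extension_sub => f Pf; apply: extensionW; case: PQ => + _; exact.
exists Q0 => //; split=> [x /PQext|]; first exact: QQ0.
move=> Q0P; case: PQ => _; apply=> f Qf.
rewrite -[P](prime_saturated pP flat); apply: Q0P; apply: QQ0;
  exact: extensionW.
Qed.

(** The extra prime, on top, is pulled back from a prime of k[x_1..x_n] above the reduction of the
    last contraction. It is strictly larger because it contains a nonzero constant, which no prime
    of the Tate algebra does. *)
Lemma prime_chain_contraction_tate m (P : ideal (tate v n)) :
  prime_chain m P -> prime_chain m.+1 (contraction incl P).
Proof.
elim: m P => [|m IHm] P [pP].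
  move=> _; split; first exact: contraction_prime.
  have [P1 _] := pP.
  have [|q pq Pq] := @exists_prime _ (reduced_ideal (contraction incl P)).
    by move=> /(reduced_ideal_top v_complete v_nontrivial);
      rewrite /= /contraction_set /= rmorph1.
  exists (contraction (@reduction R K v n) q).
    split=> [f Pf|sub]; first by apply: Pq; exists f.
    have [c c0 c_gt0] := exists_pseudouniformizer v_nontrivial.
    have : contraction incl P (itateC v n c).
      apply: sub; rewrite /= /contraction_set /= reduction_eq0;
        first exact: ideal0.
      by move=> m /=; case: eqP => _ //; rewrite valuation0 ltey.
    move=> Pc; apply: P1; rewrite -(rmorph1 (tateC v n)).
    by apply: (tateC_ideal c0); rewrite -rmorphM mulr1.
  by split=> //; exact: contraction_prime.
move=> [Q [PQ nQP] chQ]; split; first exact: contraction_prime.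
exists (contraction incl Q); last exact: IHm.
split=> [f|sub]; first exact: PQ.
apply: nQP => x; have [c [f [c0 ->]]] := tate_scale_any x.
by move=> /(tateC_ideal c0)/sub Pf; exact: idealM.
Qed.

Lemma saturation_has_dim I d : torsion_free_ideal I ->
  has_dim (ext I) d -> has_dim (reduced_ideal (saturation I)) d ->
  has_dim (saturation I) d.+1.
Proof.
move=> flat [[P IP chP] d_le] [_ d_le']; split.
  exists (contraction incl P); last exact: prime_chain_contraction_tate.
  by rewrite -contraction_extension => f; exact: IP.
move=> m Q IQ chQ; have pQ := prime_chain_prime chQ.
have [flatQ|tQ] := pselect (torsion_free_ideal Q); last first.
  apply: leqW; apply: d_le' (prime_chain_reduced tQ chQ) => _ [f Pf <-].
  by exists f => //; exact: IQ.
have [e [eE eR]] := tate_ideal_dim v_complete v_nontrivial (extension_proper pQ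
  flatQ).
rewrite [contraction _ _]prime_saturated // in eR.
apply: leq_trans (prime_chain_le flatQ eE eR chQ) _;
  have [[Q0 QQ0 chQ0] _] := eE.
rewrite ltnS; apply: d_le chQ0; apply: subset_trans QQ0;
  apply: extension_sub => f If.
apply: extensionW; apply: IQ; exists 1; rewrite ?oner_neq0 //.
by rewrite rmorph1 mul1r.
Qed.

Lemma extension_top I : ext I 1 -> ~ torsion_free_ideal I.
Proof.
move=> I1 flat; have : contraction incl (ext I) 1.
  by rewrite /= /contraction_set /= rmorph1.
rewrite contraction_extension => -[r r0]; rewrite mulr1 => /flat/eqP.
by rewrite (negbTE r0).
Qed.

Lemma krull_dims I : torsion_free_ideal I ->
  krull_dim R (quotient (ext I)) =
    krull_dim R (quotient (reduced_ideal (saturation I))) /\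
  krull_dim R (quotient (reduced_ideal (saturation I))) =
    (krull_dim R (quotient (saturation I)) - 1)%E.
Proof.
move=> flat; have [d [dE dR]] : exists d, has_dim (ext I) d /\
    has_dim (reduced_ideal (saturation I)) d.
  have [|d] := @tate_ideal_dim _ _ _ v_complete v_nontrivial n (ext I).
    by move=> /extension_top.
  by rewrite [contraction _ _]contraction_extension => ?; exists d.
rewrite (krull_dim_quotient R dE) (krull_dim_quotient R dR).
rewrite (krull_dim_quotient R (saturation_has_dim flat dE dR)); split=> //.
by rewrite -EFinB -natr1 addrK.
Qed.

End IntegralDimension.

(** * Points of finite algebras *)

(** Take a spanning family of least size: a nontrivial relation would allow one member to be
    dropped. *)
Lemma finite_mod_basis (K : fieldType) (B : comPzRingType)
    (kappa : {rmorphism K -> B}) (E : ideal B) : finite_mod kappa E ->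
  exists r (s : 'I_r -> B),
    (forall b, exists c : 'I_r -> K, E (b - \sum_i kappa (c i) * s i)) /\
    (forall c : 'I_r -> K, E (\sum_i kappa (c i) * s i) -> forall i, c i = 0).
Proof.
pose spans r := `[< exists s : 'I_r -> B, forall b, exists c : 'I_r -> K,
  E (b - \sum_i kappa (c i) * s i) >].
move=> [r0 s0P]; have exr : exists r, spans r by exists r0; apply/asboolP.
case: (ex_minnP exr) => r /asboolP[s sP] rmin; exists r, s; split=> // c Ec i.
apply/eqP/negP => /negP ci; case: r s sP rmin c Ec i ci =>
  [|r] s sP rmin c Ec i ci.
  by case: i ci.
suff /rmin : spans r by rewrite ltnn.
apply/asboolP; exists (fun j => s (lift i j)) => b; have [a ab] := sP b.
exists (fun j => a (lift i j) - a i / c i * c (lift i j)).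
have sumE (x : 'I_r.+1 -> K) : \sum_j kappa (x j) * s j =
    kappa (x i) * s i + \sum_j kappa (x (lift i j)) * s (lift i j).
  rewrite (bigD1_ord i) //=.
have := idealB ab (idealN (idealM (kappa (a i / c i)) Ec)).
rewrite opprK !sumE mulrDr mulrA -rmorphM divfK //; congr (E _).
have -> : \sum_j kappa (a (lift i j) - a i / c i * c (lift i j)) * s (lift i j)
  =
    \sum_j kappa (a (lift i j)) * s (lift i j) -
    kappa (a i / c i) * \sum_j kappa (c (lift i j)) * s (lift i j).
  rewrite mulr_sumr -sumrB; apply: eq_bigr => j _.
  by rewrite rmorphB mulrBl [kappa (_ * c _)]rmorphM mulrA.
by ring.
Qed.

Section EigenLine.
Variables (Omega : closedFieldType) (r : nat) (S : set 'M[Omega]_r).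
Hypothesis S_comm : forall M N, S M -> S N -> M *m N = N *m M.

(* A minimal nonzero stable subspace lies in an eigenspace of each matrix. *)
Lemma common_eigenspace : (0 < r)%N -> exists2 W : 'M[Omega]_r, W != 0 &
  forall M, S M -> exists l, W *m M = l *: W.
Proof.
move=> r_gt0; pose stab p := `[< exists W : 'M[Omega]_r,
  [/\ \rank W = p, (0 < p)%N & forall M, S M -> (W *m M <= W)%MS] >].
have exW : exists p, stab p.
  exists r; apply/asboolP; exists 1%:M; split=> // [|M _]; first exact: mxrank1.
  exact: submx1.
case: (ex_minnP exW) => _ /asboolP[W [<- W_gt0 Wst]] Wmin.
exists W => [|M SM]; first by rewrite -mxrank_eq0 -lt0n.
(* [N] is the matrix of [M] on the row space of [W], so an eigenvector of [N] yields one of [M]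
   inside that space. *)
pose b := row_base W; pose N := b *m M *m pinvmx b.
have bM : N *m b = b *m M.
  rewrite /N mulmxKpV // (eqmxMr _ (eq_row_base W)).
  by rewrite (eq_row_base W); exact: Wst.
have /closed_rootP[l] : size (char_poly N) != 1%N.
  by rewrite size_char_poly eqSS -lt0n.
rewrite -eigenvalue_root_char => /eigenvalueP[u uN u0]; exists l.
pose W' := (W :&: eigenspace M l)%MS.
have ubM : (u *m b) *m M = l *: (u *m b) by rewrite -mulmxA -bM mulmxA uN
  scalemxAl.
have ub0 : u *m b != 0 by rewrite mulmx_free_eq0 // row_base_free.
have ubW' : (u *m b <= W')%MS.
  rewrite sub_capmx; apply/andP; split; last exact/eigenspaceP.
  by rewrite -(eq_row_base W) submxMl.
have W'M : W' *m M = l *: W' by apply/eigenspaceP; exact: capmxSr.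
have : (\rank W <= \rank W')%N.
  apply: Wmin; apply/asboolP; exists W'; split=> // [|M' SM'].
    by apply: leq_trans (mxrankS ubW'); rewrite lt0n mxrank_eq0.
  rewrite sub_capmx; apply/andP; split.
    by apply: submx_trans (submxMr _ (capmxSl _ _)) (Wst _ SM').
  by apply/eigenspaceP; rewrite -mulmxA (S_comm SM' SM) mulmxA W'M scalemxAl.
move=> WW'; apply/eigenspaceP; apply: submx_trans (capmxSr W _).
by have /leqifP := mxrank_leqif_sup (capmxSl W (eigenspace M l));
  case: ifP => //;
  rewrite ltnNge WW'.
Qed.

End EigenLine.

(** The character is the eigenvalue of the commuting multiplication matrices on a common eigenspace
    over [Omega]. This avoids choosing a maximal ideal and embedding its residue field. *)
Lemma finite_algebra_point (K : fieldType) (B : comNzRingType)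
    (kappa : {rmorphism K -> B}) (E : ideal B) (Omega : closedFieldType)
    (beta : {rmorphism K -> Omega}) :
  ~ E 1 -> finite_mod kappa E -> exists chi : {rmorphism B -> Omega},
    (forall c, chi (kappa c) = beta c) /\ forall f, E f -> chi f = 0.
Proof.
move=> E1 /finite_mod_basis[r [s [sP s_free]]].
have /choice[c cP] (fi : B * 'I_r) := sP (fi.1 * s fi.2).
pose M f := \matrix_(i, j) c (f, i) j.
have MP f i : E (f * s i - \sum_j kappa (M f i j) * s j).
  by have := cP (f, i); under eq_bigr do rewrite -(mxE matrix_key (fun i j =>
    c (f, i) j)).
(* Independence of the basis makes the matrix of multiplication unique, so [M] respects differences,
   products and constants. *)
have Muniq f (A : 'M[K]_r) :
    (forall i, E (f * s i - \sum_j kappa (A i j) * s j)) -> M f = A.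
  move=> AP; apply/matrixP => i j; apply/eqP; rewrite -subr_eq0; apply/eqP.
  apply: (s_free (fun j => M f i j - A i j)).
  under eq_bigr do rewrite rmorphB mulrBl.
  rewrite sumrB; apply: ideal_trans (AP i); apply: idealBC; exact: MP.
have MB f g : M (f - g) = M f - M g.
  apply: Muniq => i; under eq_bigr do rewrite !mxE rmorphB mulrBl.
  have := idealB (MP f i) (MP g i); congr (E _).
  rewrite sumrB; under eq_bigr do rewrite mxE;
    under [in X in _ - X = _]eq_bigr do rewrite mxE.
  by ring.
have MM f g : M (f * g) = M f *m M g.
  apply: Muniq => i; under eq_bigr do rewrite mxE rmorph_sum mulr_suml.
  rewrite exchange_big /=; apply: (@ideal_trans _ _ (\sum_k kappa (M f i k) *
    (g * s k))).
    have := idealM g (MP f i); congr (E _); rewrite mulrBr mulr_sumr;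
      congr (_ - _).
      by ring.
    by apply: eq_bigr => k _; rewrite mulrCA.
  rewrite -sumrB; apply: ideal_sum => k _.
  have := idealM (kappa (M f i k)) (MP g k); congr (E _).
  rewrite mulrBr mulr_sumr; congr (_ - _); apply: eq_bigr => j _.
  by rewrite rmorphM mulrA.
have MC x : M (kappa x) = x%:M.
  apply: Muniq => i; rewrite (bigD1 i) //= big1 => [|j /negbTE ji].
    by rewrite mxE eqxx addr0 subrr; exact: ideal0.
  by rewrite mxE eq_sym ji rmorph0 mul0r.
have ME f : E f -> M f = 0.
  move=> Ef; apply: Muniq => i; rewrite big1 => [|j _];
    last by rewrite mxE rmorph0 mul0r.
  by rewrite subr0; exact: idealMC.
have r_gt0 : (0 < r)%N.
  rewrite lt0n; apply/eqP => r0; apply: E1; have [a] := sP 1.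
  by rewrite big1 ?subr0 // => i; move: (ltn_ord i); rewrite {2}r0.
have [_ _ [f _ <-] [g _ <-]|W W0 WP] :=
  @common_eigenspace Omega r [set map_mx beta (M f) | f in setT] _ r_gt0.
  by rewrite -!map_mxM -!MM mulrC.
have /choice[chi chiP] f : exists l, W *m map_mx beta (M f) = l *: W.
  by apply: WP; exists f.
have chi_uniq f l : W *m map_mx beta (M f) = l *: W -> chi f = l.
  rewrite chiP => /eqP; rewrite -subr_eq0 -scalerBl scaler_eq0 (negbTE W0) orbF.
  by rewrite subr_eq0 => /eqP.
have chiC x : chi (kappa x) = beta x.
  by apply: chi_uniq; rewrite MC map_scalar_mx mul_mx_scalar.
have chiB : zmod_morphism chi.
  by move=> f g; apply: chi_uniq; rewrite MB map_mxB mulmxBr !chiP scalerBl.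
have chiM : monoid_morphism chi.
  split=> [|f g]; first by rewrite -(rmorph1 kappa) chiC rmorph1.
  apply: chi_uniq; rewrite MM map_mxM mulmxA chiP -scalemxAl chiP scalerA.
  by [].
pose chi' : {rmorphism B -> Omega} :=
  HB.pack chi (GRing.isZmodMorphism.Build _ _ chi chiB)
    (GRing.isMonoidMorphism.Build _ _ chi chiM).
exists chi'; split=> // f Ef; apply: chi_uniq.
by rewrite (ME f Ef) map_mx0 mulmx0 scale0r.
Qed.

(** * Finiteness conditions *)

Lemma module_finiteP (A B : comPzRingType) (psi : {rmorphism A -> B}) (J :
  ideal B) :
  module_finite (quotient_map J \o psi) <-> finite_mod psi J.
Proof.
split=> [[s sP]|[r [s sP]]].
  have /choice[t tE] i : exists x, s`_i = quotient_map J x by exact: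
    quotient_map_surj.
  exists (size s), (fun i => t i) => b; have [c cE] := sP (quotient_map J b).
  exists c; apply/quotient_map_eq; rewrite cE rmorph_sum; apply: eq_bigr => i _.
  by rewrite rmorphM tE.
have sz : r = size [seq quotient_map J (s i) | i : 'I_r].
  by rewrite size_map size_enum_ord.
exists [seq quotient_map J (s i) | i : 'I_r] => q.
have [b ->] := quotient_map_surj q; have [c /quotient_map_eq ->] := sP b.
exists (fun i => c (cast_ord (esym sz) i)); rewrite rmorph_sum.
rewrite [RHS](reindex (cast_ord sz)) /=; last first.
  by exists (cast_ord (esym sz)) => i _; rewrite (cast_ordK, cast_ordKV).
apply: eq_bigr => i _; rewrite rmorphM cast_ordK (nth_map i) ?size_enum_ord //.
by rewrite nth_ord_enum.
Qed.

Lemma field_has_dim (K : fieldType) : has_dim (zero_ideal K) 0.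
Proof.
split.
  exists (zero_ideal K) => //; split=> //; split=> [|x y /= /eqP].
    by apply/eqP; exact: oner_neq0.
  by rewrite mulf_eq0 => /orP[]/eqP; [left|right].
move=> [//|m] P _ [_ [Q [_ nQP] /prime_chain_prime[Q1 _]]]; case: nQP => x Qx.
have [->|x0] := eqVneq x 0; first exact: ideal0.
by case: Q1; rewrite -(mulVf x0); exact: idealM.
Qed.

Lemma has_dim_unique (A : comPzRingType) (J : ideal A) d e :
  has_dim J d -> has_dim J e -> d = e.
Proof.
move=> [[P JP chP] d_le] [[Q JQ chQ] e_le]; apply/eqP.
by rewrite eqn_leq (e_le _ _ JP chP) (d_le _ _ JQ chQ).
Qed.

Lemma has_dim0_no_chain (A : comPzRingType) (J P Q : ideal A) : has_dim J 0 ->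
  J `<=` P -> prime_ideal P -> prime_ideal Q -> ~ P `<` Q.
Proof.
by move=> [_ d_le] JP pP pQ PQ; have := d_le 1%N P JP (conj pP (ex_intro2 _ _ Q
  PQ (conj pQ I))).
Qed.

(** A positive number of normalization variables would produce a strict inclusion of primes above
    [J]; with none, the source of the finite map is k itself. *)
Lemma no_chain_finite (k : fieldType) n (J : ideal (mpoly n k)) :
  (forall P Q : ideal (mpoly n k), J `<=` P -> prime_ideal P -> prime_ideal Q ->
     ~ P `<` Q) -> finite_mod (@mpolyC n k) J.
Proof.
move=> nch; have [J1|J1] := pselect (J 1).
  by exists 0%N, (fun=> 0) => b; exists (fun=> 0); exact: ideal_top.
have [d [y [fin inj _ _]]] := noether_normalization J1.
case: d y fin inj => [|d] y fin inj.
  have [r [s sP]] := fin; exists r, s => b; have [c cP] := sP b.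
  exists (fun i => mcoeff mnm0 (c i)); move: cP; congr (J (_ - _)).
  by apply: eq_bigr => i _; rewrite {1}(mpoly0_const (c i)) /= mmapC.
have [[P JP [pP [Q PQ /prime_chain_prime pQ]]] _] := noether_dim fin inj.
by case: (nch P Q JP pP pQ PQ).
Qed.

Section Finiteness.
Variables (R : realType) (K : fieldType) (v : valuation R K).
Hypotheses (v_complete : valuation_complete v) (v_nontrivial :
  valuation_nontrivial v).
Variables (n : nat) (I : ideal (itate v n)).

Let incl : {rmorphism itate v n -> tate v n} := itate_incl v n.
Let Ie := extension incl I.
Let Iec := saturation I.
Let Ibar := reduced_ideal Iec.

Let Iec_Ie f : Iec f <-> Ie (incl f).
Proof. by rewrite -[Iec]contraction_extension. Qed.

(** The lifting of finiteness with no normalization variables: series in zero variables are the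
    constants of R. *)
Lemma residue_finite_lift :
  finite_mod (@mpolyC n (residue_field v)) Ibar -> finite_mod (itateC v n) Iec.
Proof.
move=> [r [s sP]]; pose y (i : 'I_0) : mpoly n (residue_field v) := 0.
have [phi [Phi [PhiE phiC _ Phi_red]]] := lift_substitution v_complete y.
have PhiC c : Phi (itateC v 0 c) = itateC v n c.
  by apply: itate_incl_inj; rewrite PhiE; exact: phiC.
have [|q [t tP]] := lift_finite v_complete v_nontrivial PhiC Phi_red (I := Iec).
  exists r, s => b; have [c cP] := sP b; exists (fun i => mpolyC 0 (c i)).
  by under eq_bigr do rewrite /= mmapC.
exists q, t => b; have [c cP] := tP b; exists (fun i => itate_coef (c i) mnm0).
move: cP; congr (Iec (_ - _)); apply: eq_bigr => i _; congr (_ * _).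
transitivity (Phi (itateC v 0 (itate_coef (c i) mnm0))); last exact: PhiC.
congr (Phi _); apply: itate_incl_inj; apply: tate_eqP => m;
  have -> : m = mnm0 by apply/mnmP => -[].
by rewrite /= eqxx.
Qed.

Lemma integral_finite_extension :
  finite_mod (itateC v n) Iec -> finite_mod (tateC v n) Ie.
Proof.
move=> [r [S SP]]; exists r, (fun l => incl (S l)) => f.
have [c [g [_ ->]]] := tate_scale_any f; have [a aP] := SP g.
exists (fun l => c * val (a l)).
have -> : \sum_l tateC v n (c * val (a l)) * incl (S l) =
    tateC v n c * incl (\sum_l itateC v n (a l) * S l).
  rewrite rmorph_sum mulr_sumr; apply: eq_bigr => l _.
  by rewrite !rmorphM mulrA.
by rewrite -mulrBr -rmorphB; apply: idealM; apply/Iec_Ie.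
Qed.

Lemma Ie_top : Ie 1 -> Ibar 1.
Proof.
move=> Ie1; exists 1; last exact: rmorph1.
by apply/Iec_Ie; rewrite rmorph1.
Qed.

(** If I^e is proper, finiteness over the field K gives dimension 0, and the reduction has the same
    dimension. *)
Lemma affinoid_finite_no_chain : finite_mod (tateC v n) Ie ->
  forall P Q : ideal (mpoly n (residue_field v)),
    Ibar `<=` P -> prime_ideal P -> prime_ideal Q -> ~ P `<` Q.
Proof.
move=> fin P Q IP pP pQ.
have Ie1 : ~ Ie 1 by move=> /Ie_top/IP P1; case: pP.
have [d [dE]] := tate_ideal_dim v_complete v_nontrivial Ie1.
rewrite [contraction _ _]contraction_extension => dR.
have inj : injective_mod (tateC v n) Ie.
  move=> c Ic; apply/eqP/negP => /negP c0; apply: Ie1; apply: (tateC_ideal c0).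
  by rewrite mulr1.
have d0 : d = 0%N.
  apply: has_dim_unique dE _.
  exact: (@has_dim_finite K (tate v n) (tateC v n) Ie fin 0%N inj
    (field_has_dim K)).
by rewrite d0 in dR; exact: has_dim0_no_chain dR IP pP pQ.
Qed.

End Finiteness.

(** * Zeros in the completed algebraic closure *)

Lemma poly_roots_finite (L : fieldType) (p : {poly L}) : p != 0 ->
  exists s : seq L, forall x, root p x -> x \in s.
Proof.
move: {2}(size p).+1 (ltnSn (size p)) => m; elim: m p => // m IHm p sp p0.
have [[a pa]|norr] := pselect (exists a, root p a); last first.
  by exists [::] => x px; case: norr; exists x.
have /factor_theorem[q pE] := pa.
have q0 : q != 0 by apply: contra_neq p0 => q0; rewrite pE q0 mul0r.
have [|s sP] := IHm q _ q0.
  by move: sp; rewrite pE size_mul ?polyXsubC_eq0 // size_XsubC addn2.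
exists (a :: s) => x; rewrite pE rootM root_XsubC inE => /orP[/sP -> |->//].
by rewrite orbT.
Qed.

Lemma finite_set_roots (L : fieldType) n (A : set ('I_n -> L)) (p : 'I_n ->
  {poly L}) :
  (forall i, p i != 0) -> (forall x i, A x -> root (p i) (x i)) -> finite_set A.
Proof.
move=> p0 Ap; have /choice[s sP] i := poly_roots_finite (p0 i).
pose S := flatten [seq s i | i : 'I_n].
have xS x i : A x -> x i \in S.
  move=> /(Ap _ i)/sP xs; apply/flattenP; exists (s i) => //; exact: codom_f.
pose F (g : {ffun 'I_n -> 'I_(size S)}) : 'I_n -> L := fun i => S`_(g i).
apply: (@sub_finite_set _ _ (F @` setT)) => [x Ax|]; last first.
  by apply: finite_image; exact: finite_finset.
have iS i : (index (x i) S < size S)%N by rewrite index_mem; exact: xS.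
exists [ffun i => Ordinal (iS i)] => //; apply/funext => i.
by rewrite /F ffunE /= nth_index //; exact: xS.
Qed.

(** Valuation rings are integrally closed: if w(t) < 0, dividing the equation by the leading power
    of t writes 1 as 1/t times an integral element. *)
Lemma valuation_ge0_integral (R : realType) (L : fieldType) (w : valuation R L)
    (p : {poly L}) t :
  p \is monic -> (forall i, (0 <= w p`_i)%E) -> p.[t] = 0 -> (0 <= w t)%E.
Proof.
move=> pm pw pt; rewrite leNgt; apply/negP => wt.
have t0 : t != 0 by apply/eqP => t0; move: wt; rewrite t0 valuation0.
have wV : (0 < w t^-1%R)%E.
  by rewrite -[(t^-1)%R]mulr1 valuation_lt_div // valuation1.
have wVX m : (0 <= w (t^-1 ^+ m)%R)%E.
  elim: m => [|m IHm]; first by rewrite valuation1.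
  by rewrite exprS valuationM adde_ge0 // ltW.
have sp : size p = (size p).-1.+1 by rewrite prednK // size_poly_gt0 monic_neq0.
set N := (size p).-1 in sp; have pN : p`_N = 1 by move/monicP: pm.
have : (0 < w 1%R)%E; last by rewrite valuation1 ltxx.
have E : (1 : L) = t^-1 * - \sum_(i < N) p`_i * t^-1 ^+ (N - i.+1).
  move: pt; rewrite horner_coef sp big_ord_recr /= pN mul1r => /eqP.
  rewrite addrC addr_eq0 => /eqP/(congr1 (fun z => z * t^-1 ^+ N)).
  rewrite -exprMn mulfV // expr1n => ->; rewrite mulrN mulNr; congr (- _).
  rewrite mulr_suml mulr_sumr; apply: eq_bigr => i _.
  rewrite -mulrA [RHS]mulrCA; congr (_ * _); rewrite -exprS subnSK // exprVn.
  by rewrite -exprVn -{2}(subnKC (ltnW (ltn_ord i))) exprD mulrA -exprMn mulfV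
    // expr1n mul1r.
rewrite E valuationM; apply: (lt_le_trans wV); rewrite leeDl // valuationN.
by apply: valuation_ge_sum => i _; rewrite valuationM adde_ge0.
Qed.

Section Points.
Variables (R : realType) (K : fieldType) (v : valuation R K).
Hypotheses (v_complete : valuation_complete v) (v_nontrivial :
  valuation_nontrivial v).
Variables (n : nat) (C : completed_algebraic_closure v).

Let w := cac_val C.
Let wF := field_filtration (@cac_complete _ _ _ C).
Let iota : {rmorphism K -> cac_field C} := cac_incl C \o cac_base C.

Lemma iota_val c : w (iota c) = v c.
Proof. exact: cac_extends. Qed.

Lemma tate_partial_sumE (f : tate v n) (x : 'I_n -> cac_field C) :
  tate_partial_sum f x = fun N => mmap iota x (ps_trunc N f).
Proof.
apply/funext => N; rewrite /tate_partial_sum /ps_trunc rmorph_sum.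
by apply: eq_bigr => m _; rewrite /= mmapZ mmapX.
Qed.

Lemma tate_evaluation (x : 'I_n -> cac_field C) : (forall i,
  (0 <= w (x i))%E) ->
  exists ev : {rmorphism tate v n -> cac_field C},
  [/\ forall p, ev (tate_poly v p) = mmap iota x p,
      forall (M : R) f, gauss_ge M f -> (M%:E <= w (ev f))%E
    & forall f, tate_eval f x (ev f)].
Proof.
move=> x0; have [|ev [evP ev_b ev_cvg]] :=
  @tate_substitution R K v n (cac_field C) wF iota x _ x0.
  by move=> M c Mc; rewrite /= [w _]iota_val.
exists ev; split=> // f; rewrite /tate_eval tate_partial_sumE; exact: ev_cvg.
Qed.

Lemma tate_eval_unique (f : tate v n) x y y' :
  tate_eval f x y -> tate_eval (C := C) f x y' -> y = y'.
Proof. exact: (@filtered_cvg_unique _ _ wF). Qed.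

(** Each variable satisfies a monic equation over K modulo I^e, so the coordinates of the zeros are
    among the roots of n fixed polynomials. *)
Lemma finite_integral_zeros (I : ideal (itate v n)) :
  finite_mod (tateC v n) (extension (itate_incl v n) I) ->
  finite_set (integral_zeros C I).
Proof.
move=> fin; pose X i := tate_poly v (mpolyX K (mnm1 i : multinom n)).
have /choice[p pP] i : exists p : {poly K}, p \is monic /\
    extension (itate_incl v n) I (map_poly (tateC v n) p).[X i].
  by have [p pm pI] := finite_mod_integral (X i) fin; exists p.
apply: (@finite_set_roots _ _ _ (fun i => map_poly iota (p i))) =>
  [i|x i [x0 xI]].
  by rewrite monic_neq0 // map_monic; have [] := pP i.
have [ev [evP _ evE]] := tate_evaluation x0.
have evI f : extension (itate_incl v n) I f -> ev f = 0.
  apply: (@extension_sub _ _ (itate_incl v n) I (contraction ev (zero_ideal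
    _))).
  move=> g Ig; exact: tate_eval_unique (evE _) (xI g Ig).
have [_ /evI] := pP i; rewrite /root => <-.
rewrite -horner_map /= -map_poly_comp /= evP mmapX1.
apply/eqP; congr (_.[_]); apply: eq_map_poly => c /=.
by rewrite -tate_polyC evP mmapC.
Qed.

(* Specializing the normalization variables at a gives a nonzero finite
   K-algebra; a point psi of it has integral values because itate v n is
   integral over itate v d modulo I, hence psi is continuous, i.e. an
   evaluation. *)
Lemma integral_zero_over (I : ideal (itate v n)) d
    (phi : {rmorphism tate v d -> tate v n})
    (Phi : {rmorphism itate v d -> itate v n}) (a : 'I_d -> valring v) :
  (forall f, itate_incl v n (Phi f) = phi (itate_incl v d f)) ->
  (forall c, phi (tateC v d c) = tateC v n c) ->
  finite_mod phi (extension (itate_incl v n) I) ->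
  injective_mod phi (extension (itate_incl v n) I) ->
  finite_mod Phi (contraction (itate_incl v n) (extension (itate_incl v n) I))
    ->
  exists2 x, integral_zeros C I x & forall i,
    tate_eval (phi (tate_poly v (mpolyX K (mnm1 i)))) x (iota (val (a i))).
Proof.
set incl := itate_incl v n; set Ie := extension incl I => PhiE phiC fin inj Fin.
have [|ev [evP ev_b _]] := @tate_substitution R K v d K (field_filtration
  v_complete)
    idfun (fun i => val (a i)) (fun M c Mc => Mc).
  by move=> i; exact: valring_ge0.
have evC c : ev (tateC v d c) = c by rewrite -tate_polyC evP mmapC.
pose p := contraction ev (zero_ideal K); pose E := idealU Ie (extension phi p).
(* Otherwise Nakayama's argument and the injectivity of [phi] would put a power of 1 in the kernel
   [p] of the specialization. *)
have E1 : ~ E 1.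
  rewrite -(rmorph1 phi) => E1.
  have [|m] := finite_mod_extension fin _ E1.
    by move=> f /inj ->; exact: ideal0.
  by rewrite expr1n /= /contraction_set /= rmorph1; apply/eqP; exact: oner_neq0.
have phi_ev f : E (phi f - tateC v n (ev f)).
  rewrite -phiC -rmorphB; apply: idealU_r; apply: extensionW.
  by rewrite /= /contraction_set /= rmorphB evC subrr.
have E_fin : finite_mod (tateC v n) E.
  have [r [S SP]] := fin; exists r, S => f; have [c cP] := SP f.
  exists (fun l => ev (c l)).
  apply: (@ideal_trans _ _ (\sum_l phi (c l) * S l)); first exact: idealU_l.
  rewrite -sumrB; apply: ideal_sum => l _; rewrite -mulrBl; exact: idealMC.
have [chi [chiC chiE]] := finite_algebra_point (cac_base C) E1 E_fin.
pose psi : {rmorphism tate v n -> cac_field C} := cac_incl C \o chi.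
have psiC c : psi (tateC v n c) = iota c by rewrite /psi /= chiC.
have psiE f : E f -> psi f = 0 by move=> Ef; rewrite /psi /= chiE ?rmorph0.
have psi_phi f : psi (phi f) = iota (ev f).
  by apply/eqP; rewrite -psiC -subr_eq0 -rmorphB psiE.
have psi_int (g : itate v n) : (0 <= w (psi (incl g)))%E.
  have [q qm /(@idealU_l _ Ie (extension phi p))/psiE qg] :=
    finite_mod_integral g Fin.
  apply: (@valuation_ge0_integral _ _ w (map_poly (psi \o incl \o Phi) q)).
  - exact: monic_map.
  - move=> i; rewrite coef_map.
    have E' : psi (incl (Phi q`_i)) = iota (ev (itate_incl v d q`_i)).
      by rewrite -psi_phi; exact: (congr1 (fun f => psi f) (PhiE _)).
    by rewrite [X in w X]E' iota_val; apply: (ev_b 0) => m; exact: itate_ge0.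
  - transitivity ((map_poly (psi \o incl) (map_poly Phi q)).[(psi \o incl) g]).
      by rewrite -map_poly_comp.
    rewrite horner_map; exact: qg.
pose X i : itate v n := itateX v i.
pose x i := psi (incl (X i)).
have [|ev_x [ev_xP ev_xb ev_xE]] := @tate_evaluation x.
  by move=> i; exact: psi_int.
(* Write [f] as a polynomial plus c^i times an integral series: both maps agree on the polynomial
   and have integral values on the series, so they differ by at most c^i. *)
have psi_ev f : psi f = ev_x f.
  apply/eqP; rewrite -subr_eq0; apply/eqP/(@valuation_separated _ _ w) => M.
  have [c c0 c_gt0] := exists_pseudouniformizer v_nontrivial.
  have [i iM] := valuation_exp_large c0 c_gt0 v_complete M.
  have ci0 : val c ^+ i != 0 by rewrite expf_neq0.
  have /fineK vci := valuation_fin v ci0.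
  have [N /(_ N (leqnn _)) fN] := tate_dense f (fine (v (val c ^+ i))).
  have [m|g gE] := @itate_lift _ _ v n (tateC v n (val c ^+ i)^-1 *
      (f - tate_poly v (ps_trunc N f))).
    by rewrite tateC_coef valuation_le_div // -vci.
  have fE : f = tate_poly v (ps_trunc N f) + tateC v n (val c ^+ i) * incl g.
    rewrite -[incl g]/(itate_incl v n g) gE mulrA -rmorphM mulfV // rmorph1
      mul1r.
    by rewrite addrC subrK.
  have poly_eq q : psi (tate_poly v q) = ev_x (tate_poly v q).
    apply: (@rmorph_mpoly_eq n K _ (psi \o tate_poly v) (ev_x \o tate_poly v)).
      move=> b; rewrite -[LHS]/(psi (tate_poly v (mpolyC n b))).
      rewrite -[RHS]/(ev_x (tate_poly v (mpolyC n b))) ev_xP mmapC.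
      by rewrite tate_polyC psiC.
    move=> j; rewrite -[RHS]/(ev_x (tate_poly v (mpolyX K (mnm1 j)))) ev_xP
      mmapX1.
    by [].
  have ev_xC b : ev_x (tateC v n b) = iota b by rewrite -tate_polyC ev_xP mmapC.
  rewrite fE !rmorphD !rmorphM psiC ev_xC poly_eq opprD addrACA subrr add0r
    -mulrBr.
  rewrite valuationM iota_val; apply: (le_trans iM); rewrite leeDl //.
  apply: valuation_geD; first exact: psi_int.
  by rewrite valuationN; apply: ev_xb => m; exact: itate_ge0.
exists x => [|i].
  split=> [i|f If]; first exact: psi_int.
  have <- : ev_x (incl f) = 0; last exact: ev_xE.
  by rewrite -psi_ev psiE //; apply: idealU_l; exact: extensionW.
have <- : ev_x (phi (tate_poly v (mpolyX K (mnm1 i)))) = iota (val (a i)).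
  by rewrite -psi_ev psi_phi evP mmapX1.
exact: ev_xE.
Qed.

(** The normalization variables are given the values c^j. These are pairwise distinct, so the zeros
    above them are too, being told apart by the value of the first variable. *)
Lemma integral_zeros_infinite (I : ideal (itate v n)) d
    (phi : {rmorphism tate v d.+1 -> tate v n})
    (Phi : {rmorphism itate v d.+1 -> itate v n}) :
  (forall f, itate_incl v n (Phi f) = phi (itate_incl v d.+1 f)) ->
  (forall c, phi (tateC v d.+1 c) = tateC v n c) ->
  finite_mod phi (extension (itate_incl v n) I) ->
  injective_mod phi (extension (itate_incl v n) I) ->
  finite_mod Phi (contraction (itate_incl v n) (extension (itate_incl v n) I))
    ->
  ~ finite_set (integral_zeros C I).
Proof.
move=> PhiE phiC fin inj Fin.
have [c c0 c_gt0] := exists_pseudouniformizer v_nontrivial.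
have /choice[x xP] (j : nat) : exists x, integral_zeros C I x /\
    tate_eval (phi (tate_poly v (mpolyX K (mnm1 ord0)))) x (iota (val c ^+ j)).
  have [x xI xE] := integral_zero_over (fun=> c ^+ j) PhiE phiC fin inj Fin.
  by exists x; split=> //; rewrite -rmorphXn.
have c_pow j : val c ^+ j.+1 != 1.
  apply/eqP => cj; have : (0 < v (val c ^+ j.+1)%R)%E.
    rewrite exprS valuationM; apply: lt_le_trans c_gt0 _; rewrite leeDl //.
    by rewrite -rmorphXn valring_ge0.
  by rewrite cj valuation1 ltxx.
have x_inj : injective x.
  move=> i j xij; have [_ Ei] := xP i; have [_ Ej] := xP j.
  rewrite xij in Ei; have := tate_eval_unique Ei Ej.
  move=> /(fmorph_inj iota).
  wlog ij : i j {Ei Ej xij} / (i <= j)%N => [wl|].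
    by case/orP: (leq_total i j) => [/wl//|/wl h /esym/h].
  rewrite -(subnKC ij) exprD -{1}[val c ^+ i]mulr1 => /mulfI.
  rewrite expf_neq0 // => /(_ isT)/esym; case: (j - i)%N => [|k];
    first by rewrite addn0.
  by move/eqP; rewrite (negbTE (c_pow k)).
move=> finI; apply: infinite_nat.
have -> : [set: nat] = x @^-1` integral_zeros C I.
  by apply/seteqP; split=> // j _; have [] := xP j.
apply: finite_preimage finI; exact: in2W.
Qed.

End Points.

(** Condition 1 involves a choice of completed algebraic closure, so it is kept out of the cycle and
    compared with condition 2 for every choice. *)
Theorem theorem2p4 (R : realType) (K : fieldType) (v : valuation R K)
    (v_complete : valuation_complete v) (v_nontrivial : valuation_nontrivial v)
    (n : nat) (I : ideal (itate v n)) :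
  let Ie : ideal (tate v n) := extension (itate_incl v n) I in
  let Iec : ideal (itate v n) := saturation I in
  let k := residue_field v in
  let Ibar : ideal (mpoly n k) := reduced_ideal Iec in
  let V := vanishing_locus (ideal_set Ibar) in
  let c1 (Kc : completed_algebraic_closure v) :=
    finite_set (integral_zeros Kc I) in
  let c2 := V = set0 \/ zariski_dim R V = 0%E in
  let c3 := module_finite (quotient_map Ibar \o mpolyC n (R := k)) in
  let c4 := module_finite (quotient_map Iec \o itateC v n) in
  let c5 := module_finite (quotient_map Ie \o tateC v n) in
  ((forall r : valring v, I (itateC v n r) -> r = 0) ->
     krull_dim R (quotient Ie) = krull_dim R (quotient Ibar) /\
     krull_dim R (quotient Ibar) = (krull_dim R (quotient Iec) - 1)%E) /\
  ([<-> c2; c3; c4; c5] /\ forall Kc, c1 Kc <-> c2).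
Proof.
move=> Ie Iec k Ibar V c1 c2 c3 c4 c5.
have c23 : c2 -> c3.
  by move=> /zariski_dim0P/no_chain_finite fin; apply/module_finiteP.
have c34 : c3 -> c4.
  move=> /module_finiteP fin; apply/module_finiteP.
  exact: (@residue_finite_lift _ _ _ v_complete v_nontrivial n I fin).
have c45 : c4 -> c5.
  by move=> /module_finiteP fin; apply/module_finiteP;
    exact: integral_finite_extension.
have c52 : c5 -> c2.
  move=> /module_finiteP fin; apply/zariski_dim0P.
  exact: affinoid_finite_no_chain.
split; first exact: krull_dims.
split; first by tfae.
move=> Kc; split=> [fin1|/c23/c34/c45/module_finiteP fin]; last first.
  exact: finite_integral_zeros.
(* If I^e is the unit ideal, so is the reduction, and no prime lies above it. *)
have [Ie1|Ie1] := pselect (Ie 1).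
  apply/zariski_dim0P => P Q JP [P1 _]; case: P1; apply: JP; exact: Ie_top.
have [[|d] [y [phi [Phi [PhiE phiC [yfin yinj] [fin inj Fin] _]]]]] :=
  tate_normalization v_complete v_nontrivial Ie1.
  apply/zariski_dim0P => P Q; apply: has_dim0_no_chain.
  by have := noether_dim yfin yinj; rewrite [contraction _
    _]contraction_extension.
by case: (integral_zeros_infinite v_complete v_nontrivial PhiE phiC fin inj Fin
  fin1).
Qed.
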